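(* For all sufficiently large integers $q$, $$f(q)\le 8q^2+212q+1404,$$ where $f(q)$ is the least integer such that every $f(q)$-connected graph has a $q$-connected orientation. In particular, $f(q)\le(8+o(1))q^2$ as $q\to\infty$.
   Context: All graphs are finite and simple. For a positive integer $k$, a graph $G$ is $k$-connected if $|V(G)|\ge k+1$ and $G-S$ is connected for every $S\subseteq V(G)$ with $|S|<k$. An orientation of a graph (assigning one direction to each edge) is $q$-connected if the resulting digraph has at least $q+1$ vertices and remains strongly connected after the deletion of any set of fewer than $q$ vertices. *)

(* Defs.v *)
From mathcomp Require Import all_boot.

Set Implicit Arguments.
Unset Strict Implicit.
Unset Printing Implicit Defensive.

Record sgraph := SGraph {
  vertex :> finType;
  edge : rel vertex;
  edge_sym : symmetric edge;
  edge_irrefl : irreflexive edge }.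

Section Connectivity.
Variable V : finType.
Implicit Types (r : rel V) (S : {set V}).

Definition del r S : rel V :=
  [rel x y | [&& x \notin S, y \notin S & r x y]].

(* All ordered pairs of remaining vertices are joined by a path: this is
   strong connectivity of the digraph [r] minus [S], and plain connectivity
   when [r] is symmetric. *)
Definition connected_minus r S : Prop :=
  forall x y, x \notin S -> y \notin S -> connect (del r S) x y.

Definition k_connected_rel r (k : nat) : Prop :=
  k.+1 <= #|V| /\ forall S, #|S| < k -> connected_minus r S.

End Connectivity.

Definition k_connected (k : nat) (G : sgraph) : Prop :=
  k_connected_rel (@edge G) k.

Definition orientation (G : sgraph) (d : rel G) : Prop :=
  (forall x y, d x y -> edge x y) /\
  (forall x y, edge x y -> d x y (+) d y x).

Definition has_k_connected_orientation (q : nat) (G : sgraph) : Prop :=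
  exists d : rel G, orientation d /\ k_connected_rel d q.

Definition forces_orientation (q k : nat) : Prop :=
  forall G : sgraph, k_connected k G -> has_k_connected_orientation q G.

(* [k]-connectivity is only meant for positive [k], so the least value is
   taken among positive integers. *)
Definition is_least_forcing (q m : nat) : Prop :=
  [/\ 0 < m, forces_orientation q m &
      forall k, 0 < k -> forces_orientation q k -> m <= k].

(* Main.v *)
Require Import Defs.
From mathcomp Require Import all_boot all_order all_algebra.
From mathcomp Require Import zify ring lra.
From Stdlib Require Import Classical.

(* Put d = 2q - 1 and let r be the rank of the generic d-dimensional rigidity
   matroid on pairs of vertices, so that r(K_W) = d|W| - dq when |W| >= d.  If an
   independent edge set is oriented so that every vertex of X is the tail of d of
   its edges, and all these edges stay in X u S, then d|X| <= d|X u S| - dq, that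
   is |S| >= q.  So two disjoint bases, one oriented with out-degrees d and one
   with in-degrees d, are an obstacle to every separation of order < q; the missing
   dq arcs of each base are spared by contracting a vertex set V0 that already
   carries a q-connected orientation.  By Edmonds' theorem the bases exist if all
   flats F satisfy 2 r(F) + |E \ F| >= 2 r(E), which follows for 8q^2-connected
   graphs from a lower bound on r(F), an average over the orderings of the vertices.

   It remains to find V0.  If some induced subgraph has large edge expansion, every
   balanced orientation of it is q-connected.  Otherwise all vertex sets of size at
   most N = 2^(q/60) span few edges.  Then some large induced subgraph has minimum
   degree at least 9q^2/2 and no small separation into two sides of size >= N, and
   about q + 2 disjoint bases fit in it after the removal of q/2 of its vertices
   (hubs).  The arcs missing in a pair of bases are supplied by a hub, so a
   separation of order < q would have to contain all the hubs, and the last pair of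
   bases excludes this. *)

Set Implicit Arguments.
Unset Strict Implicit.
Unset Printing Implicit Defensive.

(** * Matroid rank functions and disjoint bases *)

Section MatroidRank.
Variable E : finType.
Implicit Types (A B F I : {set E}) (x y z : E).

(** The choice d = 2q - 1 makes D = C(d+1,2) equal to dq, so the rank deficit D of a complete graph
    is worth exactly q vertices. The obstacle in every rank estimate is a vertex whose neighbours in
    the flat, a in number, form a clique: averaging credits it with only d - D/(a+1) when a >= d. If
    b > 0 edges outside the flat meet it, their halves pay for the loss; if there are none, it is
    deleted instead, which lowers the rank by at least d. For two bases the payment suffices when
    b(a+1) >= 4D, and this follows from a + b >= 4D and b >= 1. Hence the connectivity 8q^2 >= 4D.
    The exponent q/60 has this origin: without a 3q-expanding subgraph, a vertex set W spans at most
    3q|W|log|W| edges, which is at most q^2|W|/20 for |W| <= 2^(q/60). The factor 1/20 is the slack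
    that the sparse case consumes. The result is f(q) <= 8q^2 for all q >= 3840, which implies the
    stated bound. *)

Record is_rank (r : {set E} -> nat) : Prop := IsRank {
  rank_card : forall A, r A <= #|A|;
  rank_mono : forall A B, A \subset B -> r A <= r B;
  rank_submod : forall A B, r (A :|: B) + r (A :&: B) <= r A + r B }.

Variable r : {set E} -> nat.
Hypothesis rP : is_rank r.

Definition cl A : {set E} := [set x | r (x |: A) == r A].
Definition indep A := r A == #|A|.

Lemma rank0 : r set0 = 0.
Proof. by apply/eqP; rewrite -leqn0 -(cards0 E) rank_card. Qed.

Lemma rankU1_le A x : r (x |: A) <= (r A).+1.
Proof.
have := rank_submod rP [set x] A; have := rank_card rP [set x].
by rewrite cards1; lia.
Qed.

Lemma sub_cl A : A \subset cl A.
Proof.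
by apply/subsetP => x xA; rewrite inE (setUidPr _) ?sub1set.
Qed.

Lemma clS A B : A \subset B -> cl A \subset cl B.
Proof.
move=> AB; apply/subsetP => x; rewrite !inE => /eqP xA.
have := rank_submod rP (x |: A) B; rewrite xA -setUA (setUidPr AB) => h.
have h2 := rank_mono rP (subsetUr [set x] B).
have h3 : r A <= r ((x |: A) :&: B).
  by apply: rank_mono => //; rewrite subsetI subsetUr.
by apply/eqP; lia.
Qed.

Lemma rank_cl_sub A B : B \subset cl A -> r (A :|: B) = r A.
Proof.
move: {2}#|B| (erefl #|B|) => n; elim: n B => [|n IHn] B cB sB.
  by move/eqP: cB; rewrite cards_eq0 => /eqP->; rewrite setU0.
have /card_gt0P[x xB] : 0 < #|B| by rewrite cB.
have cBx : #|B :\ x| = n by move: cB; rewrite (cardsD1 x) xB => -[].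
have sBx : B :\ x \subset cl A by apply: subset_trans sB; apply: subD1set.
have /subsetP/(_ x) := clS (subsetUl A (B :\ x)).
move/(_ (subsetP sB _ xB)); rewrite inE (IHn _ cBx sBx) => /eqP <-.
by rewrite setUCA setD1K.
Qed.

Lemma rank_cl A : r (cl A) = r A.
Proof. by rewrite -(setUidPr (sub_cl A)) rank_cl_sub. Qed.

Lemma rank_le_cl A B : B \subset cl A -> r B <= r A.
Proof. by move=> sB; rewrite -(rank_cl A) rank_mono. Qed.

Lemma cl_cl A : cl (cl A) = cl A.
Proof.
apply/eqP; rewrite eqEsubset sub_cl andbT; apply/subsetP => x.
rewrite !inE rank_cl => /eqP xA; rewrite eq_sym eqn_leq rank_mono ?subsetUr //=.
by rewrite -xA rank_mono // setUS // sub_cl.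
Qed.

Lemma indepS A B : A \subset B -> indep B -> indep A.
Proof.
move=> AB /eqP iB; rewrite /indep eqn_leq rank_card //=.
have := rank_submod rP A (B :\: A); have := rank_card rP (B :\: A).
have -> : A :|: B :\: A = B.
  apply/setP => x; rewrite !inE; case: (boolP (x \in A)) => //= /(subsetP AB) ->.
  by [].
have := cardsID A B; rewrite (setIidPr AB) iB; lia.
Qed.

Lemma indepU1 A x : x \notin cl A -> indep A -> indep (x |: A).
Proof.
rewrite inE => xA /eqP iA; have := rank_mono rP (subsetUr [set x] A).
move: xA; rewrite /indep => xA le1; have := rankU1_le A x.
have xnA : x \notin A.
  by apply: contra xA => xA; rewrite (setUidPr _) ?sub1set.
by rewrite cardsU1 xnA iA in le1 xA *; lia.
Qed.

Lemma not_indepP A :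
  ~~ indep A -> exists2 x, x \in A & x \in cl (A :\ x).
Proof.
move: {2}#|A| (erefl #|A|) => n; elim: n A => [|n IHn] A cA.
  by move/eqP: cA; rewrite cards_eq0 => /eqP->; rewrite /indep rank0 cards0.
have /card_gt0P[x xA] : 0 < #|A| by rewrite cA.
have cAx : #|A :\ x| = n by move: cA; rewrite (cardsD1 x) xA => -[].
case: (boolP (x \in cl (A :\ x))) => [xc _|xc niA]; first by exists x.
have [|y] := IHn _ cAx.
  by apply: contra niA => /(indepU1 xc); rewrite setD1K.
case/setD1P=> yx yA ycl; exists y => //.
have sub : A :\ x :\ y \subset A :\ y by rewrite setSD // subD1set.
exact: (subsetP (clS sub)).
Qed.

Lemma indep_notin A x : indep A -> x \in A -> x \notin cl (A :\ x).
Proof.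
move=> iA xA; rewrite inE setD1K // (eqP iA).
have := rank_card rP (A :\ x); rewrite (cardsD1 x A) xA; lia.
Qed.

Lemma ex_basis F : exists I, [/\ I \subset F, indep I & r I = r F].
Proof.
have [I /maxsetP[/andP[sI iI] maxI] _] :
  {I | maxset (fun I => (I \subset F) && indep I) I & set0 \subset I}.
  by apply: maxset_exists; rewrite sub0set /indep rank0 cards0.
exists I; split=> //; suff sF : F \subset cl I.
  by rewrite -(rank_cl_sub sF) (setUidPr sI).
apply/subsetP => x xF; apply: contraT => xc.
have := maxI (x |: I); rewrite indepU1 // subUset sub1set xF sI.
move/(_ isT (subsetUr _ _)) => eI; case/negP: xc.
by rewrite inE eI.
Qed.

(** For z outside I, the elements whose removal from I loses z are, together with z, its fundamental
    circuit; the hypothesis puts them inside R. The elements of I outside R are dropped one at a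
    time, and submodularity keeps z in the closure. *)
Lemma cl_indepI (I R : {set E}) z : indep I -> z \in cl I ->
  (forall w, w \in I -> w \notin R -> z \in cl (I :\ w)) -> z \in cl (I :&: R).
Proof.
move=> iI zI zw; have [zI'|zI'] := boolP (z \in I).
  have [zR|zR] := boolP (z \in R); first by apply: (subsetP (sub_cl _)); rewrite inE zI'.
  by have := indep_notin iI zI'; rewrite zw.
suff: forall n A, #|A| = n -> I :&: R \subset A -> A \subset I -> z \in cl A ->
   z \in cl (I :&: R) by move=> h; apply: (h #|I| I) => //; apply: subsetIl.
elim=> [|n IHn] A cA sA AI zA.
  move/eqP: cA; rewrite cards_eq0 => /eqP cA; rewrite cA in zA sA.
  by move: sA; rewrite subset0 => /eqP->.
have [AR|/subsetPn[w wA wR]] := boolP (A \subset R).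
  suff -> : I :&: R = A by [].
  by apply/eqP; rewrite eqEsubset sA subsetI AI AR.
have wI := subsetP AI _ wA.
have AwI : A :\ w \subset I by apply: subset_trans AI; apply: subD1set.
apply: (IHn (A :\ w)) => //.
- by move: cA; rewrite (cardsD1 w) wA => -[].
- apply/subsetP => u uIR; rewrite !inE (subsetP sA _ uIR) andbT.
  by apply: contraNneq wR => <-; case/setIP: uIR.
have zI2 := zw _ wI wR; move: zA zI2; rewrite !inE => /eqP h1 /eqP h2.
have := rank_submod rP (z |: A) (z |: (I :\ w)).
have -> : (z |: A) :|: (z |: (I :\ w)) = z |: I.
  apply/setP => u; rewrite !inE; case: (u =P z) => //= _.
  case: (boolP (u \in A)) => [/(subsetP AI)->|uA] //=.
  by case: (u =P w) uA => //= ->; rewrite wA.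
have -> : (z |: A) :&: (z |: (I :\ w)) = z |: (A :\ w).
  apply/setP => u; rewrite !inE; case: (u =P z) => //= _.
  by case: (boolP (u \in A)) => [/(subsetP AI)->|_]; rewrite ?andbT ?andbF.
have /eqP e0 := indepS AwI iI; have /eqP e1 := indepS AI iI.
have /eqP e2 := indepS (subD1set I w) iI.
have := rank_mono rP (subsetUr [set z] I).
have := rank_mono rP (subsetUr [set z] (A :\ w)).
rewrite e0 (eqP iI) h1 h2 e1 e2 (cardsD1 w A) wA (cardsD1 w I) wI; lia.
Qed.

End MatroidRank.

(** * Matroid covering and packing after Edmonds *)

Section Packing.
Variables (E : finType) (r : {set E} -> nat) (T : nat).
Hypothesis rP : is_rank r.
Implicit Types (A B F I R : {set E}) (x y z : E) (c : {ffun E -> option 'I_T}).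

Let cls c i : {set E} := [set x | c x == Some i].
Let dom c : {set E} := [set x | c x].
Let valid c := forall i, indep r (cls c i).
(** An arc means that [x] can take over the colour of [y] once [y] gives it up; a sink can join some
    class as it stands. Augmenting paths lead from an uncoloured element to a sink. *)
Let arc c x y :=
  if c y is Some i then x \notin cl r (cls c i :\ y) else false.
Let sink c x := [exists i, x \notin cl r (cls c i)].
Let recolor c x y : {ffun E -> option 'I_T} :=
  [ffun z => if z == x then c y else if z == y then None else c z].

Local Lemma recolor_cls c x y i : c x = None -> c y = Some i ->
  forall j, cls (recolor c x y) j = if j == i then x |: (cls c i :\ y) else cls c j.
Proof.
move=> cx cy j; apply/setP => z.
rewrite (fun_if (fun A : {set E} => z \in A)) !inE ffunE.
have [->|zx] := eqVneq z x.
  by rewrite cx cy; case: (j =P i) => [->|ji]; apply/eqP => // -[/esym].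
have [->|zy] := eqVneq z y; last by case: (j =P i) => [->|].
by rewrite cy; case: (j =P i) => // ji; apply/esym/eqP => -[/esym].
Qed.

(* A shortest augmenting path stays augmenting after its first exchange,
   because no later vertex of the path is reachable from [x] in one step. *)
Local Lemma augment n c x p : size p <= n -> valid c -> c x = None ->
  path (arc c) x p -> sink c (last x p) ->
  exists c', valid c' /\ dom c' = x |: dom c.
Proof.
elim: n c x p => [|n IHn] c x p.
  rewrite leqn0 size_eq0 => /eqP-> vc cx _ /existsP[i xi].
  exists [ffun z => if z == x then Some i else c z]; split; last first.
    by apply/setP => z; rewrite !inE ffunE; case: eqP.
  move=> j.
  have -> : cls [ffun z => if z == x then Some i else c z] j =
      if j == i then x |: cls c i else cls c j.
    apply/setP => z; rewrite (fun_if (fun A : {set E} => z \in A)) !inE ffunE.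
    have [->|zx] := eqVneq z x; last by case: (j =P i) => [->|].
    by rewrite cx; case: (j =P i) => [->|ji]; apply/eqP => // -[/esym].
  by case: eqP => _; [apply: indepU1|apply: vc].
move=> szp vc cx xp sp.
have [sx|nsx] := boolP (sink c x); first exact: (IHn c x [::]).
case: p szp xp sp => [|y p] szp xp sp; first by rewrite sp in nsx.
have [/hasP[w wp xw]|/hasPn noarc] := boolP (has (arc c x) p).
  move: szp xp sp; have [p1 p2] := splitPr wp.
  rewrite /= size_cat /= cat_path last_cat /= => szp /and4P[_ _ _ wp2] sp.
  by apply: (IHn c x (w :: p2)) => //=; [lia|rewrite xw].
move: xp => /= /andP[xy yp]; move: (xy); rewrite {1}/arc.
case cy: (c y) => [i|//] xi.
set c' := recolor c x y; have clsE := recolor_cls cx cy.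
have xcl j : x \in cl r (cls c j).
  by move: nsx => /existsPn/(_ j); rewrite negbK.
have vc' : valid c'.
  move=> j; rewrite clsE; case: eqP => _; last exact: vc.
  by apply: indepU1 => //; apply: indepS (vc i) => //; apply: subD1set.
have c'y : c' y = None.
  rewrite ffunE eqxx; case: eqP => // yx.
  by move: cx; rewrite -yx cy.
have sub j : cls c' j \subset cl r (cls c j).
  rewrite clsE; case: eqP => [ji|_]; last exact: sub_cl.
  rewrite -ji subUset sub1set xcl /= (subset_trans (subD1set _ _)) ?sub_cl //.
have subw w : w \in p -> forall j, c w = Some j ->
    cl r (cls c' j :\ w) \subset cl r (cls c j :\ w).
  move=> wp j cw; rewrite -[cl r (cls c j :\ w)](cl_cl rP); apply: clS => //.
  rewrite clsE; case: eqP => [ji|_]; last exact: sub_cl.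
  have xw : x \in cl r (cls c j :\ w).
    by move: (noarc w wp); rewrite /arc cw negbK.
  apply/subsetP => z /setD1P[zw /setU1P[->|]] //.
  rewrite -ji => /setD1P[_ zj]; apply: (subsetP (sub_cl r _)).
  by rewrite !inE zw; move: zj; rewrite inE.
have wx w : w \in p -> w != x.
  move=> wp; apply: contraTneq yp => wx; apply/negP => yp.
  have : exists2 z, arc c z w & true.
    elim: p (y) wp yp {szp sp noarc subw} => //= u p IHp z.
    rewrite inE => /orP[/eqP->|wp] /andP[zu up]; first by exists z.
    exact: (IHp u).
  by case=> z; rewrite wx /arc cx.
have arcS u w : w \in p -> arc c u w -> arc c' u w.
  move=> wp; have wy : w != y by apply: contraTneq xy => <-; apply: noarc.
  rewrite /arc ffunE (negPf (wx _ wp)) (negPf wy); case cw: (c w) => [j|//].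
  by apply: contra; apply: (subsetP (subw w wp j cw)).
have pathS s : forall z, {subset s <= p} -> path (arc c) z s -> path (arc c') z s.
  elim: s => //= u s IHs z sp' /andP[zu us]; apply/andP; split.
    by apply: arcS => //; apply: sp'; rewrite mem_head.
  by apply: IHs => // v vs; apply: sp'; rewrite inE vs orbT.
have yp' := pathS p y (fun z h => h) yp.
have sp' : sink c' (last y p).
  move: sp => /= /existsP[j]; set l := last y p => lj; apply/existsP; exists j.
  apply: contra lj; rewrite -[cl r (cls c j)](cl_cl rP).
  by apply: (subsetP (clS rP (sub j))).
have [c2 [vc2 dc2]] := IHn c' y p szp vc' c'y yp' sp'.
exists c2; split=> //; rewrite dc2; apply/setP => z; rewrite !inE ffunE.
have [->|zx] := eqVneq z x; first by rewrite cy /= orbT.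
by have [->|zy] := eqVneq z y; rewrite ?cy.
Qed.

(** In a colouring with largest domain let R be the set reachable from an uncoloured e. Since R has
    no sink and no arc leaves it, every colour class meets R in a basis of R. So R has T * r R
    coloured elements besides e, against the hypothesis. *)
Lemma matroid_cover A : (forall F, F \subset A -> #|F| <= T * r F) ->
  exists B : 'I_T -> {set E}, [/\ forall i, indep r (B i),
    forall i, B i \subset A, (forall i j, i != j -> [disjoint B i & B j])
    & \bigcup_i B i = A].
Proof.
move=> hA.
pose ok c := (dom c \subset A) && [forall i, indep r (cls c i)].
have ok0 : ok [ffun => None].
  apply/andP; split; first by apply/subsetP => z; rewrite inE ffunE.
  apply/forallP => i; suff -> : cls [ffun => None] i = set0.
    by rewrite /indep rank0 // cards0.
  by apply/setP => z; rewrite !inE ffunE.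
case: (@arg_maxnP _ _ ok (fun c => #|dom c|) ok0) => c /andP[sc /forallP vc] maxc.
have domA : dom c = A.
  apply/eqP; rewrite eqEsubset sc /=; apply/subsetP => e eA; rewrite inE.
  apply: contraT; case ce: (c e) => [//|] _.
  pose R := [set z | connect (arc c) e z].
  have RA : R \subset A.
    apply/subsetP => z; rewrite inE => /connectP[p ep ->].
    case/lastP: p ep => // p y; rewrite rcons_path last_rcons => /andP[_].
    by rewrite /arc => h; apply: (subsetP sc); rewrite inE; move: h; case: (c y).
  have eR : e \in R by rewrite inE connect0.
  have nsink z : z \in R -> ~~ sink c z.
    rewrite inE => /connectP[p ep ->]; apply/negP => sz.
    have [c2 [vc2 dc2]] := augment (leqnn _) vc ce ep sz.
    have := maxc c2; rewrite dc2 cardsU1 inE ce /=.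
    have -> : ok c2.
      by apply/andP; split; [rewrite dc2 subUset sub1set eA | apply/forallP].
    by move/(_ isT); lia.
  have RI i : r R = #|cls c i :&: R|.
    have iI : indep r (cls c i :&: R) by apply: indepS (vc i) => //; apply: subsetIl.
    rewrite -(eqP iI); apply/eqP; rewrite eqn_leq (rank_mono rP (subsetIr _ _)) andbT.
    apply: rank_le_cl => //; apply/subsetP => z zR; apply: cl_indepI => //.
      by move: (nsink z zR) => /existsPn/(_ i); rewrite negbK.
    move=> w wi; apply: contraNT => zw; rewrite inE.
    move: zR; rewrite inE => ez; apply: connect_trans ez (connect1 _).
    by move: wi; rewrite inE /arc => /eqP->.
  have clsI i j : i != j -> [disjoint cls c i :&: R & cls c j :&: R].
    move=> ij; rewrite -setI_eq0; apply/eqP/setP => z; rewrite !inE.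
    by case: (c z =P Some i) => [->|//]; rewrite (inj_eq Some_inj) (negPf ij) !andbF.
  have eqT : T * r R = #|\bigcup_i (cls c i :&: R)|.
    rewrite -sum1_card partition_disjoint_bigcup //=.
    rewrite (eq_bigr (fun=> r R)) ?sum_nat_const ?card_ord // => i _.
    by rewrite sum1_card -(RI i).
  have := hA R RA; rewrite eqT (cardsD1 e R) eR => hR.
  have /subset_leq_card : \bigcup_i (cls c i :&: R) \subset R :\ e; last by lia.
  apply/bigcupsP => i _; apply/subsetP => z /setIP[zi zR]; rewrite 2!inE zR andbT.
  by apply: contraTneq zi => ->; rewrite inE ce.
exists (cls c); split=> [i|i|i j ij|].
- exact: vc.
- by rewrite -domA; apply/subsetP => z; rewrite !inE => /eqP->.
- rewrite -setI_eq0; apply/eqP/setP => z; rewrite !inE.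
  by case: (c z =P Some i) => [->|//]; rewrite (inj_eq Some_inj) (negPf ij).
rewrite -domA; apply/setP => z; rewrite inE; apply/bigcupP/idP => [[i _]|].
  by rewrite inE => /eqP->.
by case cz: (c z) => [i|//] _; exists i; rewrite ?inE ?cz.
Qed.

(** A minimal C that still satisfies the condition is considered. Tight subsets of C are closed
    under intersection, and minimality gives for each e in C a tight set avoiding e. Hence the empty
    set is tight, that is #|C| = T * r A, and covering C by T independent sets partitions it into
    bases. *)
Lemma matroid_packing A :
  (forall F, F \subset A -> T * r A <= T * r F + #|A :\: F|) ->
  exists B : 'I_T -> {set E}, [/\ forall i, indep r (B i), forall i, r (B i) = r A,
    forall i, B i \subset A & forall i j, i != j -> [disjoint B i & B j]].
Proof.
move=> hA; case: (posnP T) => [T0|T_gt0].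
  by exists (fun=> set0); split=> -[i lti]; exfalso; move: lti; rewrite T0.
pose ok (C : {set E}) := [&& C \subset A, r C == r A &
  [forall F : {set E}, (F \subset C) ==> (T * r A <= T * r F + #|C :\: F|)]].
have okA : ok A by apply/and3P; split=> //; apply/forallP => F; apply/implyP/hA.
case: (@arg_minnP _ A ok (fun C => #|C|) okA) => C /and3P[sC /eqP rC /forallP hC] minC.
have {}hC F : F \subset C -> T * r A <= T * r F + #|C :\: F| by move/(implyP (hC F)).
pose tight (F : {set E}) := (F \subset C) && (T * r A == T * r F + #|C :\: F|).
have ex_tight e : e \in C -> exists2 F : {set E}, tight F & e \notin F.
  move=> eC; have : ~~ ok (C :\ e).
    by apply/negP => /minC; rewrite (cardsD1 e C) eC; lia.
  rewrite /ok (subset_trans (subD1set _ _) sC) /=.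
  case: eqP => [_|/eqP rCe] /=.
    case/forallPn => F; rewrite negb_imply -ltnNge => /andP[sF hF].
    have eF : e \notin F by apply/negP => /(subsetP sF); rewrite !inE eqxx.
    have sFC := subset_trans sF (subD1set _ _).
    exists F => //; rewrite /tight sFC eqn_leq hC //=.
    have -> : C :\: F = e |: (C :\ e :\: F).
      by apply/setP => z; rewrite !inE; have [->|ze] := eqVneq z e; rewrite ?eC ?eF.
    by rewrite cardsU1 !inE eqxx andbF /=; lia.
  (* If deleting e lowers the rank, the condition for [C :\ e] itself forces T = 1, and [C :\ e] is
     tight. *)
  move=> _; exists (C :\ e); last by rewrite !inE eqxx.
  have := hC _ (subD1set C e); rewrite /tight subD1set /=.
  have -> : C :\: (C :\ e) = [set e].
    by apply/setP => z; rewrite !inE; have [->|ze] := eqVneq z e; rewrite ?eC //= andNb.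
  rewrite cards1; have := rank_mono rP (subD1set C e); rewrite rC => h1 h2.
  have : T * (r (C :\ e)).+1 <= T * r A.
    by rewrite leq_mul2l ltn_neqAle rCe h1 orbT.
  by rewrite mulnS; lia.
have tightI F F' : tight F -> tight F' -> tight (F :&: F').
  move=> /andP[sF /eqP tF] /andP[sF' /eqP tF'].
  rewrite /tight (subset_trans (subsetIl _ _) sF) /= eqn_leq hC ?(subset_trans (subsetIl _ _) sF) //=.
  have := hC (F :|: F'); rewrite subUset sF sF' => /(_ isT).
  have := rank_submod rP F F'; have := cardsUI (C :\: F) (C :\: F').
  rewrite -setDIr -setDUr; nia.
have /existsP[F0 tF0] : [exists F, tight F].
  apply/existsP; exists C; rewrite /tight subxx setDv cards0 rC.
  by rewrite addn0 eqxx.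
case: (@arg_minnP _ F0 tight (fun F => #|F|) tF0) => F tF minF.
have F_0 : F = set0.
  apply/eqP; apply: contraT => /set0Pn[e eF].
  have eC : e \in C by case/andP: tF => /subsetP sF _; apply: sF.
  have [F' tF' eF'] := ex_tight e eC.
  have := minF _ (tightI _ _ tF tF').
  have : F :&: F' \proper F.
    by apply/properP; split; [apply: subsetIl|exists e; rewrite ?inE ?eF].
  by move/proper_card; lia.
have cC : #|C| = T * r A.
  by move: tF; rewrite F_0 /tight rank0 // setD0 muln0 => /andP[_ /eqP->].
have [F'|B [iB sB dB uB]] := @matroid_cover C.
  by move=> sF; have := hC F' sF; have := cardsID F' C; rewrite (setIidPr sF) cC; lia.
exists B; split=> // [i|i]; last exact: subset_trans (sB i) sC.
have rB j : r (B j) <= r A by rewrite -rC; apply: rank_mono.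
have : #|C| = \sum_j r (B j).
  rewrite -uB -sum1_card partition_disjoint_bigcup //=.
  by apply: eq_bigr => j _; rewrite sum1_card (eqP (iB j)).
rewrite cC (bigD1 i) //= => eqC.
have : \sum_(j | j != i) r (B j) <= T.-1 * r A.
  rewrite (leq_trans (leq_sum _ (fun j _ => rB j))) // sum_nat_const leq_mul2r.
  by rewrite cardC1 card_ord leqnn orbT.
have := mulSn T.-1 (r A); rewrite prednK // => e1 hs.
have := rB i; move: eqC hs; rewrite e1 => eqC hs; move: eqC hs.
move: (\sum_(_ | _) _) (T.-1 * r A) => x y *.
lia.
Qed.

End Packing.

(** * The generic rigidity matroid *)

Section GenericRank.
Import Order.TTheory GRing.Theory Num.Theory.
Local Open Scope ring_scope.

Lemma mxrank_rowsub m m' n (f : 'I_m' -> 'I_m) (A : 'M[rat]_(m, n)) :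
  (\rank (rowsub f A) <= \rank A)%N.
Proof. by rewrite rowsubE mxrankM_maxr. Qed.

(** P is the determinant, as a polynomial in t, of a square submatrix of full rank that is
    nonsingular at t0. *)
Lemma rank_minor_poly m n (X Y : 'M[rat]_(m, n)) (t0 : rat) :
  exists P : {poly rat}, P.[t0] != 0 /\
    forall t, P.[t] != 0 -> (\rank (X + t0 *: Y)%R <= \rank (X + t *: Y)%R)%N.
Proof.
have [A eA] : exists A, A = X + t0 *: Y by exists (X + t0 *: Y).
rewrite -eA; set f := maxrankfun A.
have fA : row_full (rowsub f A)^T by rewrite /row_full mxrank_tr; exact: maxrowsub_free.
set g := fullrankfun fA.
pose M t := rowsub g (rowsub f (X + t *: Y))^T.
pose Q : 'M[{poly rat}]_(\rank A) :=
  rowsub g (rowsub f (map_mx polyC X + 'X *: map_mx polyC Y))^T.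
have QE t : (\det Q).[t] = \det (M t).
  rewrite -horner_evalE -det_map_mx; congr (\det _).
  by apply/matrixP => i j; rewrite !mxE /= /horner_eval !hornerE.
exists (\det Q); split=> [|t].
  by rewrite QE -unitfE -unitmxE /M -eA fullrowsub_unit.
rewrite QE -unitfE -unitmxE => /mxrank_unit rk.
apply: (@leq_trans (\rank (M t))); first by rewrite rk.
by rewrite (leq_trans (mxrank_rowsub _ _)) // mxrank_tr mxrank_rowsub.
Qed.

Lemma poly_nonroot (P : {poly rat}) : P != 0 -> exists t, P.[t] != 0.
Proof.
move=> P0; apply: NNPP => h.
have := max_poly_roots P0 (rs := [seq i%:R | i <- iota 0 (size P)]).
rewrite size_map size_iota ltnn => /(_ _ _)/notF; apply.
  by apply/allP => t _; apply/negPn/negP => /negP ht; apply: h; exists t; exact/negP.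
by rewrite map_inj_uniq ?iota_uniq // => i j /eqP; rewrite eqr_nat => /eqP.
Qed.

End GenericRank.

Lemma big_disjU (R : Type) (idx : R) (op : Monoid.com_law idx) (I : finType)
    (A B : {set I}) (f : I -> R) : [disjoint A & B] ->
  \big[op/idx]_(i in A :|: B) f i =
  op (\big[op/idx]_(i in A) f i) (\big[op/idx]_(i in B) f i).
Proof. by move=> AB; rewrite -bigU //; apply: eq_bigl => i; rewrite !inE. Qed.

Lemma cards_disjU (I : finType) (A B : {set I}) :
  [disjoint A & B] -> #|A :|: B| = #|A| + #|B|.
Proof. by move=> AB; rewrite -!sum1_card big_disjU. Qed.

(** * Graphs as sets of two-element vertex sets *)

Section EdgeSets.
Variable V : finType.
Implicit Types (F : {set {set V}}) (U W X Y : {set V}) (u v w : V).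

Definition Kn U : {set {set V}} := [set e : {set V} | (#|e| == 2) && (e \subset U)].
Definition nb F v : {set V} := [set u | (u != v) && ([set v; u] \in F)].
Definition inc F v : {set {set V}} := [set e in F | v \in e].

Lemma nbP F u v : (u \in nb F v) = (u != v) && ([set v; u] \in F).
Proof. by rewrite inE. Qed.

Lemma in_Kn2 U u v : ([set u; v] \in Kn U) = [&& u != v, u \in U & v \in U].
Proof. by rewrite inE cards2 subUset !sub1set eqSS eqb1. Qed.

Lemma KnS U W : U \subset W -> Kn U \subset Kn W.
Proof.
move=> UW; apply/subsetP => e; rewrite !inE => /andP[c2 eU].
by rewrite c2 (subset_trans eU).
Qed.

Lemma KnI U W : Kn U :&: Kn W = Kn (U :&: W).
Proof. by apply/setP => e; rewrite !inE subsetI; case: (#|e| == 2). Qed.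

Lemma edge2P U e v : e \in Kn U -> v \in e -> exists2 u, u != v & e = [set v; u].
Proof.
rewrite inE => /andP[/cards2P[x [y [xy ->]]] _]; rewrite !inE => /orP[]/eqP->.
  by exists y; rewrite // eq_sym.
by exists x; rewrite // setUC.
Qed.

Lemma nb_sym F u v : (u \in nb F v) = (v \in nb F u).
Proof. by rewrite !nbP eq_sym setUC. Qed.

Lemma nbxx F v : v \notin nb F v.
Proof. by rewrite nbP eqxx. Qed.

Lemma set2_inj v : {in [set~ v] &, injective (fun u => [set v; u])}.
Proof.
move=> x y; rewrite !inE => xv yv /setP/(_ x).
by rewrite !inE eqxx orbT (negPf xv) => /esym/eqP.
Qed.

Lemma inc_nb F v : F \subset Kn setT -> inc F v = [set [set v; u] | u in nb F v].
Proof.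
move=> FK; apply/setP => e; rewrite inE; apply/andP/imsetP => [[eF ve]|[u]].
  have [u uv ee] := edge2P (subsetP FK _ eF) ve.
  by exists u; rewrite // nbP uv -ee.
by rewrite nbP => /andP[_ h] ->; rewrite h !inE eqxx.
Qed.

Lemma big_inc (R : Type) (idx : R) (op : Monoid.com_law idx) F v (f : {set V} -> R) :
  F \subset Kn setT ->
  \big[op/idx]_(e in inc F v) f e = \big[op/idx]_(u in nb F v) f [set v; u].
Proof.
move=> FK; rewrite inc_nb // big_imset // => x y xn yn.
by apply: set2_inj; rewrite !inE; [move: xn|move: yn]; rewrite nbP => /andP[].
Qed.

Lemma card_inc F v : F \subset Kn setT -> #|inc F v| = #|nb F v|.
Proof. by move=> FK; rewrite -!sum1_card big_inc. Qed.

Lemma nb_Kn U v : v \in U -> nb (Kn U) v = U :\ v.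
Proof.
by move=> vU; apply/setP => u; rewrite nbP in_Kn2 !inE vU eq_sym andbA andbb.
Qed.

Lemma nbI_Kn F W v : v \in W -> nb (F :&: Kn W) v = nb F v :&: W.
Proof.
move=> vW; apply/setP => u; rewrite nbP !in_setI nbP in_Kn2 vW eq_sym.
by case: eqP => //= _; rewrite andbC.
Qed.

End EdgeSets.

Section Rigidity.
Import Order.TTheory GRing.Theory Num.Theory.
Local Open Scope ring_scope.
Variables (V : finType) (d : nat).
Implicit Types (p : V -> 'I_d -> rat) (e : {set V}) (F : {set {set V}}).
Implicit Types (U W : {set V}) (u v w : V) (l : {set V} -> rat).

(* The row of the edge [e = {u, v}] has [p u - p v] in block [u] and
   [p v - p u] in block [v]. *)
Definition rig p e v (c : 'I_d) : rat :=
  if v \in e then \sum_(z in e) (p v c - p z c) else 0.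

Lemma rigE p u v c : u != v -> rig p [set v; u] v c = p v c - p u c.
Proof.
move=> uv; rewrite /rig !inE eqxx /= big_setU1 ?inE 1?eq_sym //= big_set1.
by rewrite subrr add0r.
Qed.

Definition rrow p e : 'rV[rat]_#|{: V * 'I_d}| :=
  \row_j rig p e (enum_val j).1 (enum_val j).2.

(** Pairs outside [F] get zero rows instead of being left out, so that all edge sets share one
    matrix shape and the entries are linear in [p]. *)
Definition rigmx p F : 'M[rat]_(#|{: {set V}}|, #|{: V * 'I_d}|) :=
  \matrix_i (if enum_val i \in F then rrow p (enum_val i) else 0).

Definition rk p F := \rank (rigmx p F).

Lemma rigmx_sum p F : (rigmx p F :=: \sum_(e in F) <<rrow p e>>)%MS.
Proof.
apply/eqmxP/andP; split.
  apply/row_subP => i; rewrite rowK; case: ifP => iF; last exact: sub0mx.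
  by apply: (sumsmx_sup (enum_val i)) => //; rewrite genmxE.
apply/sumsmx_subP => e eF; rewrite genmxE; apply/submxP.
exists (delta_mx 0 (enum_rank e)); rewrite -rowE rowK enum_rankK eF.
by [].
Qed.

Lemma rigmxS p F F' : F \subset F' -> (rigmx p F <= rigmx p F')%MS.
Proof.
move=> sF; rewrite rigmx_sum; apply/sumsmx_subP => e eF.
by rewrite rigmx_sum (sumsmx_sup e) ?(subsetP sF).
Qed.

Lemma rk_rank p : is_rank (rk p).
Proof.
split=> [F|F F' sF|F F'].
- rewrite /rk rigmx_sum -sum1_card.
  elim/big_rec2: _ => [|e n M _ IH]; first by rewrite mxrank0.
  rewrite (leq_trans (mxrank_adds_leqif _ _).1) // leq_add // genmxE.
  exact: rank_leq_row.
- exact/mxrankS/rigmxS.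
rewrite /rk -(mxrank_sum_cap (rigmx p F)) leq_add //; apply: mxrankS; last first.
  by rewrite sub_capmx !rigmxS // ?subsetIl ?subsetIr.
rewrite rigmx_sum; apply/sumsmx_subP => e /setUP[] eF.
  by rewrite (submx_trans _ (addsmxSl _ _)) // rigmx_sum (sumsmx_sup e).
by rewrite (submx_trans _ (addsmxSr _ _)) // rigmx_sum (sumsmx_sup e).
Qed.

Lemma cl_rk p F e : (e \in cl (rk p) F) = (rrow p e <= rigmx p F)%MS.
Proof.
have sub : (rigmx p F <= rigmx p (e |: F))%MS.
  exact/rigmxS/subsetUr.
rewrite inE eq_sym (mxrank_leqif_sup sub).2; apply/idP/idP => [|se].
  apply: submx_trans; rewrite rigmx_sum (sumsmx_sup e) ?genmxE //.
  by rewrite !inE eqxx.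
rewrite rigmx_sum; apply/sumsmx_subP => f /setU1P[->|fF]; rewrite genmxE //.
by rewrite rigmx_sum (sumsmx_sup f) // genmxE.
Qed.

(** An equilibrium stress of a framework, which is a linear relation between the rows of the edges
    of [F]. *)
Definition stress p F l := forall v c, \sum_(e in F) l e * rig p e v c = 0.

Lemma stress_row p F l : stress p F l <-> \sum_(e in F) l e *: rrow p e = 0.
Proof.
split=> [st|st v c].
  apply/rowP => j; rewrite summxE mxE -[RHS](st (enum_val j).1 (enum_val j).2).
  by apply: eq_bigr => e _; rewrite !mxE.
have /rowP/(_ (enum_rank (v, c))) := st; rewrite summxE mxE => {2}<-.
by apply: eq_bigr => e _; rewrite !mxE enum_rankK.
Qed.

Lemma stress_cl p F l e :
  stress p F l -> e \in F -> l e != 0 -> e \in cl (rk p) (F :\ e).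
Proof.
move/stress_row => st eF le; rewrite cl_rk.
move: st; rewrite (bigD1 e) //= => /(canRL (addrK _)); rewrite add0r => st.
rewrite -[rrow p e](scalerK le) st scalemx_sub // eqmx_opp.
rewrite summx_sub // => f /andP[fF fe]; rewrite scalemx_sub // rigmx_sum.
by rewrite (sumsmx_sup f) ?genmxE // !inE fe.
Qed.

Lemma cl_stress p F e : e \in F -> e \in cl (rk p) (F :\ e) ->
  exists l, stress p F l /\ l e != 0.
Proof.
rewrite cl_rk => eF /submxP[D eD].
exists (fun f => if f == e then -1 else D 0 (enum_rank f)).
rewrite eqxx oppr_eq0 oner_eq0; split=> //; apply/stress_row.
rewrite (bigD1 e) //= eqxx scaleN1r; apply/eqP; rewrite addrC subr_eq0.
rewrite eD; apply/eqP/esym; rewrite mulmx_sum_row.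
rewrite (reindex_onto enum_rank enum_val) /= => [|i _]; last by rewrite enum_valK.
rewrite (eq_bigl xpredT) => [|f]; last by rewrite enum_rankK eqxx.
rewrite (bigID (mem (F :\ e))) /= [X in _ + X]big1 ?addr0 => [|f fF]; last first.
  by rewrite rowK enum_rankK (negPf fF) scaler0.
apply: eq_big => [f|f]; rewrite !inE; first by rewrite andbC.
by case/andP=> fe fF; rewrite rowK enum_rankK !inE fe fF (negPf fe).
Qed.

Lemma indep_stress p F l e :
  indep (rk p) F -> stress p F l -> e \in F -> l e = 0.
Proof.
move=> iF st eF; apply/eqP; apply: contraT => le.
have := indep_notin (rk_rank p) iF eF.
by rewrite (stress_cl st).
Qed.

Lemma stress_indep p F :
  (forall l, stress p F l -> forall e, e \in F -> l e = 0) -> indep (rk p) F.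
Proof.
move=> h; apply: contraT => /(not_indepP (rk_rank p))[e eF /(cl_stress eF)[l [st]]].
by rewrite (h l st e eF) eqxx.
Qed.

End Rigidity.

Lemma bounded_max (T : Type) (f : T -> nat) b (x0 : T) : (forall x, f x <= b) ->
  exists x, forall y, f y <= f x.
Proof.
move=> fb; have : exists n x, b - f x <= n by exists (b - f x0), x0.
case=> n; elim: n => [|n IHn] [x hx].
  by exists x => y; have := fb y; have := fb x; lia.
have [[y hy]|h] := classic (exists y, b - f y <= n); first by apply: IHn; exists y.
exists x => y; have : ~~ (b - f y <= n) by apply/negP => hy; apply: h; exists y.
by have := fb y; lia.
Qed.

Section Generic.
Import Order.TTheory GRing.Theory Num.Theory.
Local Open Scope ring_scope.
Variables (V : finType) (d : nat).
Implicit Types (p : V -> 'I_d -> rat) (e : {set V}) (F : {set {set V}}).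
Implicit Types (U W : {set V}) (u v w : V) (l : {set V} -> rat) (a : V -> rat).

(* Along the line through two configurations only finitely many points do not
   have the largest rank for a given edge set. *)
Lemma generic_config : exists p0, forall p F, (rk p F <= rk p0 F)%N.
Proof.
(* Maximising the sum of all ranks gives one configuration that is best for every [F] at once: a
   better value at a single [F] would raise the sum at a common good point of the line. *)
have [p0 max0] := @bounded_max _ (fun p => \sum_F rk p F)%N (\sum_(F : {set {set V}}) #|F|)%N
  (fun _ _ => 0) (fun p => leq_sum _ (fun F _ => rank_card (rk_rank p) F)).
exists p0 => p F; rewrite leqNgt; apply/negP => lt0.
pose pt t v c := p0 v c + t * (p v c - p0 v c).
have lin F' : exists X Y, forall t, rigmx (pt t) F' = X + t *: Y.
  exists (rigmx p0 F'), (rigmx (fun v c => p v c - p0 v c) F') => t.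
  apply/matrixP => i j; rewrite !mxE; case: (_ \in F'); last by rewrite !mxE mulr0 addr0.
  rewrite !mxE /rig; case: (_ \in _); last by rewrite mulr0 addr0.
  rewrite mulr_sumr -big_split /=; apply: eq_bigr => z _; rewrite /pt; ring.
have rk0 F' : rk (pt 0) F' = rk p0 F'.
  rewrite /rk; congr (\rank _); apply/matrixP => i j; rewrite !mxE.
  case: (_ \in F') => //; rewrite !mxE /rig /pt; case: (_ \in _) => //.
  by apply: eq_bigr => z _; ring.
have rk1 : rk (pt 1) F = rk p F.
  rewrite /rk; congr (\rank _); apply/matrixP => i j; rewrite !mxE.
  case: (_ \in F) => //; rewrite !mxE /rig /pt; case: (_ \in _) => //.
  by apply: eq_bigr => z _; ring.
have poly F' t0 : exists P : {poly rat}, P.[t0] != 0 /\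
    forall t, P.[t] != 0 -> (rk (pt t0) F' <= rk (pt t) F')%N.
  have [X [Y XY]] := lin F'; have [P [P0 PM]] := rank_minor_poly X Y t0.
  by exists P; split=> // t /PM; rewrite /rk !XY.
have [Q Q0] : exists Q : {poly rat}, Q != 0 /\
    forall t, Q.[t] != 0 -> forall F', (rk p0 F' <= rk (pt t) F')%N.
  have [Q [Q0 QM]] : exists Q : {poly rat}, Q != 0 /\
    forall t, Q.[t] != 0 -> forall F', F' \in enum {: {set {set V}}} ->
      (rk p0 F' <= rk (pt t) F')%N.
    elim: (enum _) => [|F' s [Q [Q0 QM]]]; first by exists 1; rewrite oner_eq0.
    have [P [P0 PM]] := poly F' 0; exists (P * Q); split.
      by rewrite mulf_neq0 //; apply: contraNneq P0 => ->; rewrite horner0.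
    move=> t; rewrite hornerM mulf_eq0 => /norP[Pt Qt] F2.
    rewrite inE => /orP[/eqP->|]; first by rewrite -rk0 PM.
    exact: QM.
  by exists Q; split=> // t Qt F'; apply: (QM t) => //; rewrite mem_enum.
case: Q0 => Q0 QM; have [P [P1 PM]] := poly F 1.
have PQ : P * Q != 0.
  by rewrite mulf_neq0 //; apply: contraNneq P1 => ->; rewrite horner0.
have [t] := poly_nonroot PQ; rewrite hornerM mulf_eq0 => /norP[Pt Qt].
have := max0 (pt t); rewrite leqNgt => /negP; apply.
rewrite [X in (_ < X)%N](bigD1 F) //= [X in (X < _)%N](bigD1 F) //= -addSn leq_add //.
  by apply: leq_trans lt0 _; rewrite -rk1 PM.
by apply: leq_sum => F' _; apply: QM.
Qed.

Lemma stress_nb p F l v c : F \subset Kn setT ->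
  \sum_(e in F) l e * rig p e v c =
  \sum_(u in nb F v) l [set v; u] * (p v c - p u c).
Proof.
move=> FK; rewrite (bigID (fun e => v \in e)) /= [X in _ + X]big1 ?addr0; last first.
  by move=> e /andP[_ ve]; rewrite /rig (negPf ve) mulr0.
transitivity (\sum_(e in inc F v) l e * rig p e v c).
  by apply: eq_bigl => e; rewrite inE.
rewrite big_inc //; apply: eq_bigr => u; rewrite nbP => /andP[uv _].
by rewrite rigE.
Qed.

(** An affine dependence a of the points gives the stress with value a_u a_v on the edge uv:
    equilibrium at v is a_v times the sum of the a_u (p_v - p_u), which vanishes. *)
Lemma dep_stress p U a : \sum_(u in U) a u = 0 ->
  (forall c, \sum_(u in U) a u * p u c = 0) ->
  stress p (Kn U) (fun e => \prod_(u in e) a u).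
Proof.
move=> a0 ap v c; rewrite stress_nb ?KnS ?subsetT //.
have [vU|vU] := boolP (v \in U); last first.
  rewrite big1 // => u; rewrite nbP in_Kn2 (negPf vU) andbF /=.
  by rewrite andbF.
transitivity (a v * (p v c * (\sum_(u in U :\ v) a u) - \sum_(u in U :\ v) a u * p u c)).
  rewrite nb_Kn // mulr_sumr -sumrB mulr_sumr; apply: eq_bigr => u /setD1P[uv _].
  by rewrite big_setU1 ?inE 1?eq_sym //= big_set1; ring.
have := a0; have := ap c; rewrite !(big_setD1 v vU) /= => /(canRL (addKr _)) -> /(canRL (addKr _)) ->.
ring.
Qed.

(** The points are the unit vectors and, if there are d+1 of them, the origin. With the coordinate
    belonging to w, equilibrium at u retains only the term of the edge uw. *)
Lemma simplex_indep U : (#|U| <= d.+1)%N -> exists p, indep (rk p) (Kn U).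
Proof.
move=> cU; pose idx u := index u (enum U).
pose p u (c : 'I_d) : rat := (idx u == c)%:R; exists p.
have ltidx u : u \in U -> (idx u <= d)%N.
  by move=> uU; rewrite -ltnS (leq_trans _ cU) // cardE index_mem mem_enum.
apply: stress_indep => l st.
suff main u w : u \in U -> w \in U -> u != w -> (idx w < d)%N -> l [set u; w] = 0.
  move=> e; rewrite inE => /andP[/cards2P[u [w [uw ->]]]].
  rewrite subUset !sub1set => /andP[uU wU].
  have [lw|gw] := ltnP (idx w) d; first exact: main.
  rewrite setUC main //; first by rewrite eq_sym.
  rewrite ltn_neqAle ltidx // andbT; apply: contraNneq uw => du.
  rewrite -(nth_index u (s := enum U) (x := u)) ?mem_enum //.
  rewrite -(nth_index u (s := enum U) (x := w)) ?mem_enum //.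
  by apply/eqP; congr nth; apply/eqP; rewrite -/(idx u) -/(idx w) du eqn_leq gw ltidx.
move=> uU wU uw ltw; have := st u (Ordinal ltw).
rewrite stress_nb ?KnS ?subsetT // nb_Kn // (big_setD1 w) ?inE 1?eq_sym ?uw //=.
have inj x : x \in U -> (idx x == idx w) = (x == w).
  move=> xU; apply/eqP/eqP => [|->] // e.
  by rewrite -(nth_index u (s := enum U) (x := x)) ?mem_enum // -/(idx x) e nth_index ?mem_enum.
rewrite big1 ?addr0 => [|z].
  by rewrite /p /= eqxx inj // (negPf uw) sub0r mulrN1 => /eqP; rewrite oppr_eq0 => /eqP.
by rewrite !inE => /and3P[zw zu zU]; rewrite /p /= !inj // (negPf uw) (negPf zw) subrr mulr0.
Qed.

Lemma affine_dep p U : (d.+1 < #|U|)%N -> exists a, [/\ exists2 u, u \in U & a u != 0,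
  \sum_(u in U) a u = 0 & forall c, \sum_(u in U) a u * p u c = 0].
Proof.
move=> cU.
pose M : 'M[rat]_(#|U|, d.+1) :=
  \matrix_(i, j) if unlift ord0 j is Some c then p (enum_val i) c else 1.
have : kermx M != 0.
  rewrite kermx_eq0 /row_free; have := rank_leq_col M.
  by apply: contraTneq => ->; rewrite -ltnNge.
case/rowV0Pn => x /sub_kermxP xM x0.
pose a u := if insub (index u (enum U)) is Some i then x 0 i else 0.
have aE i : a (enum_val i) = x 0 i.
  have ei : index (enum_val i) (enum U) = i.
    by rewrite (enum_val_nth (enum_val i)) index_uniq ?enum_uniq -?cardE.
  by rewrite /a ei; case: insubP => [j _ /val_inj->|] //; rewrite ltn_ord.
have sumE (f : V -> rat) : \sum_(u in U) a u * f u = \sum_i x 0 i * f (enum_val i).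
  by rewrite big_enum_val /=; apply: eq_bigr => i _; rewrite aE.
exists a; split.
- have [i xi] := rV0Pn _ x0.
  by exists (enum_val i); rewrite ?enum_valP ?aE.
- have := sumE (fun=> 1); under eq_bigr do rewrite mulr1; move=> ->.
  have /rowP/(_ ord0) := xM; rewrite !mxE => h; rewrite -[RHS]h.
  by apply: eq_bigr => i _; rewrite mxE unlift_none.
move=> c; rewrite sumE; have /rowP/(_ (lift ord0 c)) := xM; rewrite !mxE => h.
by rewrite -[RHS]h; apply: eq_bigr => i _; rewrite mxE liftK.
Qed.

End Generic.

Section Generic.
Import Order.TTheory GRing.Theory Num.Theory.
Local Open Scope ring_scope.
Variables (V : finType) (d : nat) (p0 : V -> 'I_d -> rat).
Implicit Types (p : V -> 'I_d -> rat) (e : {set V}) (F B : {set {set V}}).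
Implicit Types (U W N : {set V}) (u v w : V) (l : {set V} -> rat) (a : V -> rat).

Hypothesis max0 : forall p F, (rk p F <= rk p0 F)%N.

Lemma max_indep p F : indep (rk p) F -> indep (rk p0) F.
Proof.
by move=> /eqP iF; rewrite /indep eqn_leq (rank_card (rk_rank p0)) -iF max0.
Qed.

(** A nontrivial affine dependence would give a stress of an independent complete graph, so all
    products a_u a_w vanish; as the sum of a is zero, a single nonzero coefficient is impossible. *)
Lemma generic_affine U a : (#|U| <= d.+1)%N -> \sum_(u in U) a u = 0 ->
  (forall c, \sum_(u in U) a u * p0 u c = 0) -> forall u, u \in U -> a u = 0.
Proof.
move=> cU a0 ap u uU; have [p /max_indep iU] := simplex_indep cU.
have st := dep_stress a0 ap; apply/eqP; apply: contraT => au.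
have others w : w \in U -> w != u -> a w = 0.
  move=> wU wu; have := indep_stress iU st (e := [set u; w]).
  rewrite in_Kn2 uU wU eq_sym wu => /(_ isT).
  rewrite big_setU1 ?inE 1?eq_sym //= big_set1 => /eqP.
  by rewrite mulf_eq0 (negPf au) => /eqP.
move: a0; rewrite (big_setD1 u) //= big1 ?addr0; first by move/eqP; rewrite (negPf au).
by move=> w /setD1P[wu wU]; apply: others.
Qed.

Lemma rk_KnE U : (#|U| <= d.+1)%N -> rk p0 (Kn U) = #|Kn U|.
Proof. by move=> cU; have [p /max_indep/eqP] := simplex_indep cU. Qed.

(** By general position of any d+1 points, an affine dependence of d+2 points has no zero
    coefficient, so the resulting stress is nonzero on every edge. *)
Lemma rk_K_dep U v x : #|U| = d.+2 -> v \in U -> x \in U -> v != x ->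
  [set v; x] \in cl (rk p0) (Kn U :\ [set v; x]).
Proof.
move=> cU vU xU vx.
have [|a [[u uU au] a0 ap]] := @affine_dep V d p0 U; first by rewrite cU.
have nz w : w \in U -> a w != 0.
  move=> wU; apply: contraNneq au => aw.
  have [->|uw] := eqVneq u w; first by rewrite aw.
  apply/eqP; apply: (@generic_affine (U :\ w)); last by rewrite !inE uw.
  - by move: cU; rewrite (cardsD1 w) wU add1n => -[->].
  - by move: a0; rewrite (big_setD1 w) //= aw add0r.
  by move=> c; have := ap c; rewrite (big_setD1 w) //= aw mul0r add0r.
apply: stress_cl (dep_stress a0 ap) _ _; first by rewrite in_Kn2 vx vU.
by rewrite big_setU1 ?inE //= big_set1 mulf_neq0 ?nz.
Qed.

Definition star v N : {set {set V}} := [set [set v; u] | u in N].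

Lemma big_star v N (f : {set V} -> rat) : v \notin N ->
  \sum_(e in star v N) f e = \sum_(u in N) f [set v; u].
Proof.
move=> vN; rewrite big_imset // => x y xN yN; apply: set2_inj; rewrite !inE.
  by apply: contraNneq vN => <-.
by apply: contraNneq vN => <-.
Qed.

Lemma card_star v N : v \notin N -> #|star v N| = #|N|.
Proof.
move=> vN; rewrite card_in_imset // => x y xN yN; apply: set2_inj; rewrite !inE.
  by apply: contraNneq vN => <-.
by apply: contraNneq vN => <-.
Qed.

Lemma mem_star v N e : e \in star v N -> v \in e.
Proof. by case/imsetP => u _ ->; rewrite !inE eqxx. Qed.

Lemma star_f v N u : u \in N -> [set v; u] \in star v N.
Proof. exact: imset_f. Qed.

Lemma star_disj B v N : (forall e, e \in B -> v \notin e) -> [disjoint B & star v N].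
Proof.
move=> hB; rewrite -setI_eq0; apply/eqP/setP => e; rewrite !inE.
by apply/negbTE/negP => /andP[/hB h /mem_star]; apply/negP.
Qed.

Lemma sum_star_v p B v N l c : (forall e, e \in B -> v \notin e) -> v \notin N ->
  \sum_(e in B :|: star v N) l e * rig p e v c =
  \sum_(u in N) l [set v; u] * (p v c - p u c).
Proof.
move=> hB vN; rewrite big_disjU ?star_disj //= big_star // big1 ?add0r.
  apply: eq_bigr => u uN; rewrite rigE //; by apply: contraNneq vN => <-.
by move=> e /hB ve; rewrite /rig (negPf ve) mulr0.
Qed.

Lemma sum_star_other p B v N l y c : (forall e, e \in B -> v \notin e) -> v \notin N ->
  y != v ->
  \sum_(e in B :|: star v N) l e * rig p e y c =
  \sum_(e in B) l e * rig p e y c +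
  (if y \in N then l [set v; y] * (p y c - p v c) else 0).
Proof.
move=> hB vN yv; rewrite big_disjU ?star_disj //= big_star //; congr (_ + _).
have z0 u : u != y -> l [set v; u] * rig p [set v; u] y c = 0.
  by move=> uy; rewrite /rig !inE (negPf yv) eq_sym (negPf uy) mulr0.
case: ifP => yN; last first.
  by rewrite big1 // => u uN; rewrite z0 //; apply: contraTneq uN => ->; rewrite yN.
rewrite (big_setD1 y) //= setUC rigE 1?eq_sym // big1 ?addr0 //.
by move=> u /setD1P[uy _]; rewrite z0.
Qed.

Lemma rig_eq p p' e : (forall x, x \in e -> p x = p' x) -> rig p e =2 rig p' e.
Proof.
move=> h y c; rewrite /rig; case: ifP => // ye; apply: eq_bigr => z ze.
by rewrite !h.
Qed.

Lemma rank_extend F v B N : F \subset Kn setT -> N \subset nb F v ->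
  B \subset cl (rk p0) (F :\: inc F v) -> (forall e, e \in B -> v \notin e) ->
  indep (rk p0) (B :|: star v N) -> (#|B| + #|N| <= rk p0 F)%N.
Proof.
move=> FK sN sB hB /eqP iB.
have vN : v \notin N by apply: contra (nbxx F v); apply: (subsetP sN).
have <- : rk p0 (B :|: star v N) = (#|B| + #|N|)%N.
  by rewrite iB cards_disjU ?star_disj // card_star.
apply: (rank_le_cl (rk_rank p0)); rewrite subUset (subset_trans sB) /=.
  apply: subset_trans (sub_cl _ _); apply/subsetP => e /imsetP[u uN ->].
  by move: (subsetP sN _ uN); rewrite nbP => /andP[].
by apply: (clS (rk_rank p0)); apply: subsetDl.
Qed.

(** A 0-extension. Equilibrium at the new vertex v is an affine dependence of v and at most d
    neighbours, which is trivial; the remaining stress lives on the old basis. *)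
Lemma rank_vertex F v : F \subset Kn setT ->
  (rk p0 (F :\: inc F v) + minn d #|nb F v| <= rk p0 F)%N.
Proof.
move=> FK; have [B [sB iB rB]] := ex_basis (rk_rank p0) (F :\: inc F v).
have hB e : e \in B -> v \notin e.
  by move/(subsetP sB); rewrite !inE => /andP[/nandP[/negPf->|//]].
have [N [sN cN]] : exists N, N \subset nb F v /\ #|N| = minn d #|nb F v|.
  exists [set u in take d (enum (nb F v))]; split.
    by apply/subsetP => u; rewrite inE => /mem_take; rewrite mem_enum.
  rewrite cardsE (card_uniqP _) ?take_uniq ?enum_uniq // size_take -cardE.
  by rewrite /minn; case: ltnP.
have vN : v \notin N by apply: contra (nbxx F v); apply: (subsetP sN).
have cN' : (#|N| <= d)%N by rewrite cN geq_minl.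
rewrite -cN -rB (eqP iB); apply: (@rank_extend F v) => //.
  exact: subset_trans sB (sub_cl _ _).
apply: stress_indep => l st.
have lN u : u \in N -> l [set v; u] = 0.
  move=> uN; pose a x := if x == v then - \sum_(z in N) l [set v; z] else l [set v; x].
  have aN x : x \in N -> a x = l [set v; x].
    by move=> xN; rewrite /a; case: eqP => // xv; rewrite -xv xN in vN.
  rewrite -aN //; apply: (@generic_affine (v |: N)); last by rewrite !inE uN orbT.
  - by rewrite cardsU1 vN.
  - rewrite big_setU1 //= {1}/a eqxx (eq_bigr (fun z => l [set v; z])) ?addNr //.
  move=> c; have := st v c; rewrite sum_star_v // => h.
  rewrite big_setU1 //= {1}/a eqxx mulNr mulr_suml -sumrN -big_split /=.
  apply/eqP; rewrite -oppr_eq0 -sumrN; apply/eqP; rewrite -[RHS]h.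
  apply: eq_bigr => z zN; rewrite aN //; ring.
move=> e /setUP[eB|/imsetP[u uN ->]]; last exact: lN.
apply: (indep_stress iB) (eB) => y c; have := st y c.
have [->|yv] := eqVneq y v.
  by move=> _; rewrite big1 // => f /hB vf; rewrite /rig (negPf vf) mulr0.
rewrite sum_star_other //; case: ifP => yN; last by rewrite addr0.
by rewrite lN // mul0r addr0.
Qed.

(** A Henneberg 1-extension. With v at the midpoint of u and w, a stress must agree on vu and vw and
    vanish on the other edges at v. The two collinear edges then act on u and w like the single pair
    uw, which is independent of the old basis. *)
Lemma rank_vertex_nonclosed F v u w : F \subset Kn setT -> (d < #|nb F v|)%N ->
  u \in nb F v -> w \in nb F v -> u != w ->
  [set u; w] \notin cl (rk p0) (F :\: inc F v) ->
  (rk p0 (F :\: inc F v) + d.+1 <= rk p0 F)%N.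
Proof.
move=> FK dN uN wN uw huw.
have [B [sB iB rB]] := ex_basis (rk_rank p0) (F :\: inc F v).
have hB e : e \in B -> v \notin e.
  by move/(subsetP sB); rewrite !inE => /andP[/nandP[/negPf->|//]].
have [N [sN cN u_N w_N]] : exists N, [/\ N \subset nb F v, #|N| = d.+1, u \in N & w \in N].
  (* For d = 0 all rows are zero, so the pair uw would lie in the closure. *)
  have : (1 < d.+1)%N.
    rewrite ltnS lt0n; apply: contraNneq huw => d0; rewrite cl_rk.
    rewrite (_ : rrow _ _ = 0) ?sub0mx //; apply/rowP => j; exfalso.
    by have [y [c lc]] := enum_val j; move: lc; rewrite d0.
  move=> d1; exists (u |: (w |: [set x in take d.-1 (enum (nb F v :\ u :\ w))])); split.
  - rewrite !subUset !sub1set uN wN /=; apply/subsetP => x; rewrite inE => /mem_take.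
    by rewrite mem_enum !in_setD1 => /and3P[].
  - have nt z x : z \in take x (enum (nb F v :\ u :\ w)) -> (z != w) && (z != u).
      by move/mem_take; rewrite mem_enum !inE => /and3P[-> ->].
    rewrite !cardsU1 !inE (negPf uw) /=.
    have -> : (u \in take d.-1 (enum (nb F v :\ u :\ w))) = false.
      by apply/negP => /nt; rewrite eqxx andbF.
    have -> : (w \in take d.-1 (enum (nb F v :\ u :\ w))) = false.
      by apply/negP => /nt; rewrite eqxx.
    rewrite cardsE (card_uniqP _) ?take_uniq ?enum_uniq // size_takel -?cardE; first lia.
    move: dN; rewrite (cardsD1 u) uN (cardsD1 w (nb F v :\ u)) in_setD1 wN andbT.
    rewrite eq_sym uw /=; lia.
  - by rewrite !inE eqxx.
  by rewrite !inE eqxx orbT.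
have vN : v \notin N by apply: contra (nbxx F v); apply: (subsetP sN).
have uv : u != v by apply: contraNneq vN => <-.
have wv : w != v by apply: contraNneq vN => <-.
pose p' x c := if x == v then (p0 u c + p0 w c) / 2 else p0 x c.
have p'v c : p' v c = (p0 u c + p0 w c) / 2 by rewrite /p' eqxx.
have p'x x c : x != v -> p' x c = p0 x c by rewrite /p' => /negPf->.
have uwB : [set u; w] \notin cl (rk p0) B.
  apply: contra huw; apply: (subsetP (clS (rk_rank p0) sB)).
have iB' := indepU1 (rk_rank p0) uwB iB.
rewrite -rB (eqP iB) -cN; apply: (@rank_extend F v) => //.
  exact: subset_trans sB (sub_cl _ _).
apply: (@max_indep p'); apply: stress_indep => l st.
set lu := l [set v; u].
pose s := \sum_(z in N :\ u :\ w) l [set v; z].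
pose b := (lu - l [set v; w]) / 2.
(* Substituting the midpoint for v in the equilibrium at v splits the weight of v equally between u
   and w. What results is an affine dependence [a] of the d+1 points of N, hence zero. *)
pose a x := if x == u then b - s / 2 else if x == w then - b - s / 2 else l [set v; x].
have split_sum (f : V -> rat) :
    \sum_(z in N) f z = f u + (f w + \sum_(z in N :\ u :\ w) f z).
  by rewrite (big_setD1 u) //= (big_setD1 w) //= !inE eq_sym uw.
have ao x : x \in N :\ u :\ w -> a x = l [set v; x].
  by rewrite !inE => /and3P[/negPf xw /negPf xu _]; rewrite /a xu xw.
have au : a u = b - s / 2 by rewrite /a eqxx.
have aw : a w = - b - s / 2 by rewrite /a eqxx eq_sym (negPf uw).
have a0 : forall x, x \in N -> a x = 0.
  apply: generic_affine; first by rewrite cN.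
    rewrite split_sum (eq_bigr _ ao) au aw -/s; by field.
  move=> c; have := st v c; rewrite sum_star_v // split_sum => h.
  rewrite split_sum au aw.
  have e1 : \sum_(z in N :\ u :\ w) l [set v; z] * (p' v c - p' z c) =
      s * p' v c - \sum_(z in N :\ u :\ w) a z * p0 z c.
    rewrite mulr_suml -sumrB; apply: eq_bigr => z zN; rewrite ao //.
    by rewrite (p'x z) ?mulrBr //; move: zN; rewrite !inE => /and3P[_ _ zN]; apply: contraNneq vN => <-.
  move: h; rewrite e1 !p'v !p'x // -/lu => h.
  apply/eqP; rewrite -oppr_eq0; apply/eqP; rewrite -[RHS]h /b; by field.
have s0 : s = 0 by rewrite /s big1 // => z zN; rewrite -ao // a0 //; move: zN; rewrite !inE => /and3P[].
have lw : l [set v; w] = lu.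
  have := a0 u u_N; rewrite au s0 /b => h; lra.
have lo z : z \in N -> z != u -> z != w -> l [set v; z] = 0.
  by move=> zN zu zw; rewrite -ao ?a0 // !inE zw zu.
(* The edges vu and vw are replaced by the pair uw with half the stress, because v is half as far
   from u as w is. *)
pose l' e := if e == [set u; w] then lu / 2 else l e.
have uwnB : [set u; w] \notin B by apply: contra uwB; apply: (subsetP (sub_cl _ _)).
have lB e : e \in B -> l' e = l e.
  by move=> eB; rewrite /l'; case: eqP => // ee; rewrite ee (negPf uwnB) in eB.
have l'0 : forall e, e \in [set u; w] |: B -> l' e = 0.
  move=> e eB'; apply: (indep_stress iB') (eB') => y c.
  have [->|yv] := eqVneq y v.
    rewrite big1 // => f; rewrite !inE => /orP[/eqP->|/hB vf].
      by rewrite /rig !inE eq_sym (negPf uv) eq_sym (negPf wv) mulr0.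
    by rewrite /rig (negPf vf) mulr0.
  rewrite big_setU1 //= {1}/l' eqxx.
  rewrite (eq_bigr (fun e => l e * rig p' e y c)) => [|f fB]; last first.
    rewrite lB //; congr (_ * _); apply: rig_eq => x xf; rewrite /p'.
    by case: eqP => // xv; have := hB f fB; rewrite -xv xf.
  have := st y c; rewrite sum_star_other // addrC => h; rewrite -[RHS]h; congr (_ + _).
  have [->|yu] := eqVneq y u.
    by rewrite u_N rigE 1?eq_sym // p'v p'x // -/lu; field.
  have [->|yw] := eqVneq y w.
    by rewrite w_N setUC rigE // p'v p'x // lw; by field.
  rewrite /rig !inE (negPf yu) (negPf yw) mulr0; case: ifP => // yN.
  by rewrite lo // mul0r.
have lu0 : lu = 0.
  by have := l'0 [set u; w]; rewrite !inE eqxx /l' eqxx => /(_ isT) h; lra.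
move=> e /setUP[eB|/imsetP[z zN ->]]; first by rewrite -lB // l'0 // !inE eB orbT.
have [->|zu] := eqVneq z u; first exact: lu0.
by have [->|zw] := eqVneq z w; [rewrite lw|apply: lo].
Qed.

End Generic.

(* Properties of the rank function of the generic [d]-dimensional rigidity
   matroid; the last one comes from moving [v] to the midpoint of [u] and [w]. *)
Record is_rigid (V : finType) d (r : {set {set V}} -> nat) : Prop := IsRigid {
  rigid_rank : is_rank r;
  rigid_Kn (U : {set V}) : #|U| <= d.+1 -> r (Kn U) = #|Kn U|;
  rigid_dep (U : {set V}) (v x : V) : #|U| = d.+2 -> v \in U -> x \in U -> v != x ->
    [set v; x] \in cl r (Kn U :\ [set v; x]);
  rigid_vertex (F : {set {set V}}) (v : V) : F \subset Kn setT ->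
    r (F :\: inc F v) + minn d #|nb F v| <= r F;
  rigid_nonclosed (F : {set {set V}}) (v u w : V) : F \subset Kn setT ->
    d < #|nb F v| -> u \in nb F v -> w \in nb F v -> u != w ->
    [set u; w] \notin cl r (F :\: inc F v) -> r (F :\: inc F v) + d.+1 <= r F }.

Lemma generic_rigid (V : finType) d : exists r : {set {set V}} -> nat, is_rigid d r.
Proof.
have [p0 max0] := generic_config V d; exists (rk p0); split.
- exact: rk_rank.
- exact: rk_KnE.
- exact: rk_K_dep.
- exact: rank_vertex.
- exact: rank_vertex_nonclosed.
Qed.

(** * Rank of flats *)

Lemma ex_subset_card (T : finType) (A : {set T}) k : k <= #|A| ->
  exists B : {set T}, B \subset A /\ #|B| = k.
Proof.
move=> kA; exists [set u in take k (enum A)]; split.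
  by apply/subsetP => u; rewrite inE => /mem_take; rewrite mem_enum.
by rewrite cardsE (card_uniqP _) ?take_uniq ?enum_uniq // size_takel -?cardE.
Qed.

Lemma card_Kn (V : finType) (U : {set V}) : #|Kn U| = 'C(#|U|, 2).
Proof.
by rewrite -cards_draws; apply: eq_card => e; rewrite !inE andbC.
Qed.

Section RigidRank.
Variables (V : finType) (d : nat) (r : {set {set V}} -> nat).
Hypothesis rP : is_rigid d r.
Implicit Types (e : {set V}) (F : {set {set V}}) (U W K N : {set V}) (u v w x y : V).
Let rR : is_rank r := rigid_rank rP.
Local Notation D := ('C(d.+1, 2)).

Lemma double_D : 2 * D = d * d.+1.
Proof. by have := bin_ffact d.+1 2; rewrite !ffactnS ffactn0 !factS fact0 /=; nia. Qed.

Lemma rigid_Kn_eq W : d <= #|W| -> r (Kn W) + D = d * #|W|.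
Proof.
move: {2}(#|W| - d) (erefl (#|W| - d)) => n; elim: n W => [|n IHn] W eW dW.
  have cW : #|W| = d by lia.
  rewrite (rigid_Kn rP) ?cW // card_Kn cW.
  by have := double_D; rewrite binS bin1; nia.
have /card_gt0P[v vW] : 0 < #|W| by lia.
have cWv : #|W| = #|W :\ v|.+1 by rewrite (cardsD1 v) vW.
have := IHn (W :\ v); rewrite cWv mulnS => /(_ _ _) IH.
have {IH}-> : d * #|W :\ v| = r (Kn (W :\ v)) + D by rewrite IH //; lia.
suff : r (Kn W) = r (Kn (W :\ v)) + d by lia.
have delE : Kn W :\: inc (Kn W) v = Kn (W :\ v).
  apply/setP => e; rewrite !inE subsetD1.
  by case: (#|e| == 2); case: (e \subset W); case: (v \in e).
apply/eqP; rewrite eqn_leq; apply/andP; split; last first.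
  have := rigid_vertex rP (F := Kn W) v (KnS (subsetT _)).
  by rewrite delE nb_Kn // (minn_idPl _) //; lia.
(* The d edges from v to U span every further edge vx at v: on v, x and U all pairs except vx are
   available, and these span vx. *)
have [|U [sU cU]] := @ex_subset_card _ (W :\ v) d; first by lia.
have vU : v \notin U by apply/negP => /(subsetP sU); rewrite !inE eqxx.
apply: (@leq_trans (r (Kn (W :\ v) :|: star v U))); last first.
  have := rank_submod rR (Kn (W :\ v)) (star v U).
  by have := rank_card rR (star v U); rewrite card_star // cU; lia.
apply: (rank_le_cl rR); apply/subsetP => e eK.
have [ve|ve] := boolP (v \in e); last first.
  apply: (subsetP (sub_cl _ _)); apply/setUP; left; rewrite -delE in_setD eK andbT.
  by rewrite inE negb_and ve orbT.
have [x xv ee] := edge2P eK ve.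
have xW : x \in W by move: eK; rewrite ee in_Kn2 => /and3P[].
have [xU|xU] := boolP (x \in U).
  by apply: (subsetP (sub_cl _ _)); rewrite ee in_setU orbC star_f.
rewrite ee; apply: (subsetP (clS rR _)) (rigid_dep rP (U := v |: (x |: U)) _ _ _ _).
- apply/subsetP => f /setD1P[fvx fK].
  have [vf|vf] := boolP (v \in f).
    have [y yv ef] := edge2P fK vf; rewrite in_setU orbC ef star_f //.
    move: fvx fK; rewrite ef in_Kn2 !inE eqxx /= (negPf yv) /= => vy /andP[_ /orP[/eqP yx|//]].
    by rewrite yx eqxx in vy.
  move: fK; rewrite in_setU inE => /andP[c2 sf]; rewrite inE c2 /=.
  apply/orP; left; apply/subsetP => y yf; rewrite !inE.
  have yv : y != v by apply: contraNneq vf => <-.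
  move: (subsetP sf y yf); rewrite !inE (negPf yv) /= => /orP[/eqP->//|/(subsetP sU)].
  by rewrite !inE => /andP[].
- by rewrite !cardsU1 !inE eq_sym (negPf xv) (negPf vU) xU cU.
- by rewrite !inE eqxx.
- by rewrite !inE eqxx orbT.
by rewrite eq_sym.
Qed.

(* The closed edge sets of the matroid, seen in the complete graph. *)
Definition flat F := F \subset Kn setT /\
  forall u v, u != v -> [set u; v] \in cl r F -> [set u; v] \in F.

(** On v, x and d vertices of K the flat contains all edges of a complete graph on d+2 vertices
    except vx, and these span vx. *)
Lemma flat_glue F K v x : flat F -> d <= #|K| -> v \notin K -> x \notin K -> v != x ->
  Kn K \subset F -> (forall y, y \in K -> [set v; y] \in F /\ [set x; y] \in F) ->
  [set v; x] \in F.
Proof.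
move=> [FK fl] dK vK xK vx KF vxF; apply: fl => //.
have [U [sU cU]] := ex_subset_card dK.
have vU : v \notin U by apply: contra vK; apply: (subsetP sU).
have xU : x \notin U by apply: contra xK; apply: (subsetP sU).
apply: (subsetP (clS rR _)) (rigid_dep rP (U := v |: (x |: U)) _ _ _ _) => //.
- apply/subsetP => f /setD1P[fvx fK].
  have [vf|vf] := boolP (v \in f).
    have [y yv ef] := edge2P fK vf; move: fvx fK; rewrite ef in_Kn2 !inE eqxx /= (negPf yv) /=.
    move=> vy /andP[_ /orP[/eqP yx|/(subsetP sU) yK]]; last by case: (vxF y yK).
    by rewrite yx eqxx in vy.
  have [xf|xf] := boolP (x \in f).
    have [y yx ef] := edge2P fK xf; move: fvx fK vf; rewrite ef in_Kn2 !inE eqxx /= (negPf yx) /=.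
    move=> xy /and3P[_ _ yvU]; rewrite (negPf vx) /= eq_sym => yv.
    by move: yvU; rewrite (negPf yv) => /(subsetP sU) yK; case: (vxF y yK).
  apply: (subsetP KF); move: fK; rewrite !inE => /andP[-> sf] /=.
  apply/subsetP => y yf; move: (subsetP sf y yf); rewrite !inE => /or3P[/eqP yv|/eqP yx|/(subsetP sU)//].
    by rewrite -yv yf in vf.
  by rewrite -yx yf in xf.
- by rewrite !cardsU1 !inE (negPf vx) (negPf vU) xU cU.
- by rewrite !inE eqxx.
by rewrite !inE eqxx orbT.
Qed.

Lemma Kn_del F W v : (F :&: Kn W) :\: inc (F :&: Kn W) v = F :&: Kn (W :\ v).
Proof.
apply/setP => e; rewrite !inE subsetD1.
by case: (e \in F); case: (#|e| == 2); case: (e \subset W); case: (v \in e).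
Qed.

Definition clq F N := Kn N \subset F.

Lemma clqP F N : reflect (forall x y, x \in N -> y \in N -> x != y -> [set x; y] \in F)
  (clq F N).
Proof.
apply: (iffP subsetP) => [h x y xN yN xy|h e]; first by apply: h; rewrite in_Kn2 xy xN.
rewrite inE => /andP[/cards2P[x [y [xy ->]]]].
by rewrite subUset !sub1set => /andP[xN yN]; apply: h.
Qed.

Lemma nclqP F N : ~~ clq F N ->
  exists x y, [/\ x \in N, y \in N, x != y & [set x; y] \notin F].
Proof.
case/subsetPn=> e; rewrite inE => /andP[/cards2P[x [y [xy ->]]]].
by rewrite subUset !sub1set => /andP[xN yN] h; exists x, y.
Qed.

Lemma clqS F N N' : N \subset N' -> clq F N' -> clq F N.
Proof. by move=> /KnS; apply: subset_trans. Qed.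

(** The vertices v and w are both joined to the clique formed by u and the rest of N, which has at
    least d vertices, so [flat_glue] supplies vw. Consequently at most one deletion turns a large
    non-clique neighbourhood into a clique. *)
Lemma clq_del F N u v w : flat F -> N \subset nb F u -> d < #|N| -> v \in N -> w \in N ->
  v != w -> clq F (N :\ v) -> clq F (N :\ w) -> clq F N.
Proof.
move=> fl sN dN vN wN vw /clqP cv /clqP cw.
have vwF : [set v; w] \in F.
  have uN : u \notin N by apply: contra (nbxx F u); apply: (subsetP sN).
  have ux x : x \in N -> [set u; x] \in F by move/(subsetP sN); rewrite nbP => /andP[].
  apply: (@flat_glue F (u |: (N :\ v :\ w)) v w) => //.
  - rewrite cardsU1 !inE (negPf uN) !andbF /=.
    move: dN; rewrite (cardsD1 v) vN (cardsD1 w (N :\ v)) !inE eq_sym vw wN /=; lia.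
  - by rewrite !inE eqxx /= andbF orbF; apply: contraNneq uN => <-.
  - by rewrite !inE eqxx /= orbF; apply: contraNneq uN => <-.
  - apply/clqP => x y; rewrite !inE.
    case/predU1P => [->|/and3P[xw xv xN]]; case/predU1P => [->|/and3P[yw yv yN]]; rewrite ?eqxx //.
    + by move=> _; apply: ux.
    + by move=> _; rewrite setUC; apply: ux.
    by move=> xy; apply: cv; rewrite // !inE ?xv ?yv.
  move=> y /setU1P[->|]; first by rewrite ![[set _; u]]setUC !ux.
  rewrite !inE => /and3P[yw yv yN]; split.
    by apply: cw; rewrite ?inE ?vw ?yw // eq_sym.
  by apply: cv; rewrite ?inE ?yv 1?eq_sym ?vw // eq_sym.
apply/clqP => x y xN yN xy.
have [xv|xv] := eqVneq x v; last first.
  have [yv|yv] := eqVneq y v; last by apply: cv; rewrite ?inE ?xv ?yv.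
  have [->|xw] := eqVneq x w; first by rewrite yv setUC.
  by apply: cw; rewrite ?inE ?xw ?xN ?yv ?vw.
have [->|yw] := eqVneq y w; first by rewrite xv.
by apply: cw => //; rewrite !inE ?yw // xv vw.
Qed.

Import Order.TTheory GRing.Theory Num.Theory.
Local Open Scope ring_scope.

(* Contribution to the rank of a flat of a vertex with [a] neighbours in it, [c]
   telling whether they form a clique.  The values are those for which the
   averaging recursion [phi_step] is tight. *)
Definition phi (c : bool) (a : nat) : rat :=
  if (a < d)%N then a%:R / 2 else
  if c then d%:R - D%:R / a.+1%:R else d%:R + 1 / 2 - D%:R / a%:R.

Definition phiF F W u := phi (clq F (nb F u :&: W)) #|nb F u :&: W|.

(* Lower bound for the rank lost when such a vertex is deleted. *)
Definition gain (c : bool) (a : nat) : nat := if ~~ c && (d < a)%N then d.+1 else minn d a.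

Lemma rigid_gain F W v : flat F -> v \in W ->
  (r (F :&: Kn (W :\ v)) + gain (clq F (nb F v :&: W)) #|nb F v :&: W| <= r (F :&: Kn W))%N.
Proof.
move=> [FK fl] vW; have sK : F :&: Kn W \subset Kn setT by apply: subset_trans (subsetIl _ _) FK.
rewrite -(nbI_Kn F vW) -Kn_del /gain; case: ifP => [/andP[nc dN]|_]; last exact: rigid_vertex.
have [x [y [xN yN xy xyF]]] := nclqP nc.
apply: (rigid_nonclosed rP sK dN xN yN xy); rewrite Kn_del.
by apply: contra xyF => /(subsetP (clS rR (subsetIl _ _))); apply: fl.
Qed.

End RigidRank.

(** * Averaging bound for the rank of a flat *)

Section Averaging.
Import Order.TTheory GRing.Theory Num.Theory.
Local Open Scope ring_scope.
Variables (V : finType) (d : nat) (r : {set {set V}} -> nat).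
Hypothesis rP : is_rigid d r.
Hypothesis d_gt0 : (0 < d)%N.
Implicit Types (e : {set V}) (F : {set {set V}}) (U W K N : {set V}) (u v w x y : V).
Local Notation D := ('C(d.+1, 2)).

Lemma double_DQ : 2 * D%:R = d%:R * (d%:R + 1) :> rat.
Proof. by have := congr1 (fun n : nat => n%:R : rat) (double_D d); rewrite !natrM natr1. Qed.

Lemma phi_small c a : (a <= d)%N -> phi d c a = a%:R / 2.
Proof.
rewrite leq_eqVlt /phi => /orP[/eqP->|->] //; rewrite ltnn.
have := double_DQ; have : 0 < d%:R :> rat by rewrite ltr0n.
rewrite -(natr1 d); move: d%:R D%:R => x y x0 yE.
by case: c; [have -> : y = x * (x + 1) / 2 by lra|have -> : y = x * (x + 1) / 2 by lra]; field; lra.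
Qed.

Lemma phi_clique a : (d <= a)%N -> phi d true a = d%:R - D%:R / (a%:R + 1).
Proof. by rewrite /phi ltnNge => -> /=; rewrite natr1. Qed.

Lemma phi_nonclique a : (d <= a)%N -> phi d false a = d%:R + 1 / 2 - D%:R / a%:R.
Proof. by rewrite /phi ltnNge => ->. Qed.

Lemma phi_le_nonclique a : (d < a)%N -> phi d true a.-1 <= phi d false a.-1.
Proof.
case: a => // a; rewrite ltnS => da /=; rewrite phi_clique // phi_nonclique //.
have a0 : 0 < a%:R :> rat by rewrite ltr0n; lia.
have : d%:R <= a%:R :> rat by rewrite ler_nat.
have := double_DQ; have : 0 < d%:R :> rat by rewrite ltr0n.
move: d%:R D%:R a%:R a0 => x y z z0 x0 yE xz.
rewrite -subr_ge0 (_ : _ - _ = (z * (z + 1) - 2 * y) / (2 * z * (z + 1))); last by field; lra.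
by rewrite divr_ge0 // ?yE; nra.
Qed.

(** This is the recursion for u when the first vertex to be deleted is u itself or one of its
    neighbours, each choice counted once. In the non-clique case with more than d neighbours, the
    gain d+1 balances the single neighbour whose deletion may leave a clique. *)
Lemma phi_step F N u : flat r F -> N \subset nb F u ->
  (#|N|.+1)%:R * phi d (clq F N) #|N| <=
  (gain d (clq F N) #|N|)%:R + \sum_(v in N) phi d (clq F (N :\ v)) #|N :\ v|.
Proof.
move=> fl sN; set a := #|N|.
have cNv v : v \in N -> #|N :\ v| = a.-1 by move=> vN; rewrite /a (cardsD1 v N) vN.
have [ad|da] := leqP a d.
  rewrite phi_small // (eq_bigr (fun=> a.-1%:R / 2)); last first.
    by move=> v vN; rewrite cNv // phi_small //; lia.
  rewrite sumr_const -/a /gain ltnNge ad andbF (minn_idPr ad) -mulr_natr.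
  case: (a) => [|b]; first by rewrite mul0r mulr0 addr0.
  by rewrite /= -!(natr1 b.+1) -(natr1 b); lra.
have a0 : 0 < a%:R :> rat by rewrite ltr0n; lia.
have a1 : (a.-1)%:R = a%:R - 1 :> rat by rewrite -[X in X%:R - 1](ltn_predK da) -(natr1 a.-1); lra.
have am0 : 0 < a%:R - 1 :> rat by rewrite -a1 ltr0n; lia.
have dm : (d <= a.-1)%N by lia.
have [cN|ncN] := boolP (clq F N).
  rewrite (eq_bigr (fun=> phi d true a.-1)); last first.
    by move=> v vN; rewrite cNv // (clqS (subD1set _ _) cN).
  rewrite sumr_const -/a /gain (minn_idPl (ltnW da)) -mulr_natr !phi_clique ?(ltnW da) //.
  rewrite a1 -(natr1 a) subrK; move: d%:R D%:R => x y; rewrite -subr_ge0 [X in _ <= X](_ : _ = 0) //; field; lra.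
have [v0 hv0] : exists v0, forall v, v \in N -> v != v0 -> ~~ clq F (N :\ v).
  have [[v [vN cv]]|h] := classic (exists v, v \in N /\ clq F (N :\ v)).
    exists v => w wN wv; apply: contra ncN => cw.
    exact: (clq_del rP fl sN da wN vN wv).
  exists u => v vN _; apply/negP => cv; apply: h; by exists v.
rewrite /gain /= da phi_nonclique ?(ltnW da) //.
have lowall v : v \in N -> phi d true a.-1 <= phi d (clq F (N :\ v)) #|N :\ v|.
  by move=> vN; rewrite cNv //; case: clq => //; apply: phi_le_nonclique.
have main : phi d true a.-1 + (a%:R - 1) * phi d false a.-1 <=
    \sum_(v in N) phi d (clq F (N :\ v)) #|N :\ v|.
  have [v1 v1N hv1] : exists2 v1, v1 \in N & forall v, v \in N -> v != v1 -> ~~ clq F (N :\ v).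
    have [vN|vN] := boolP (v0 \in N); first by exists v0.
    have /card_gt0P[v1 v1N] : (0 < #|N|)%N by rewrite -/a; lia.
    by exists v1 => // v vN' _; apply: hv0 => //; apply: contraNneq vN => <-.
  rewrite (bigD1 v1) //= lerD ?lowall //.
  rewrite (eq_bigr (fun=> phi d false a.-1)) => [|v /andP[vN vv1]]; last first.
    by rewrite cNv // (negPf (hv1 v vN vv1)).
  rewrite sumr_const -a1 -[X in _ <= X]mulr_natl (_ : #|_| = a.-1) //.
  rewrite -(cNv v1 v1N); apply: eq_card => v; rewrite !inE; exact: andbC.
apply: le_trans (lerD (lexx _) main).
rewrite phi_clique // phi_nonclique // a1 -(natr1 a) -(natr1 d) subrK.
move: d%:R D%:R => x y; rewrite -subr_ge0.
rewrite [X in _ <= X](_ : _ = 0) //; field; lra.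
Qed.

(** Induction on W, summed over all choices of the first deleted vertex. For a fixed u, deleting a
    non-neighbour leaves its contribution unchanged; the other choices are [phi_step]. *)
Lemma flat_rank_ge F W : flat r F -> \sum_(u in W) phiF d F W u <= (r (F :&: Kn W))%:R.
Proof.
move=> fl; move: {2}#|W| (erefl #|W|) => n; elim: n W => [|n IHn] W cW.
  by move/eqP: cW; rewrite cards_eq0 => /eqP->; rewrite big_set0 ler0n.
have n0 : 0 < n.+1%:R :> rat by rewrite ltr0n.
rewrite -(ler_pM2l n0).
pose g v : rat := (gain d (clq F (nb F v :&: W)) #|nb F v :&: W|)%:R.
have step : \sum_(v in W) (g v + \sum_(u in W :\ v) phiF d F (W :\ v) u) <=
    n.+1%:R * (r (F :&: Kn W))%:R.
  rewrite -cW mulr_natl -sumr_const; apply: ler_sum => v vW.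
  have := rigid_gain rP fl vW; rewrite -(ler_nat rat) natrD => h; apply: le_trans h.
  rewrite addrC lerD2r IHn //; by move: cW; rewrite (cardsD1 v) vW => -[].
apply: le_trans step; rewrite big_split /= mulr_sumr.
have exch : \sum_(v in W) \sum_(u in W :\ v) phiF d F (W :\ v) u =
    \sum_(u in W) \sum_(v in W :\ u) phiF d F (W :\ v) u.
  rewrite (exchange_big_dep (fun u => u \in W)) /=; last by move=> v u vW /setD1P[].
  apply: eq_bigr => u uW; apply: eq_bigl => v; rewrite !inE uW andbT eq_sym andbC.
  by [].
rewrite exch -big_split /=; apply: ler_sum => u uW.
set N := nb F u :&: W.
have sN : N \subset nb F u by apply: subsetIl.
have NW : N \subset W :\ u.
  apply/subsetP => v /setIP[vn vW]; rewrite !inE vW andbT.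
  by apply: contraNneq (nbxx F u) => {1}<-.
rewrite (bigID (mem N)) /= addrA.
have -> : \sum_(v in W :\ u | v \in N) phiF d F (W :\ v) u =
    \sum_(v in N) phi d (clq F (N :\ v)) #|N :\ v|.
  apply: eq_big => [v|v /andP[_ vN]].
    by case: (boolP (v \in N)) => [/(subsetP NW)->|]; rewrite ?andbF.
  by rewrite /phiF setIDA.
have -> : \sum_(v in W :\ u | v \notin N) phiF d F (W :\ v) u =
    (n%:R - #|N|%:R) * phiF d F W u.
  rewrite (eq_bigr (fun=> phiF d F W u)); last first.
    move=> v /andP[_ vN]; rewrite /phiF setIDA -/N.
    by rewrite (setDidPl _) // disjoint_sym disjoints1.
  have cWu : #|W :\ u| = n by move: cW; rewrite (cardsD1 u) uW => -[].
  rewrite sumr_const -[LHS]mulr_natl -cWu -natrB ?subset_leq_card //.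
  congr (_%:R * _); rewrite -(setIidPr NW) -cardsD; apply: eq_card => v.
  by rewrite in_setD andbC [LHS]unfold_in in_setI; case: (v \in W :\ u).
have := phi_step fl sN; rewrite -/(g u) -(natr1 n) -(natr1 #|N|) /phiF -/N.
move: (phi _ _ _) (g u) (\sum_(_ in N) _) => x y z; lra.
Qed.

End Averaging.

Section Handshake.
Variable V : finType.
Implicit Types (J : {set {set V}}) (W : {set V}).

Lemma handshake J W : J \subset Kn setT ->
  \sum_(v in W) #|nb J v :&: W| = 2 * #|J :&: Kn W|.
Proof.
move=> JK; have sK : J :&: Kn W \subset Kn setT by apply: subset_trans JK; apply: subsetIl.
transitivity (\sum_(v in W) \sum_(e in J :&: Kn W) (v \in e : nat)).
  apply: eq_bigr => v vW; rewrite -nbI_Kn // -card_inc // -sum1_card big_mkcond /=.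
  rewrite [RHS]big_mkcond /=; apply: eq_bigr => e _; rewrite inE.
  by case: (e \in _); case: (v \in e).
rewrite exchange_big /= mulnC -sum_nat_const; apply: eq_bigr => e.
rewrite !inE => /and3P[_ /eqP c2 /setIidPr eW].
transitivity #|W :&: e|; last by rewrite eW.
rewrite -sum1_card [RHS]big_mkcond [LHS]big_mkcond /=; apply: eq_bigr => v _.
by rewrite inE; case: (v \in W); case: (v \in e).
Qed.

End Handshake.

(* [k]-connectivity of the graph induced on [W]. *)
Definition sconn (V : finType) k (E : {set {set V}}) (W : {set V}) : Prop :=
  k < #|W| /\ forall A1 A2 : {set V}, A1 \subset W -> A2 \subset W ->
    A1 != set0 -> A2 != set0 -> [disjoint A1 & A2] ->
    (forall x y, x \in A1 -> y \in A2 -> [set x; y] \notin E) ->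
    k <= #|W :\: (A1 :|: A2)|.

Lemma sconn_mindeg (V : finType) k (E : {set {set V}}) (W : {set V}) v :
  sconn k E W -> v \in W -> k <= #|nb E v :&: W|.
Proof.
move=> [kW sep] vW; set N := nb E v :&: W.
have vN : v \notin N by rewrite inE (negPf (nbxx _ _)).
have [A0|A0] := eqVneq (W :\: (v |: N)) set0.
  have : #|W| <= #|v |: N|.
    by apply: subset_leq_card; rewrite -setD_eq0 A0.
  by rewrite cardsU1 vN; lia.
have := sep [set v] (W :\: (v |: N)); rewrite sub1set vW subsetDl A0.
rewrite -card_gt0 cards1 => /(_ isT isT isT isT).
have -> : [disjoint [set v] & W :\: (v |: N)] by rewrite disjoints1 !inE eqxx.
have -> : W :\: ([set v] :|: W :\: (v |: N)) = N.
  apply/setP => x; rewrite in_setD !in_setU in_setD in_setU1 in_set1.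
  have [->|xv] := eqVneq x v; first by rewrite (negPf vN).
  by rewrite /N in_setI; case: (x \in nb E v); case: (x \in W).
apply=> // x y; rewrite inE => /eqP-> {x}; rewrite in_setD in_setU1 in_setI => /andP[h yW].
by move: h; rewrite negb_or yW andbT nbP => /andP[->] /=.
Qed.

(** * Rank of flats in highly connected graphs *)

Section EdgeCount.
Import Order.TTheory GRing.Theory Num.Theory.
Local Open Scope ring_scope.
Variables (V : finType) (d : nat) (r : {set {set V}} -> nat).
Hypothesis rP : is_rigid d r.
Hypothesis d_gt0 : (0 < d)%N.
Implicit Types (e : {set V}) (E F J : {set {set V}}) (U W K N : {set V}) (u v w x y : V).
Local Notation D := ('C(d.+1, 2)).

(** Discharging: each edge of J gives one half to each of its ends, and every vertex of W has to
    collect T * d. Edges of J may leave W as long as they stay in W0. *)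
Lemma charge_rank T F J W W0 : flat r F -> J \subset Kn setT -> W \subset W0 ->
  (forall v, v \in W -> T%:R * d%:R <= T%:R * phiF d F W v + #|nb J v :&: W0|%:R / 2) ->
  (T * (d * #|W|) <= T * r (F :&: Kn W) + #|J :&: Kn W0|)%N.
Proof.
move=> fl JK WW0 ch; rewrite -(ler_nat rat) natrD !natrM.
have hs := congr1 (fun n : nat => n%:R : rat) (handshake W0 JK).
rewrite natrM natr_sum in hs.
have leJ : \sum_(v in W) (#|nb J v :&: W0|%:R / 2) <= #|J :&: Kn W0|%:R :> rat.
  rewrite -mulr_suml; move: hs; rewrite (big_setID W) /= (setIidPr WW0) => hs.
  have : 0 <= \sum_(v in W0 :\: W) (#|nb J v :&: W0|%:R : rat) by apply: sumr_ge0.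
  by lra.
apply: le_trans (lerD (ler_wpM2l (ler0n _ _) (flat_rank_ge rP d_gt0 W fl)) leJ).
rewrite mulr_sumr -big_split /= mulrA mulr_natr -sumr_const.
exact: ler_sum.
Qed.

Lemma phi_ge_clique c a : (d <= a)%N -> d%:R - D%:R / (a%:R + 1) <= phi d c a.
Proof.
move=> da; rewrite -phi_clique //; case: c => //.
by have := @phi_le_nonclique d d_gt0 a.+1; apply.
Qed.

(** This is the packing condition for two bases, up to the deficit D of each. Deletions shrink W
    until either discharging works at every vertex or the flat is complete on W. *)
Lemma connected_rank_ge k F J W : (1 < d)%N -> (4 * D <= k)%N -> flat r F ->
  J \subset Kn setT -> sconn k (F :|: J) W ->
  (2 * (d * #|W|) <= 2 * r (F :&: Kn W) + #|J :&: Kn W| + 2 * D)%N.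
Proof.
move=> d1 kD fl JK; have [FK _] := fl; have dD := double_D d.
move: {2}#|W| (erefl #|W|) => n; elim: n W => [|n IHn] W cW conn.
  by case: conn; rewrite cW.
(* Discharging fails exactly for vertices of this kind, since nothing makes up for [phi] being below
   d. Deleting such a vertex lowers the rank by at least d. *)
have [[v [vW bv cv]]|h] := classic (exists v,
    [/\ v \in W, nb J v :&: W = set0 & clq F (nb F v :&: W)]).
  have nH x : x \in W -> (x \in nb (F :|: J) v) = (x \in nb F v).
    move=> xW; rewrite !nbP in_setU; case: eqP => //= xv.
    have /setP/(_ x) := bv; rewrite !inE xW andbT; case: eqP => //= _.
    by move=> ->; rewrite orbF.
  (* On k+1 vertices the degree bound makes v adjacent to all others, so the flat is complete on W
     and its rank is known exactly. *)
  have [cWk|Wk] := eqVneq #|W| k.+1.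
    have -> : F :&: Kn W = Kn W.
      apply/setIidPr/clqP => x y xW yW xy.
      have nv : nb F v :&: W = W :\ v.
        apply/eqP; rewrite eqEcard; apply/andP; split.
          apply/subsetP => z /setIP[zn zW]; rewrite !inE zW andbT.
          by apply: contraTneq zn => ->; apply: nbxx.
        have := sconn_mindeg conn vW; move: cWk; rewrite (cardsD1 v W) vW add1n => -[->].
        move/leq_trans; apply; apply: subset_leq_card; apply/subsetP => z.
        by rewrite !in_setI => /andP[zn zW]; rewrite zW andbT -nH.
      have vx z : z \in W -> z != v -> [set v; z] \in F.
        move=> zW zv; have : z \in nb F v :&: W by rewrite nv !inE zv.
        by rewrite in_setI nbP => /andP[/andP[]].
      have [xv|xv] := eqVneq x v; first by rewrite xv vx // -xv eq_sym.
      have [->|yv] := eqVneq y v; first by rewrite setUC; apply: vx.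
      by move/clqP: cv; apply=> //; rewrite nv !inE ?xv ?yv.
    have := rigid_Kn_eq rP (W := W); rewrite cWk; nia.
  have cWv : #|W :\ v| = n by move: cW; rewrite (cardsD1 v) vW => -[].
  have := IHn _ cWv; case: conn => kW sep.
  (* The neighbours of v form a clique and cannot meet both sides of a separation of [W :\ v]; v
     joins one side, the other having no neighbour of v, without enlarging the separator. *)
  have conn' : sconn k (F :|: J) (W :\ v).
    split; first by rewrite cWv; lia.
    move=> A1 A2 s1 s2 n1 n2 dj no.
    have [sW1 sW2] : A1 \subset W /\ A2 \subset W.
      by split; [apply: subset_trans s1 _|apply: subset_trans s2 _]; apply: subD1set.
    have nvA1 : v \notin A1 by apply/negP => /(subsetP s1); rewrite !inE eqxx.
    have nvA2 : v \notin A2 by apply/negP => /(subsetP s2); rewrite !inE eqxx.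
    have side (B1 B2 : {set V}) : B1 \subset W -> B2 \subset W -> v \notin B1 -> v \notin B2 ->
       B1 != set0 -> B2 != set0 ->
       [disjoint B1 & B2] -> (forall x y, x \in B1 -> y \in B2 -> [set x; y] \notin F :|: J) ->
       (forall y, y \in B2 -> y \notin nb F v) -> (k <= #|W :\ v :\: (B1 :|: B2)|)%N.
      move=> t1 t2 v1 v2 m1 m2 dB noB nvB.
      have := sep (v |: B1) B2; rewrite subUset sub1set vW t1 t2 m2 => /(_ isT isT).
      have -> : v |: B1 != set0 by apply/set0Pn; exists v; rewrite !inE eqxx.
      rewrite -[[disjoint _ & _]]setI_eq0 setIUl setU_eq0 !setI_eq0 disjoints1 v2 dB => /(_ isT isT isT).
      rewrite setDDl setUA; apply=> x y /setU1P[->|xB] yB; last exact: noB.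
      have yv : y != v by apply: contraNneq v2 => <-.
      have := nvB y yB; rewrite -nH ?(subsetP t2) // nbP yv /=.
      by [].
    have [[y yA2 yn]|hA2] := classic (exists2 y, y \in A2 & y \in nb F v); last first.
      apply: side => // y yA; apply/negP => yn; apply: hA2; by exists y.
    rewrite setUC; apply: side => //; first by rewrite disjoint_sym.
      by move=> x z xA zA; rewrite setUC; apply: no.
    move=> x xA1; apply/negP => xn; have := no x y xA1 yA2.
    rewrite in_setU => /norP[/negP nF _]; apply: nF; move/clqP: cv; apply.
    - by rewrite in_setI xn (subsetP sW1).
    - by rewrite in_setI yn (subsetP sW2).
    by apply: contraTneq xA1 => ->; rewrite (disjointFl dj yA2).
  move/(_ conn'); rewrite cWv cW.
  have := subset_leq_card (setIS J (KnS (subD1set W v))).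
  have := rigid_gain rP fl vW.
  rewrite cv /gain /= => h1 h2 h3.
  have : (d <= #|nb F v :&: W|)%N.
    have := sconn_mindeg (conj kW sep) vW.
    suff : nb (F :|: J) v :&: W \subset nb F v :&: W by move/subset_leq_card; nia.
    by apply/subsetP => z; rewrite !in_setI => /andP[zn zW]; rewrite zW andbT -nH.
  by move=> dN; move: h1; rewrite (minn_idPl dN); nia.
suff : (2 * (d * #|W|) <= 2 * r (F :&: Kn W) + #|J :&: Kn W|)%N by lia.
apply: (charge_rank fl JK (subxx W)) => v vW.
have := sconn_mindeg conn vW.
set a := #|nb F v :&: W|; set b := #|nb J v :&: W|.
have : (#|nb (F :|: J) v :&: W| <= a + b)%N.
  apply: leq_trans (leq_card_setU _ _); apply: subset_leq_card; apply/subsetP => z.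
  rewrite in_setU !in_setI !nbP in_setU => /andP[/andP[-> /orP[]->] ->] //=.
  by rewrite orbT.
move=> ab ka; have {}ab : (4 * D <= a + b)%N by lia.
have hb : b = 0%N -> ~~ clq F (nb F v :&: W).
  move=> b0; apply/negP => cv; apply: h; exists v; split=> //.
  by apply/eqP; rewrite -cards_eq0 -/b b0.
rewrite /phiF -/a.
have dDQ := double_DQ d.
have d2 : 2 <= d%:R :> rat by rewrite (ler_nat rat 2).
have abQ : 4 * D%:R <= a%:R + b%:R :> rat by rewrite -natrM -natrD ler_nat.
have [ad|da] := ltnP a d.
  rewrite phi_small ?(ltnW ad) //; have : a%:R <= d%:R :> rat by rewrite ler_nat ltnW.
  move: (d%:R) (D%:R) (a%:R) (b%:R) (ler0n rat a) dDQ d2 abQ => x y z t *; nra.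
have a0 : 0 < a%:R :> rat by rewrite ltr0n; lia.
have [b0|b0] := posnP b.
  rewrite (negPf (hb b0)) phi_nonclique // b0 mul0r addr0.
  rewrite b0 addr0 in abQ.
  have : D%:R / a%:R <= 1 / 2 :> rat.
    rewrite ler_pdivrMr //; have := ler0n rat D; lra.
  lra.
have := phi_ge_clique (clq F (nb F v :&: W)) da; move: (phi _ _ _) => ph.
have b1 : 1 <= b%:R :> rat by rewrite (ler_nat rat 1).
(* As b >= 1, the product b(a+1) is at least a + b, hence at least 4D. *)
have : D%:R / (a%:R + 1) <= b%:R / 4 :> rat.
  by rewrite ler_pdivrMr; nra.
lra.
Qed.

End EdgeCount.

(** * Orientations *)

Section Tails.
Variable V : finType.
Implicit Types (e : {set V}) (B E : {set {set V}}) (X Z W : {set V}) (u v w : V).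
Implicit Types (x : V -> nat) (t : {set V} -> V).

(** An orientation is encoded by the map [t] that sends each edge to its tail. *)
Definition outdeg t B v := #|[set e in B | t e == v]|.

Lemma sum_outdeg t B Z : \sum_(v in Z) outdeg t B v = #|[set e in B | t e \in Z]|.
Proof.
rewrite -[RHS]sum1_card (partition_big t (mem Z)) /= => [|e]; last by rewrite inE => /andP[].
apply: eq_bigr => v vZ; rewrite /outdeg -sum1_card; apply: eq_bigl => e; rewrite !inE.
by case: (t e =P v) => [->|]; rewrite ?vZ ?andbT ?andbF.
Qed.

Lemma sum_modular x Z Z' : \sum_(v in Z :|: Z') x v + \sum_(v in Z :&: Z') x v =
  \sum_(v in Z) x v + \sum_(v in Z') x v.
Proof.
rewrite ![\sum_(v in _) x v]big_mkcond -!big_split /=; apply: eq_bigr => v _.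
by rewrite !inE; case: (v \in Z); case: (v \in Z'); rewrite ?addn0.
Qed.

Lemma ind_supermod B Z Z' : #|B :&: Kn Z| + #|B :&: Kn Z'| <=
  #|B :&: Kn (Z :|: Z')| + #|B :&: Kn (Z :&: Z')|.
Proof.
rewrite -cardsUI -setIUr -setIIr KnI leq_add2r.
by apply: subset_leq_card; apply: setIS; rewrite subUset !KnS ?subsetUl ?subsetUr.
Qed.

(** Hakimi's theorem, by induction on the edges. If neither end of an edge can be its tail, there
    are tight sets Z and Z', each containing just one of the ends. The edge lies inside their union
    but in neither of them, which contradicts supermodularity. *)
Lemma hakimi B x (v0 : V) : B \subset Kn setT ->
  (forall Z, #|B :&: Kn Z| <= \sum_(v in Z) x v) ->
  exists t, (forall e, e \in B -> t e \in e) /\ forall v, outdeg t B v <= x v.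
Proof.
move: {2}#|B| (erefl #|B|) => n; elim: n B x => [|n IHn] B x cB BK hB.
  move/eqP: cB; rewrite cards_eq0 => /eqP B0; exists (fun=> v0).
  split=> [e|v]; first by rewrite B0 inE.
  by rewrite /outdeg B0 [#|_|](_ : _ = 0) //; apply/eqP; rewrite cards_eq0; apply/eqP/setP => e; rewrite !inE.
have /card_gt0P[e eB] : 0 < #|B| by rewrite cB.
have cBe : #|B :\ e| = n by move: cB; rewrite (cardsD1 e) eB => -[].
have : e \in Kn setT by apply: (subsetP BK).
rewrite inE => /andP[/cards2P[u [w [uw ee]]] _].
have eKn Z : (e \in Kn Z) = (u \in Z) && (w \in Z) by rewrite ee in_Kn2 uw.
have iBe Z : #|B :&: Kn Z| = ((u \in Z) && (w \in Z)) + #|(B :\ e) :&: Kn Z|.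
  by rewrite (cardsD1 e) in_setI eB eKn setIDAC.
pose x' y v := x v - (v == y).
have hx' y : y \in e -> (forall Z, y \in Z -> #|(B :\ e) :&: Kn Z| < \sum_(v in Z) x v) ->
    exists t, (forall e, e \in B -> t e \in e) /\ forall v, outdeg t B v <= x v.
  move=> ye hy; have xy : 0 < x y.
    by have := hy [set y]; rewrite inE eqxx big_set1 => /(_ isT); lia.
  have [|Z|t [tB ot]] := IHn (B :\ e) (x' y) cBe; first exact: subset_trans (subD1set _ _) BK.
    have [yZ|yZ] := boolP (y \in Z).
      have -> : \sum_(v in Z) x' y v = (x y).-1 + \sum_(v in Z :\ y) x v.
        rewrite (big_setD1 y yZ) /= /x' eqxx subn1; congr (_ + _).
        by apply: eq_bigr => v /setD1P[/negPf-> _]; rewrite subn0.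
      by have := hy Z yZ; rewrite (big_setD1 y yZ) /=; lia.
    rewrite (eq_bigr x) => [|v vZ].
      by apply: leq_trans (hB Z); rewrite iBe; lia.
    rewrite /x' (_ : (v == y) = false) ?subn0 //; by apply: contraNF yZ => /eqP <-.
  exists (fun f => if f == e then y else t f); split=> [f fB|v].
    by case: eqP => [->//|/eqP fe]; apply: tB; rewrite !inE fe.
  apply: (@leq_trans ((v == y) + outdeg t (B :\ e) v)); last first.
    by have := ot v; rewrite /x'; case: (v =P y) => [->|_]; lia.
  rewrite /outdeg (cardsD1 e) inE eB eqxx /= [y == v]eq_sym leq_add2l.
  apply: subset_leq_card; apply/subsetP => f; rewrite !inE.
  by case/and3P=> /negPf fe ->; rewrite fe.
have tight y z : e = [set y; z] -> ~ (forall Z, y \in Z -> #|(B :\ e) :&: Kn Z| < \sum_(v in Z) x v) ->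
    exists Z, [/\ y \in Z, z \notin Z & \sum_(v in Z) x v <= #|B :&: Kn Z|].
  move=> eyz h; apply: NNPP => h2; apply: h => Z yZ; rewrite ltnNge; apply/negP => le.
  apply: h2; exists Z; split=> //; last by rewrite iBe; lia.
  apply/negP => zZ; have eZ : e \in Kn Z.
    have : e \in Kn setT by apply: (subsetP BK).
    by rewrite eyz !in_Kn2 yZ zZ => /andP[->].
  by have := hB Z; rewrite iBe -eKn eZ; lia.
have [hu|/(tight u w ee)[Z [uZ wZ tZ]]] := classic (forall Z, u \in Z -> #|(B :\ e) :&: Kn Z| < \sum_(v in Z) x v).
  by apply: (hx' u) => //; rewrite ee !inE eqxx.
have ee' : e = [set w; u] by rewrite setUC.
have [hw|/(tight w u ee')[Z' [wZ' uZ' tZ']]] := classic (forall Z, w \in Z -> #|(B :\ e) :&: Kn Z| < \sum_(v in Z) x v).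
  by apply: (hx' w) => //; rewrite ee !inE eqxx orbT.
have := ind_supermod (B :\ e) Z Z'; have := sum_modular x Z Z'.
have := hB (Z :|: Z'); have := hB (Z :&: Z'); move: tZ tZ'.
rewrite !iBe !inE uZ wZ' (negPf wZ) (negPf uZ') !orbT /=; lia.
Qed.

Lemma hakimi_eq B x t : (forall v, outdeg t B v <= x v) ->
  \sum_v x v <= #|B| -> forall v, outdeg t B v = x v.
Proof.
move=> le sx v; apply/eqP; rewrite eqn_leq le leqNgt; apply/negP => lt.
have : \sum_v outdeg t B v < \sum_v x v.
  rewrite (bigD1 v) //= [X in _ < X](bigD1 v) //= -addSn leq_add //.
  by apply: leq_sum.
rewrite (eq_bigl (mem [set: V])) => [|u]; last by rewrite /= in_setT.
rewrite sum_outdeg (_ : [set _ in _ | _] = B); first lia.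
by apply/setP => e; rewrite !inE andbT.
Qed.

End Tails.

(** * Balanced orientations and the cut form of connectivity *)

Section Balanced.
Variable V : finType.
Implicit Types (e : {set V}) (B E : {set {set V}}) (X Y Z W : {set V}) (u v w : V).
Implicit Types (t : {set V} -> V).

(** H is a minimal set of vertices whose prescribed degree is rounded up such that Hakimi's
    condition holds. Minimality puts each vertex of H in a tight set, so a largest tight set Z
    contains H; outside Z all degrees are rounded down, and the prescribed total is at most the
    number of edges. *)
Lemma balanced E (v0 : V) : E \subset Kn setT ->
  exists t, (forall e, e \in E -> t e \in e) /\
    forall v, #|nb E v| <= 2 * outdeg t E v + 1 /\ 2 * outdeg t E v <= #|nb E v| + 1.
Proof.
move=> EK.
pose xs (H : {set V}) v := if v \in H then uphalf #|nb E v| else #|nb E v|./2.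
have half v : 2 * #|nb E v|./2 <= #|nb E v| by have := odd_double_half #|nb E v|; rewrite -mul2n; lia.
have uhalf v : #|nb E v| <= 2 * uphalf #|nb E v|.
  by have := odd_double_half #|nb E v|; rewrite uphalf_half -mul2n; lia.
have uhalf2 v : 2 * uphalf #|nb E v| <= #|nb E v| + 1.
  by have := odd_double_half #|nb E v|; rewrite uphalf_half -mul2n; lia.
have degZ Z : 2 * #|E :&: Kn Z| <= \sum_(v in Z) #|nb E v|.
  rewrite -handshake //; apply: leq_sum => v _.
  by apply: subset_leq_card; apply: subsetIl.
pose ok H := [forall Z : {set V}, #|E :&: Kn Z| <= \sum_(v in Z) xs H v].
have okT : ok setT.
  apply/forallP => Z; rewrite -(leq_pmul2l (isT : 0 < 2)) (leq_trans (degZ Z)) //.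
  by rewrite big_distrr /=; apply: leq_sum => v _; rewrite /xs inE uhalf.
case: (@arg_minnP _ setT ok (fun H => #|H|) okT) => H /forallP okH minH.
pose tight Z := \sum_(v in Z) xs H v <= #|E :&: Kn Z|.
have tight0 : tight set0 by rewrite /tight big_set0.
case: (@arg_maxnP _ set0 tight (fun Z => #|Z|) tight0) => Z tZ maxZ.
have HZ : H \subset Z.
  apply/subsetP => v vH; apply: contraT => vZ.
  have /forallPn[Z' ] : ~~ ok (H :\ v).
    by apply/negP => /minH; rewrite (cardsD1 v H) vH; lia.
  rewrite -ltnNge => ltZ'.
  have xsv u : u != v -> xs (H :\ v) u = xs H u by move=> uv; rewrite /xs !inE uv.
  have vZ' : v \in Z'.
    apply: contraT => vZ'; move: ltZ'; rewrite ltnNge (eq_bigr (xs H)) ?okH // => u uZ'.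
    by apply: xsv; apply: contraNneq vZ' => <-.
  have tZ' : tight Z'.
    apply: leq_trans ltZ'; rewrite !(big_setD1 v vZ') /=.
    rewrite [X in _ <= (_ + X).+1](eq_bigr (xs H)) => [|u /setD1P[uv _]]; last exact: xsv.
    by rewrite {1 3}/xs !inE eqxx vH /= uphalf_half; lia.
  have : tight (Z :|: Z').
    have := okH (Z :&: Z'); have := sum_modular (xs H) Z Z'.
    by have := ind_supermod E Z Z'; move: tZ tZ'; rewrite /tight; lia.
  move/maxZ; have : Z \proper Z :|: Z'.
    by apply/properP; split; [apply: subsetUl|exists v; rewrite // inE vZ' orbT].
  by move/proper_card; lia.
have sumH : \sum_v xs H v <= #|E|.
  have e1 (x : V -> nat) : \sum_(v in [set: V]) x v = \sum_v x v by apply: eq_bigl => v; rewrite inE.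
  have e2 (x : V -> nat) : \sum_v x v = \sum_(v in Z) x v + \sum_(v in ~: Z) x v.
    by rewrite (bigID (mem Z)) /=; congr (_ + _); apply: eq_bigl => v; rewrite inE.
  have hs : 2 * #|E| = \sum_v #|nb E v|.
    have := handshake setT EK; rewrite (setIidPl EK) e1 => <-.
    by apply: eq_bigr => v _; rewrite setIT.
  rewrite -(leq_pmul2l (isT : 0 < 2)) hs !e2 mulnDr leq_add //.
    by apply: leq_trans (degZ Z); rewrite leq_mul2l; exact: tZ.
  rewrite big_distrr /=; apply: leq_sum => v; rewrite inE => vZ.
  rewrite /xs (_ : (v \in H) = false) //.
  by apply: contraNF vZ; apply: (subsetP HZ).
have [t [tE ot]] := hakimi v0 EK okH.
have {}ot := hakimi_eq ot sumH.
exists t; split=> // v; rewrite ot /xs; have := half v; have := uhalf v; have := uhalf2 v.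
have := odd_double_half #|nb E v|; rewrite -mul2n.
by case: (v \in H); lia.
Qed.

Definition arc E t : rel V := fun x y => [&& x != y, [set x; y] \in E & t [set x; y] == x].

(* Cut form of [q]-connectivity of the digraph induced on [W]. *)
Definition qcut q (ar : rel V) W : Prop :=
  q < #|W| /\ forall X Y, X \subset W -> Y \subset W -> X != set0 -> Y != set0 ->
    [disjoint X & Y] -> #|W :\: (X :|: Y)| < q -> exists x y, [/\ x \in X, y \in Y & ar x y].

Lemma qcut_connected q ar : qcut q ar setT -> k_connected_rel ar q.
Proof.
case; rewrite cardsT => qV cut; split=> // S Sq x y xS yS.
apply: contraT => nxy.
pose X := [set z | connect (del ar S) x z & z \notin S].
have [||||||u [w [uX wY uw]]] := cut X (~: (X :|: S)).
- exact: subsetT.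
- exact: subsetT.
- by apply/set0Pn; exists x; rewrite inE connect0.
- by apply/set0Pn; exists y; rewrite !inE (negPf nxy) (negPf yS).
- by rewrite -setI_eq0; apply/eqP/setP => z; rewrite !inE; case: connect; case: (z \in S).
- apply: leq_ltn_trans Sq; apply: subset_leq_card; apply/subsetP => z; rewrite !inE.
  by case: connect; case: (z \in S).
move: uX wY; rewrite !inE => /andP[xu uS]; rewrite negb_or negb_and negbK.
case/andP=> /orP[xw wS|wS /negP[]]; last by [].
case/negP: xw; apply: connect_trans xu (connect1 _).
by apply/and3P.
Qed.

End Balanced.

Definition edges (G : sgraph) : {set {set G}} :=
  [set e | [exists x, exists y, edge x y && (e == [set x; y])]].

Lemma edgesP (G : sgraph) (x y : G) : ([set x; y] \in edges G) = edge x y.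
Proof.
rewrite inE; apply/existsP/idP => [[u /existsP[w /andP[uw /eqP exy]]]|xy]; last first.
  by exists x; apply/existsP; exists y; rewrite xy eqxx.
have uNw : u != w by apply: contraTneq uw => ->; rewrite edge_irrefl.
have : u \in [set x; y] by rewrite exy !inE eqxx.
have : w \in [set x; y] by rewrite exy !inE eqxx orbT.
rewrite !inE => /orP[]/eqP ew /orP[]/eqP eu; move: uNw uw; rewrite ew eu ?eqxx // => _.
by rewrite edge_sym.
Qed.

Lemma edges_Kn (G : sgraph) : edges G \subset Kn setT.
Proof.
apply/subsetP => e; rewrite inE => /existsP[x /existsP[y /andP[xy /eqP->]]].
by rewrite in_Kn2 !inE !andbT; apply: contraTneq xy => ->; rewrite edge_irrefl.
Qed.

Lemma k_connected_sconn k (G : sgraph) : k_connected k G -> sconn k (edges G) setT.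
Proof.
case=> kV conn; split; first by rewrite cardsT.
move=> A1 A2 _ _ /set0Pn[x xA] /set0Pn[y yA] dA noA; rewrite leqNgt; apply/negP => lt.
have /connectP[p] : connect (del (@edge G) (setT :\: (A1 :|: A2))) x y.
  by apply: conn => //; rewrite !inE ?xA ?yA ?orbT.
elim: p x xA => [|z p IHp] x xA /=; first by move=> _ xy; rewrite -xy (disjointFl dA yA) in xA.
case/andP=> /and3P[_ + xz] zp yl; rewrite !inE andbT negbK => /orP[zA|zA].
  exact: (IHp z).
by have := noA x z xA zA; rewrite edgesP xz.
Qed.

Lemma qcut_orientation q (G : sgraph) (t : {set G} -> G) :
  (forall e, e \in edges G -> t e \in e) -> qcut q (arc (edges G) t) setT ->
  has_k_connected_orientation q G.
Proof.
move=> tE cut; exists (arc (edges G) t); split; last exact: qcut_connected.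
split=> x y; first by rewrite /arc edgesP => /and3P[].
move=> xy; have xNy : x != y by apply: contraTneq xy => ->; rewrite edge_irrefl.
have xyE : [set x; y] \in edges G by rewrite edgesP.
rewrite /arc [[set y; x]]setUC xyE [y == x]eq_sym xNy /=.
move: (tE _ xyE); rewrite !inE => /orP[]/eqP ->; rewrite eqxx ?(negPf xNy) //.
by rewrite eq_sym (negPf xNy).
Qed.

(** * Extending an orientation *)

Section Contract.
Variables (E : finType) (r : {set E} -> nat) (A0 : {set E}).
Hypothesis rP : is_rank r.
Implicit Types A B : {set E}.

Definition contract A := r (A :|: A0) - r A0.

Lemma contractK A : contract A + r A0 = r (A :|: A0).
Proof. by rewrite subnK // rank_mono // subsetUr. Qed.

Lemma contract_rank : is_rank contract.
Proof.
split=> [A|A B AB|A B].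
- have := contractK A; have := rank_submod rP A A0; have := rank_card rP A; lia.
- have := contractK A; have := contractK B; have := rank_mono rP (setSU A0 AB); lia.
have := rank_submod rP (A :|: A0) (B :|: A0); rewrite -setUUl -setUIl.
by have := contractK A; have := contractK B; have := contractK (A :|: B);
  have := contractK (A :&: B); lia.
Qed.

Lemma contract_le A : contract A <= r A.
Proof. have := contractK A; have := rank_submod rP A A0; lia. Qed.

Lemma contract_indep A : indep contract A -> indep r A.
Proof.
rewrite /indep => /eqP cA; rewrite eqn_leq rank_card //= -cA.
exact: contract_le.
Qed.

End Contract.

Section Flats.
Variables (V : finType) (d : nat) (r : {set {set V}} -> nat).
Hypothesis rP : is_rigid d r.
Implicit Types (e : {set V}) (B E F J : {set {set V}}) (X Y Z W S : {set V}) (u v w : V).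
Let rR : is_rank r := rigid_rank rP.

Lemma flat_closure F : F \subset Kn setT -> exists F' : {set {set V}},
  [/\ F \subset F', flat r F' & r F' = r F].
Proof.
move=> FK; exists (cl r F :&: Kn setT); split.
- by rewrite subsetI FK sub_cl.
- split=> [|u v uv h]; first exact: subsetIr.
  rewrite in_setI in_Kn2 uv !in_setT !andbT -(cl_cl rR).
  exact: (subsetP (clS rR (subsetIl _ (Kn setT))) _ h).
apply/eqP; rewrite eqn_leq (rank_le_cl rR) ?subsetIl //= rank_mono //.
by rewrite subsetI FK sub_cl.
Qed.

Lemma sconnS k E E' W : E \subset E' -> sconn k E W -> sconn k E' W.
Proof.
move=> EE [kW sep]; split=> // A1 A2 s1 s2 n1 n2 dA no; apply: sep => // x y xA yA.
by apply: contra (no x y xA yA); apply: (subsetP EE).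
Qed.

Lemma dead_count q B t X S : d = 2 * q - 1 -> 0 < d -> indep r B -> B \subset Kn setT ->
  (forall v, v \in X -> outdeg t B v = d) -> X != set0 -> (forall e, e \in B -> t e \in e) ->
  (forall e, e \in B -> t e \in X -> e \subset X :|: S) -> q <= #|S|.
Proof.
move=> dq d0 iB BK oX X0 tB dead; have [v vX] := set0Pn _ X0.
have sK : B :&: Kn (X :|: S) \subset Kn setT by apply: subset_trans (subsetIl _ _) BK.
have sub : [set e in B | t e \in X] \subset B :&: Kn (X :|: S).
  apply/subsetP => e; rewrite !inE => /andP[eB tX]; rewrite eB dead // andbT /=.
  by have := subsetP BK _ eB; rewrite inE => /andP[].
(* The rank formula for complete graphs needs d vertices; the other ends of the d edges leaving v
   provide them. *)
have dX : d <= #|X :|: S|.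
  rewrite -(oX v vX); apply: (@leq_trans #|nb (B :&: Kn (X :|: S)) v|); last first.
    by rewrite nbI_Kn ?inE ?vX // subset_leq_card ?subsetIr.
  rewrite -card_inc //; apply: subset_leq_card; apply/subsetP => e; rewrite inE => /andP[eB /eqP te].
  rewrite inE -te tB // andbT; apply: (subsetP sub); by rewrite inE eB te.
have := sum_outdeg t B X; rewrite (eq_bigr (fun=> d)) // sum_nat_const => eX.
have := subset_leq_card sub; rewrite -eX.
rewrite -(eqP (indepS rR (subsetIl B (Kn (X :|: S))) iB)).
have := rank_mono rR (subsetIr B (Kn (X :|: S))).
have := rigid_Kn_eq rP dX; have dD := double_D d; have leU : d * #|X :|: S| <= d * #|X| + d * #|S|.
  by rewrite -mulnDr leq_mul2l leq_card_setU orbT.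
have e2 : d * d.+1 = 2 * (d * q) by rewrite mulnCA; congr (_ * _); lia.
have -> : 'C(d.+1, 2) = d * q by lia.
move=> h1 h2 h3; rewrite -(leq_pmul2l d0); lia.
Qed.

End Flats.

Section Extension.
Variables (V : finType) (d : nat) (r : {set {set V}} -> nat).
Hypothesis rP : is_rigid d r.
Implicit Types (e : {set V}) (B E F J : {set {set V}}) (X Y Z W S : {set V}) (u v w : V).
Implicit Types (t : {set V} -> V).
Let rR : is_rank r := rigid_rank rP.

Definition other t e : V := odflt (t e) [pick w in e :\ t e].

Lemma otherP t e : e \in Kn setT -> t e \in e ->
  [/\ other t e \in e, other t e != t e & e = [set t e; other t e]].
Proof.
move=> eK te; have [u ut ee] := edge2P eK te.
have ue : u \in e by rewrite ee !inE eqxx orbT.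
rewrite /other; case: pickP => [w|/(_ u)] /=; last by rewrite in_setD1 ut ue.
case/setD1P=> wt we; rewrite we wt; split=> //.
by move: we; rewrite {1 2}ee !inE (negPf wt) /= => /eqP->.
Qed.

(** Contracting [Kn V0] removes the deficit: the rank of [Kn (Z :|: V0)] exceeds that of [Kn V0] by
    exactly d for each vertex of Z outside V0, which is Hakimi's condition. *)
Lemma contract_orient (V0 : {set V}) B (v0 : V) : d <= #|V0| -> B \subset Kn setT ->
  indep (contract r (Kn V0)) B -> contract r (Kn V0) B = d * #|~: V0| ->
  exists t, (forall e, e \in B -> t e \in e) /\
    forall v, outdeg t B v = if v \in V0 then 0 else d.
Proof.
move=> dV0 BK iB rB; pose x v := if v \in V0 then 0 else d.
have sumx Z : \sum_(v in Z) x v = d * #|Z :\: V0|.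
  rewrite (big_setID V0) /= big1 => [|v /setIP[_ vV0]]; last by rewrite /x vV0.
  rewrite add0n (eq_bigr (fun=> d)) => [|v /setDP[_ /negPf vV0]]; last by rewrite /x vV0.
  by rewrite sum_nat_const mulnC.
have cR := contract_rank (Kn V0) rR.
have hB Z : #|B :&: Kn Z| <= \sum_(v in Z) x v.
  rewrite -(eqP (indepS cR (subsetIl _ _) iB)) sumx.
  apply: leq_trans (rank_mono cR (subsetIr _ _)) _.
  have := contractK (Kn V0) rR (Kn Z).
  have h : r (Kn Z :|: Kn V0) <= r (Kn (Z :|: V0)).
    by apply: rank_mono => //; rewrite subUset !KnS ?subsetUl ?subsetUr.
  have := rigid_Kn_eq rP dV0; have := rigid_Kn_eq rP (leq_trans dV0 (subset_leq_card (subsetUr Z V0))).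
  have -> : #|Z :|: V0| = #|Z :\: V0| + #|V0|.
    rewrite -cards_disjU; first by congr #|pred_of_set _|; apply/setP => v; rewrite !inE; case: (v \in V0); rewrite ?orbT.
    by rewrite -setI_eq0 setIDAC setDIl setDv setI0.
  by rewrite mulnDr; lia.
have [t [tB ot]] := hakimi v0 BK hB; exists t; split=> //; apply: (hakimi_eq ot).
rewrite -(eqP iB) rB (eq_bigl (mem [set: V])) => [|v]; last by rewrite /= in_setT.
by rewrite sumx setTD.
Qed.

Lemma orient_extend q k E (V0 : {set V}) t0 : d = 2 * q - 1 -> 1 < q -> 4 * 'C(d.+1, 2) <= k ->
  E \subset Kn setT -> sconn k E setT -> d <= #|V0| ->
  (forall e, e \in E :&: Kn V0 -> t0 e \in e) -> qcut q (arc (E :&: Kn V0) t0) V0 ->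
  exists t, (forall e, e \in E -> t e \in e) /\ qcut q (arc E t) setT.
Proof.
move=> dq q1 kD EK conn dV0 t0E [qV0 cut0].
have d1 : 1 < d by lia.
have d0 : 0 < d by lia.
have /card_gt0P[v0 _] : 0 < #|V0| by lia.
pose A := E :\: Kn V0; have AK : A \subset Kn setT by apply: subset_trans EK; apply: subsetDl.
have cR := contract_rank (Kn V0) rR.
have cV0 : #|[set: V]| = #|V0| + #|~: V0| by rewrite cardsT cardsC.
have rA_le F : F \subset Kn setT -> contract r (Kn V0) F <= d * #|~: V0|.
  move=> FK; have := contractK (Kn V0) rR F.
  have h : r (F :|: Kn V0) <= r (Kn setT).
    by apply: rank_mono => //; rewrite subUset FK KnS // subsetT.
  have := rigid_Kn_eq rP dV0; have := rigid_Kn_eq rP (leq_trans dV0 (subset_leq_card (subsetT V0))).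
  by rewrite cV0 mulnDr; lia.
(* Packing condition in the contraction. [connected_rank_ge] is applied to the closure of F and
   [Kn V0]; its deficit 2D cancels against twice the rank d|V0| - D of [Kn V0]. *)
have pack F : F \subset A -> 2 * (d * #|~: V0|) <= 2 * contract r (Kn V0) F + #|A :\: F|.
  move=> FA; have FK := subset_trans FA AK.
  have FV0K : F :|: Kn V0 \subset Kn setT by rewrite subUset FK KnS // subsetT.
  have [F' [sF fl rF]] := flat_closure rP FV0K.
  have [FK' _] := fl.
  have := connected_rank_ge rP d0 d1 kD fl (subset_trans (subsetDl E F') EK) (W := setT).
  have conn' : sconn k (F' :|: E :\: F') setT.
    apply: sconnS conn; apply/subsetP => e eE; rewrite !inE eE andbT.
    exact: orbN.
  move/(_ conn'); rewrite (setIidPl FK') rF -(contractK _ rR).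
  have : #|(E :\: F') :&: Kn setT| <= #|A :\: F|.
    apply: subset_leq_card; apply/subsetP => e /setIP[/setDP[eE eF'] _].
    rewrite !in_setD eE andbT; apply/andP; split.
      by apply: contra eF' => eF; apply: (subsetP sF); rewrite inE eF.
    by apply: contra eF' => eF; apply: (subsetP sF); rewrite in_setU eF orbT.
  have := rigid_Kn_eq rP dV0; rewrite cV0 mulnDr; lia.
have cA : contract r (Kn V0) A = d * #|~: V0|.
  apply/eqP; rewrite eqn_leq rA_le //; have := pack A (subxx _).
  by rewrite setDv cards0; lia.
have [|B [iB rB sB dB]] := matroid_packing (T := 2) cR (A := A).
  by move=> F FA; rewrite cA pack.
pose B1 := B ord0; pose B2 := B ord_max.
have BK i : B i \subset Kn setT by apply: subset_trans (sB i) AK.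
have B12 : [disjoint B1 & B2] by apply: dB.
have [t1 [t1B ot1]] := contract_orient v0 dV0 (BK ord0) (iB ord0) (etrans (rB ord0) cA).
have [t2 [t2B ot2]] := contract_orient v0 dV0 (BK ord_max) (iB ord_max) (etrans (rB ord_max) cA).
(* The second base is reversed, so that it prescribes in-degrees; edges in neither base get an
   arbitrary tail. *)
pose t e := if e \in Kn V0 then t0 e else if e \in B1 then t1 e else
  if e \in B2 then other t2 e else odflt v0 [pick w in e].
have tE e : e \in E -> t e \in e.
  move=> eE; rewrite /t; case: ifP => [eV0|_]; first by apply: t0E; rewrite in_setI eE.
  case: ifP => [/t1B//|_]; case: ifP => [eB2|_].
    by have [] := otherP (subsetP (BK _) _ eB2) (t2B _ eB2).
  case: pickP => [//|h]; have := subsetP EK _ eE; rewrite inE => /andP[/eqP c2 _].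
  by move: c2; rewrite (eq_card0 h).
have nV0 i e : e \in B i -> (e \in E) && (e \notin Kn V0).
  by move/(subsetP (sB i)); rewrite in_setD andbC.
have tB1 e : e \in B1 -> t e = t1 e.
  by move=> eB; rewrite /t eB; case/andP: (nV0 _ _ eB) => _ /negPf->.
have tB2 e : e \in B2 -> t e = other t2 e.
  by move=> eB; rewrite /t eB; case/andP: (nV0 _ _ eB) => _ /negPf->; rewrite (disjointFl B12).
exists t; split=> //; split.
  by apply: leq_trans qV0 (subset_leq_card (subsetT _)).
move=> X Y _ _ X0 Y0 dXY Sq; apply: NNPP => noarc.
have noarc' x y : x \in X -> y \in Y -> ~~ arc E t x y.
  by move=> xX yY; apply/negP => a; apply: noarc; exists x, y.
(* If X avoids V0, the out-degrees in B1 force q vertices into S; if Y avoids V0, the in-degrees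
   from B2 do. Otherwise the given orientation on V0 supplies an arc from X to Y. *)
set S := setT :\: (X :|: Y) in Sq.
have [XV0|XV0] := eqVneq (X :&: V0) set0.
  have : q <= #|S|; last by rewrite leqNgt Sq.
  apply: (@dead_count _ _ _ rP q B1 t1 X S dq d0) => //.
  - apply: (@contract_indep _ _ (Kn V0) rR); exact: iB.
  - exact: BK.
  - by move=> v vX; rewrite ot1; case: ifP => // vV0; have /setP/(_ v) := XV0; rewrite !inE vX vV0.
  move=> e eB tX; have [oe ot ee] := otherP (subsetP (BK _) _ eB) (t1B _ eB).
  rewrite ee subUset !sub1set inE tX /= !in_setU; case: (boolP (_ \in X)) => //= oX.
  rewrite in_setD in_setU (negPf oX) in_setT andbT /=; apply/negP => oY.
  case/negP: (noarc' _ _ tX oY).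
  by rewrite /arc eq_sym ot -ee tB1 // eqxx; case/andP: (nV0 _ _ eB) => ->.
have [YV0|YV0] := eqVneq (Y :&: V0) set0.
  have : q <= #|S|; last by rewrite leqNgt Sq.
  apply: (@dead_count _ _ _ rP q B2 t2 Y S dq d0) => //.
  - apply: (@contract_indep _ _ (Kn V0) rR); exact: iB.
  - exact: BK.
  - by move=> v vY; rewrite ot2; case: ifP => // vV0; have /setP/(_ v) := YV0; rewrite !inE vY vV0.
  move=> e eB tY; have [oe ot ee] := otherP (subsetP (BK _) _ eB) (t2B _ eB).
  rewrite ee subUset !sub1set inE tY /= !in_setU; case: (boolP (_ \in Y)) => //= oY.
  rewrite in_setD in_setU (negPf oY) in_setT andbT orbF; apply/negP => oX.
  case/negP: (noarc' _ _ oX tY).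
  by rewrite /arc ot setUC -ee tB2 // eqxx; case/andP: (nV0 _ _ eB) => ->.
have [||||||x [y [/setIP[xX xV0] /setIP[yY yV0] a]]] := cut0 (X :&: V0) (Y :&: V0) => //.
- exact: subsetIr.
- exact: subsetIr.
- by apply: disjointWl (subsetIl _ _) _; apply: disjointWr (subsetIl _ _) _.
- apply: leq_ltn_trans Sq; apply: subset_leq_card; apply/subsetP => z; rewrite !inE.
  by case: (z \in V0); rewrite ?andbF ?andbT.
case/negP: (noarc' x y xX yY); move: a; rewrite /arc in_setI => /and3P[-> /andP[-> exy] txy].
by rewrite /t exy.
Qed.

End Extension.

(** * Expanding subgraphs *)

Section Expander.
Variable V : finType.
Implicit Types (e : {set V}) (B E F J : {set {set V}}) (X Y Z W S : {set V}) (u v w : V).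
Implicit Types (t : {set V} -> V).

Definition ind E Z := #|E :&: Kn Z|.

Lemma sum_deg E X : E \subset Kn setT ->
  \sum_(v in X) #|nb E v| = \sum_(e in E) #|e :&: X|.
Proof.
move=> EK; transitivity (\sum_(v in X) \sum_(e in E) (v \in e : nat)).
  apply: eq_bigr => v vX; rewrite -card_inc // -sum1_card big_mkcond /=.
  rewrite [RHS]big_mkcond /=; apply: eq_bigr => e _; rewrite inE.
  by case: (e \in _); case: (v \in e).
rewrite exchange_big /=; apply: eq_bigr => e _.
rewrite -sum1_card [RHS]big_mkcond [LHS]big_mkcond /=; apply: eq_bigr => v _.
by rewrite inE andbC; case: (v \in X); case: (v \in e).
Qed.

Lemma sum_deg_ge E W X : E \subset Kn W -> X \subset W ->
  #|E| + ind E X <= \sum_(v in X) #|nb E v| + ind E (W :\: X).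
Proof.
move=> EW XW; rewrite sum_deg; last by apply: subset_trans EW (KnS (subsetT _)).
have indE Z : ind E Z = \sum_(e in E) (e \subset Z : nat).
  rewrite /ind -sum1_card [LHS]big_mkcond [RHS]big_mkcond /=; apply: eq_bigr => e _.
  rewrite !inE; case: (boolP (e \in E)) => //= /(subsetP EW); rewrite inE => /andP[-> _] /=.
  by case: (e \subset Z).
rewrite !indE -sum1_card -!big_split /=; apply: leq_sum => e eE.
have := subsetP EW _ eE; rewrite inE => /andP[/eqP c2 eW].
have [eX|eX] := boolP (e \subset X); first by rewrite (setIidPl eX) c2.
have [ceX|ceX] := posnP #|e :&: X|; last by lia.
suff -> : e \subset W :\: X by lia.
apply/subsetP => v ve; rewrite !inE (subsetP eW) // andbT; apply/negP => vX.
by have /eqP := ceX; rewrite cards_eq0 => /eqP/setP/(_ v); rewrite !inE ve vX.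
Qed.

Lemma tails_in_le E t X S : E \subset Kn setT -> (forall e, e \in E -> t e \in e) ->
  (forall e, e \in E -> t e \in X -> e \subset X :|: S) ->
  #|[set e in E | t e \in X]| <= ind E X + #|X| * #|S|.
Proof.
move=> EK tE dead; rewrite -cardsX.
have h : [set e in E | t e \in X] \subset
    (E :&: Kn X) :|: [set [set p.1; p.2] | p in setX X S].
  apply/subsetP => e; rewrite inE => /andP[eE tX]; rewrite in_setU in_setI eE /=.
  have [_ ot ee] := otherP (subsetP EK _ eE) (tE _ eE).
  have := dead e eE tX; rewrite ee subUset !sub1set in_Kn2 eq_sym ot tX => /andP[_ /setUP[->//|oS]].
  by apply/orP; right; apply/imsetP; exists (t e, other t e); rewrite // inE /= tX oS.
apply: leq_trans (subset_leq_card h) _; apply: leq_trans (leq_card_setU _ _) _.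
by rewrite leq_add2l leq_imset_card.
Qed.

(** The edges between X and its complement in W are those of W minus those inside the two parts, so
    this says that their number is at least c times the size of the smaller part. *)
Definition expander c E W := forall X, X \subset W -> X != set0 -> W :\: X != set0 ->
  ind E X + ind E (W :\: X) + c * minn #|X| #|W :\: X| <= ind E W.

Lemma indI E W X : X \subset W -> ind (E :&: Kn W) X = ind E X.
Proof. by move=> XW; rewrite /ind -setIA KnI (setIidPr XW). Qed.

(** A balanced orientation gives X at least e(X) + (3q-1)|X|/2 tails, e(X) being the number of edges
    inside X. If no arc leaves X except into S, there are at most e(X) + |X||S| of them. So 3q <=
    2|S| + 1, which for q >= 1 yields |S| >= q. *)
Lemma expander_half q E W t X S : expander (3 * q) E W -> 0 < q -> E \subset Kn setT ->
  (forall e, e \in E :&: Kn W -> t e \in e) ->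
  (forall v, #|nb (E :&: Kn W) v| <= 2 * outdeg t (E :&: Kn W) v + 1) ->
  X \subset W -> X != set0 -> 2 * #|X| <= #|W| ->
  (forall e, e \in E :&: Kn W -> t e \in X -> e \subset X :|: S) -> q <= #|S|.
Proof.
move=> ex q0 EK tE out XW X0 X2 dead.
have X_gt0 : 0 < #|X| by rewrite card_gt0.
have cWX : #|W :\: X| = #|W| - #|X| by rewrite cardsD (setIidPr XW).
have WX0 : W :\: X != set0 by rewrite -card_gt0; lia.
have EWK : E :&: Kn W \subset Kn setT by apply: subset_trans EK; apply: subsetIl.
have := ex X XW X0 WX0; rewrite (minn_idPl _); last by lia.
have := sum_deg_ge (subsetIr E (Kn W)) XW; rewrite !indI ?subsetDl // -/(ind E W).
have := tails_in_le EWK tE dead; rewrite -sum_outdeg indI //.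
have : \sum_(v in X) #|nb (E :&: Kn W) v| <=
    \sum_(v in X) (2 * outdeg t (E :&: Kn W) v + 1).
  by apply: leq_sum => v _; apply: out.
rewrite big_split /= -big_distrr /= sum1_card.
move: (\sum_(v in X) outdeg _ _ _) (\sum_(v in X) _) => so sd.
move: (ind E W) (ind E X) (ind E (W :\: X)) => a b c h1 h2 h3 h4.
have : 3 * q * #|X| <= (2 * #|S| + 1) * #|X| by nia.
by rewrite leq_pmul2r //; lia.
Qed.

Lemma outdeg_other E t v : E \subset Kn setT -> (forall e, e \in E -> t e \in e) ->
  outdeg (other t) E v + outdeg t E v = #|nb E v|.
Proof.
move=> EK tE; rewrite -card_inc // /outdeg -cards_disjU.
  congr #|pred_of_set _|; apply/setP => e; rewrite !inE.
  case: (boolP (e \in E)) => //= eE; have [_ ot ee] := otherP (subsetP EK _ eE) (tE _ eE).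
  have -> : (v \in e) = (v == t e) || (v == other t e) by rewrite {1}ee !inE.
  by rewrite orbC ![v == _]eq_sym.
rewrite -setI_eq0; apply/eqP/setP => e; rewrite !inE.
case: (boolP (e \in E)) => //= eE; have [_ ot _] := otherP (subsetP EK _ eE) (tE _ eE).
by apply/negP => /andP[/eqP<- /eqP h]; rewrite h eqxx in ot.
Qed.

Lemma expander_qcut q E W : expander (3 * q) E W -> 0 < q -> E \subset Kn setT -> 1 < #|W| ->
  2 * q <= #|W| /\ exists t, (forall e, e \in E :&: Kn W -> t e \in e) /\
    qcut q (arc (E :&: Kn W) t) W.
Proof.
move=> ex q0 EK W1; set EW := E :&: Kn W.
have EWK : EW \subset Kn setT by apply: subset_trans EK; apply: subsetIl.
have /card_gt0P[v vW] : 0 < #|W| by lia.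
have W3q : 3 * q <= #|W|.
  have vsW : [set v] \subset W by rewrite sub1set.
  have cWv : #|W :\ v| = #|W|.-1 by rewrite (cardsD1 v W) vW.
  have := ex _ vsW; rewrite -!card_gt0 cards1 cWv => /(_ isT) h.
  have {h} := h ltac:(lia); rewrite (minn_idPl _); last by lia.
  have := sum_deg_ge (subsetIr E (Kn W)) vsW; rewrite -/(ind E W) !indI ?subsetDl // big_set1.
  have : #|nb EW v| <= #|W|.
    by rewrite nbI_Kn // subset_leq_card ?subsetIr.
  rewrite -/EW; lia.
split; first lia.
have [t [tE out]] := balanced v EWK; exists t; split=> //; split; first lia.
move=> X Y XW YW X0 Y0 dXY Sq; apply: NNPP => noarc.
have noarc' x y : x \in X -> y \in Y -> ~~ arc EW t x y.
  by move=> xX yY; apply/negP => a; apply: noarc; exists x, y.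
set S := W :\: (X :|: Y) in Sq.
have inW e u : e \in EW -> u \in e -> u \in W.
  by rewrite !inE => /and3P[_ _ /subsetP h] /h.
(* One of X and Y has at most half of W. For Y the reversed orientation [other t], which is balanced
   as well, takes the role of [t]. *)
have [X2|X2] := leqP (2 * #|X|) #|W|.
  have : q <= #|S|; last by rewrite leqNgt Sq.
  apply: (expander_half ex q0 EK tE _ XW X0 X2) => [u|e eE tX]; first by case: (out u).
  have [oe ot ee] := otherP (subsetP EWK _ eE) (tE _ eE).
  rewrite ee subUset !sub1set inE tX /= !in_setU; case: (boolP (_ \in X)) => //= oX.
  rewrite in_setD in_setU (negPf oX) (inW _ _ eE oe) andbT /=; apply/negP => oY.
  case/negP: (noarc' _ _ tX oY).
  by rewrite /arc eq_sym ot -ee eE eqxx.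
have Y2 : 2 * #|Y| <= #|W|.
  have : #|X :|: Y| <= #|W| by apply: subset_leq_card; rewrite subUset XW.
  by rewrite cards_disjU //; lia.
have : q <= #|S|; last by rewrite leqNgt Sq.
have oE e : e \in EW -> other t e \in e.
  by move=> eE; have [] := otherP (subsetP EWK _ eE) (tE _ eE).
apply: (expander_half ex q0 EK oE _ YW Y0 Y2) => [u|e eE oY].
  by have := outdeg_other u EWK tE; case: (out u); rewrite -/EW; lia.
have [oe ot ee] := otherP (subsetP EWK _ eE) (tE _ eE).
rewrite ee subUset !sub1set andbC !in_setU oY /=; case: (boolP (_ \in Y)) => //= tY.
rewrite in_setD in_setU (negPf tY) (inW _ _ eE (tE _ eE)) andbT orbF; apply/negP => tX.
case/negP: (noarc' _ _ tX oY).
by rewrite /arc eq_sym ot -ee eE eqxx.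
Qed.

(** W is split along a poorly expanding cut. The edges across number at most c times the smaller
    part, and the logarithm grows by at least one on that part: log a + 1 = log 2a <= log (a+b) for
    a <= b. *)
Lemma no_expander_sparse c E W : E \subset Kn setT ->
  (forall W', W' \subset W -> 1 < #|W'| -> ~ expander c E W') ->
  ind E W <= c * #|W| * trunc_log 2 #|W|.
Proof.
move=> EK; move: {2}#|W| (leqnn #|W|) => n; elim: n W => [|n IHn] W cW noex.
  move: cW; rewrite leqn0 cards_eq0 => /eqP->; rewrite /ind.
  rewrite (_ : _ :&: _ = set0) ?cards0 //; apply/setP => e; rewrite !inE subset0.
  by case: (e =P set0) => [->|]; rewrite ?cards0 ?andbF.
have [W1|W1] := leqP #|W| 1.
  rewrite /ind (_ : _ :&: _ = set0) ?cards0 //; apply/setP => e; rewrite !inE.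
  apply/negP => /and3P[_ /eqP c2 /subset_leq_card]; lia.
have [X [XW X0 WX0 lt]] : exists X, [/\ X \subset W, X != set0, W :\: X != set0 &
    ind E W < ind E X + ind E (W :\: X) + c * minn #|X| #|W :\: X|].
  apply: NNPP => h; apply: (noex W (subxx _) W1) => X XW X0 WX0; rewrite leqNgt.
  by apply/negP => lt; apply: h; exists X.
have cWX : #|W| = #|X| + #|W :\: X| by rewrite -(cardsID X W) (setIidPr XW).
have cX : 0 < #|X| by rewrite card_gt0.
have cY : 0 < #|W :\: X| by rewrite card_gt0.
have IX : ind E X <= c * #|X| * trunc_log 2 #|X|.
  by apply: IHn => [|W' W'X]; [lia|apply: noex; apply: subset_trans W'X XW].
have IY : ind E (W :\: X) <= c * #|W :\: X| * trunc_log 2 #|W :\: X|.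
  by apply: IHn => [|W' W'X]; [lia|apply: noex; apply: subset_trans W'X (subsetDl _ _)].
have key a b : 0 < a -> a <= b -> a * trunc_log 2 a + b * trunc_log 2 b + a <=
    (a + b) * trunc_log 2 (a + b).
  move=> a0 ab; have l1 : (trunc_log 2 a).+1 <= trunc_log 2 (a + b).
    by rewrite -trunc_logMp //; apply: leq_trunc_log; lia.
  have l2 : trunc_log 2 b <= trunc_log 2 (a + b) by apply: leq_trunc_log; lia.
  nia.
apply: leq_trans (ltnW lt) _.
apply: (@leq_trans (c * (#|X| * trunc_log 2 #|X| + #|W :\: X| * trunc_log 2 #|W :\: X| +
    minn #|X| #|W :\: X|))); first by rewrite !mulnDr !mulnA; lia.
rewrite -mulnA leq_mul2l cWX; apply/orP; right.
have [ab|ba] := leqP #|X| #|W :\: X|; first exact: key.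
by have := key _ _ cY (ltnW ba); rewrite [_ + #|X|]addnC; lia.
Qed.

End Expander.

(** * Locally sparse graphs *)

Section Core.
Variables (V : finType) (E : {set {set V}}).
Hypothesis EK : E \subset Kn setT.
Implicit Types (e : {set V}) (A R X Y Z W S : {set V}) (u v w : V).

Definition deg A v := #|nb E v :&: A|.

Lemma ind_U1 R v : v \notin R -> ind E (v |: R) = ind E R + deg R v.
Proof.
move=> vR; have sK : E :&: Kn (v |: R) \subset Kn setT by apply: subset_trans EK; apply: subsetIl.
rewrite /ind -(cardsID (inc (E :&: Kn (v |: R)) v) (E :&: Kn (v |: R))) addnC.
have sI : inc (E :&: Kn (v |: R)) v \subset E :&: Kn (v |: R).
  by apply/subsetP => e; rewrite [e \in inc _ _]inE => /andP[].
rewrite Kn_del (setIidPr sI).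
congr (_ + _); first by rewrite setU1K.
rewrite card_inc // nbI_Kn ?inE ?eqxx // /deg; apply: eq_card => u.
rewrite [LHS]in_setI [RHS]in_setI in_setU1; case: eqP => [->|] //.
by rewrite (negPf (nbxx E v)).
Qed.

Lemma degU A v w : deg A v <= deg (A :\ w) v + (w \in nb E v).
Proof.
rewrite /deg (cardsD1 w) addnC setIDA leq_add2l in_setI.
by case: (w \in nb E v); case: (w \in A).
Qed.

Lemma deg_le A W v : (forall u, u \in A -> u \in nb E v -> u \in W) -> deg A v <= deg W v.
Proof.
move=> h; apply: subset_leq_card; apply/subsetP => u; rewrite !in_setI => /andP[un uA].
by rewrite un h.
Qed.

Variables (q N : nat).
Hypothesis q_gt0 : 0 < q.
Hypothesis N_big : 18 * q ^ 4 < N.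
Hypothesis mindeg : forall v, 8 * q ^ 2 <= #|nb E v|.
Hypothesis sparse : forall W, #|W| <= N -> 20 * ind E W <= q ^ 2 * #|W|.

(* Deficiency of [U] in the graph induced on [A].  The set found below is a
   smallest set of at least [N] vertices with small deficiency, minus a maximal
   small set [R] of vertices of low degree: both sides of a small separation have
   smaller deficiency, so one of them has fewer than [N] vertices. *)
Let def A (U : {set V}) := \sum_(v in U) (8 * q ^ 2 - deg A v).

Lemma sparse_core (v0 : V) : exists A, [/\ A != set0,
  forall v, v \in A -> 9 * q ^ 2 <= 2 * deg A v &
  forall A1 A2, A1 \subset A -> A2 \subset A -> A1 != set0 -> A2 != set0 ->
    [disjoint A1 & A2] -> (forall x y, x \in A1 -> y \in A2 -> [set x; y] \notin E) ->
    #|A :\: (A1 :|: A2)| <= 2 * q ^ 4 -> #|A :\: A1| < N \/ #|A :\: A2| < N].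
Proof.
have q2 : 0 < q ^ 2 by rewrite expn_gt0 q_gt0.
have q6 : q ^ 2 * q ^ 4 = q ^ 6 by rewrite -expnD.
(* The constant 60 reproduces itself: removing R adds at most 18q^6, the side of smaller deficiency
   keeps at most half of 78q^6, and a separator of 2q^4 vertices adds at most 16q^6, in total
   55q^6. *)
pose ok A := (N <= #|A|) && (def A A <= 60 * q ^ 6).
have okT : ok setT.
  apply/andP; split; last first.
    rewrite /def big1 // => v _; apply/eqP; rewrite subn_eq0 /deg setIT; exact: mindeg.
  rewrite leqNgt; apply/negP => /ltnW /[dup] lt /sparse.
  have := handshake setT EK; rewrite -/(ind E setT) => hs.
  have : 8 * q ^ 2 * #|[set: V]| <= 2 * ind E setT.
    rewrite -hs mulnC -sum_nat_const; apply: leq_sum => v _; rewrite setIT; exact: mindeg.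
  have : 0 < #|[set: V]| by apply/card_gt0P; exists v0; rewrite inE.
  nia.
case: (@arg_minnP _ setT ok (fun A => #|A|) okT) => A /andP[NA defA] minA.
(* The last condition bounds R: its deficiency in A is at most 60q^6 and its edges number at most
   q^2|R|/20, so 7q^2|R| <= 120q^6 + q^2|R|/10, whence |R| <= 18q^4 < N. Thus the bound by N never
   stops R from growing. *)
pose okR R := [&& R \subset A, #|R| <= N, def (A :\: R) (A :\: R) <= 60 * q ^ 6 + q ^ 2 * #|R| &
  7 * q ^ 2 * #|R| <= 2 * (def A R + ind E R)].
have okR0 : okR set0.
  by rewrite /okR sub0set cards0 setD0 leq0n muln0 addn0 defA muln0.
case: (@arg_maxnP _ set0 okR (fun R => #|R|) okR0) => R /and4P[RA RN defR wR] maxR.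
have cR : #|R| <= 18 * q ^ 4.
  have dR : def A R <= 60 * q ^ 6.
    apply: leq_trans defA; rewrite [X in _ <= X](big_setID R) /= (setIidPr RA).
    exact: leq_addr.
  rewrite -(leq_pmul2l q2); have := sparse RN; nia.
set A' := A :\: R.
have defA' : def A' A' <= 78 * q ^ 6.
  by apply: leq_trans defR _; rewrite -q6; nia.
have mind v : v \in A' -> 9 * q ^ 2 <= 2 * deg A' v.
  move=> vA'; rewrite leqNgt; apply/negP => lt.
  have [vA vR] : v \in A /\ v \notin R by move: vA'; rewrite inE => /andP[].
  have degA_split : deg A v = deg A' v + deg R v.
    rewrite /deg /A' -cards_disjU; last first.
      rewrite -setI_eq0; apply/eqP/setP => u; rewrite !in_setI in_setD in_set0.
      by case: (u \in R); rewrite ?andbF.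
    congr #|pred_of_set _|; rewrite -setIUr; congr (_ :&: _); apply/setP => u; rewrite !inE.
    by case: (boolP (u \in R)) => [/(subsetP RA)->|]; rewrite ?orbT ?orbF.
  have := maxR (v |: R); rewrite cardsU1 vR.
  suff -> : okR (v |: R) by move/(_ isT); lia.
  apply/and4P; split.
  - by rewrite subUset sub1set vA RA.
  - by rewrite cardsU1 vR; lia.
  - have -> : A :\: (v |: R) = A' :\ v by rewrite /A' setDDl setUC.
    (* Deleting v removes its own deficiency, at least 8q^2 - deg v, and creates at most deg v at
       its neighbours. For 2 deg v < 9q^2 the net increase is below q^2. *)
    have h : def (A' :\ v) (A' :\ v) <= \sum_(u in A' :\ v) (8 * q ^ 2 - deg A' u) + deg A' v.
      have -> : deg A' v = \sum_(u in A' :\ v) (u \in nb E v : nat).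
        rewrite /deg -sum1_card [LHS]big_mkcond [RHS]big_mkcond /=; apply: eq_bigr => u _.
        rewrite in_setI in_setD1; have [->|uv] := eqVneq u v; first by rewrite (negPf (nbxx _ _)).
        by rewrite andbC; case: (u \in A'); case: (u \in nb E v).
      rewrite -big_split /=; apply: leq_sum => u _.
      by have := degU A' u v; rewrite nb_sym; lia.
    rewrite cardsU1 vR; move: defR h; rewrite {1}/def (big_setD1 v vA') /=.
    rewrite -/A'; move: (\sum_(_ in A' :\ v) _) (def _ _) => x y; nia.
  rewrite ind_U1 // /def big_setU1 //= -/(def A R) cardsU1 vR; nia.
exists A'; split=> //.
  have : 0 < #|A'| by rewrite /A' cardsD (setIidPr RA); lia.
  by rewrite card_gt0.
move=> A1 A2 s1 s2 n1 n2 dA noE cS; set S := A' :\: (A1 :|: A2) in cS.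
have side (B1 B2 : {set V}) : B1 \subset A' -> B2 \subset A' -> B2 != set0 -> [disjoint B1 & B2] ->
    (forall x y, x \in B1 -> y \in B2 -> [set x; y] \notin E) ->
    #|A' :\: (B1 :|: B2)| <= 2 * q ^ 4 -> 2 * def A' B1 <= 78 * q ^ 6 -> #|A' :\: B2| < N.
  move=> t1 t2 m2 dB noB cB defB; rewrite ltnNge; apply/negP => le.
  set U := A' :\: B2 in le.
  have B1U : B1 \subset U.
    by apply/subsetP => x xB; rewrite inE (subsetP t1 _ xB) (disjointFr dB xB).
  have UB : U :\: B1 = A' :\: (B1 :|: B2) by rewrite /U setDDl setUC.
  (* Vertices of B1 have no neighbour in B2, so their deficiency is unchanged; each separator vertex
     contributes at most 8q^2. *)
  have defU : def U U <= 60 * q ^ 6.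
    rewrite /def (big_setID B1) /= (setIidPr B1U) UB.
    have e1 : \sum_(v in B1) (8 * q ^ 2 - deg U v) <= def A' B1.
      apply: leq_sum => v vB; apply: leq_sub2l; apply: deg_le => u uA' un.
      rewrite inE uA' andbT; apply/negP => uB; have := noB v u vB uB.
      by move: un; rewrite nbP => /andP[_ ->].
    have e2 : \sum_(v in A' :\: (B1 :|: B2)) (8 * q ^ 2 - deg U v) <= 2 * q ^ 4 * (8 * q ^ 2).
      apply: leq_trans (leq_sum _ (fun v _ => leq_subr _ _)) _.
      by rewrite sum_nat_const leq_mul2r cB orbT.
    have e3 : 2 * q ^ 4 * (8 * q ^ 2) = 16 * q ^ 6 by rewrite mulnACA [q ^ 4 * _]mulnC q6.
    apply: leq_trans (leq_add e1 e2) _; rewrite e3; move: defB.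
    by move: (def A' B1) (q ^ 6) => x y; clear; lia.
  have := minA U; rewrite /ok le defU => /(_ isT).
  have /card_gt0P[y yB] : 0 < #|B2| by rewrite card_gt0.
  have : #|U| < #|A'|.
    apply: proper_card; apply/properP; split; first exact: subsetDl.
    by exists y; rewrite ?(subsetP t2) // inE yB.
  move=> UA' AU; have := leq_trans (leq_ltn_trans AU UA') (subset_leq_card (subsetDl A R)).
  by rewrite ltnn.
have : def A' A1 + def A' A2 <= 78 * q ^ 6.
  apply: leq_trans defA'; rewrite /def -big_disjU //=.
  rewrite [X in _ <= X](big_setID (A1 :|: A2)) /= (setIidPr _) ?leq_addr //.
  by rewrite subUset s1.
move=> le; have [h|h] := leqP (def A' A1) (def A' A2).
  right; apply: (side A1 A2) => //; move: le h; clear.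
  by move: (def A' A1) (def A' A2) (q ^ 6) => x y z; lia.
left; apply: (side A2 A1) => //; last first.
- by move: le h; clear; move: (def A' A1) (def A' A2) (q ^ 6) => x y z; lia.
- by rewrite setUC.
- by move=> x y xA yA; rewrite setUC; apply: noE.
- by rewrite disjoint_sym.
Qed.

End Core.

(** * Numerical inequalities for the sparse case *)

Section Numbers.
Variables (q T : nat).
Hypothesis q_big : 100 <= q.
Hypothesis T_le : T <= q + 2.

(** The left side is 2TD. The lower bounds below for b(a+1), needed to pay for a clique
    neighbourhood, all pass through 5q^3. *)
Let Tq : 2 * T * (q * (2 * q - 1)) <= 5 * (q * q * q).
Proof.
have h : 2 * T * (q * (2 * q - 1)) <= (2 * (q + 2)) * (q * (2 * q)).
  by apply: leq_mul; [rewrite leq_mul2l|rewrite leq_mul2l; apply/orP; right; lia].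
apply: leq_trans h _.
have : 100 * (q * q) <= q * (q * q) by rewrite leq_mul2r q_big orbT.
clear; nia.
Qed.

Lemma num_small_clique a b x : 17 * q ^ 2 <= 4 * x -> x <= a.+1 -> 2 * q <= b ->
  2 * T * (q * (2 * q - 1)) <= b * a.+1.
Proof.
move=> hx xa hb; apply: leq_trans Tq _.
have h : 17 * (q * q) <= 4 * a.+1 by rewrite mulnn; lia.
have : 2 * q * (17 * (q * q)) <= b * (4 * a.+1) by apply: leq_mul.
move: (b * (4 * a.+1)) (mulnCA b 4 a.+1) => y ->; clear; lia.
Qed.

Lemma num_large_clique a b x : q ^ 4 <= x -> x <= a.+1 -> 0 < b ->
  2 * T * (q * (2 * q - 1)) <= b * a.+1.
Proof.
move=> hx xa hb; apply: leq_trans Tq _.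
apply: (@leq_trans (1 * a.+1)); last by rewrite leq_mul2r hb orbT.
rewrite mul1n; apply: leq_trans xa; apply: leq_trans hx.
rewrite (_ : q ^ 4 = q * (q * q * q)); first by rewrite leq_mul2r; move: q_big; clear; lia.
by rewrite !expnS expn0 muln1 !mulnA.
Qed.

Lemma num_mid a b : 2 * q - 1 <= a -> 2 * q <= b -> 9 * q ^ 2 <= 2 * (a + b) + q ->
  2 * T * (q * (2 * q - 1)) <= b * a.+1.
Proof.
move=> ha hb hab; apply: leq_trans Tq _; rewrite -mulnn in hab.
have : 100 * (q * q) <= q * (q * q) by rewrite leq_mul2r q_big orbT.
have [a' ea] : exists a', a.+1 = 2 * q + a' by exists (a.+1 - 2 * q); move: ha; clear; lia.
have [b' eb] : exists b', b = 2 * q + b' by exists (b - 2 * q); move: hb; clear; lia.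
have : 9 * (q * q) <= 2 * (2 * q + a' + (2 * q + b')) + q by move: hab ea eb; clear; lia.
rewrite ea eb; move=> h.
have : q * (9 * (q * q)) <= q * (2 * (2 * q + a' + (2 * q + b')) + q) by rewrite leq_mul2l h orbT.
clear; nia.
Qed.

Lemma num_low a b : a < 2 * q - 1 -> 9 * q ^ 2 <= 2 * (a + b) + q ->
  2 * T * (2 * q - 1) <= b.
Proof.
move=> ha hab; have h : 2 * T * (2 * q - 1) <= 2 * (q + 2) * (2 * q).
  by apply: leq_mul; [rewrite leq_mul2l|lia].
apply: leq_trans h _; rewrite -mulnn in hab.
have : 100 * q <= q * q by rewrite leq_mul2r q_big orbT.
move: hab ha; clear; nia.
Qed.

Lemma num_b a b : a < 2 * (q * (2 * q - 1)) -> 9 * q ^ 2 <= 2 * (a + b) + q -> 2 * q <= b.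
Proof.
have h : q * (2 * q - 1) = 2 * (q * q) - q by rewrite mulnBr muln1 mulnCA.
by rewrite h -mulnn; have : 100 * q <= q * q; [rewrite leq_mul2r q_big orbT|clear; lia].
Qed.

Lemma num_D a x : 17 * q ^ 2 <= 4 * x -> x <= a.+1 -> 2 * (q * (2 * q - 1)) <= a.
Proof.
have -> : q * (2 * q - 1) = 2 * (q * q) - q by rewrite mulnBr muln1 mulnCA.
by rewrite -mulnn; have : 100 * q <= q * q; [rewrite leq_mul2r q_big orbT|move: q_big; clear; lia].
Qed.

Lemma num_d : 2 * q - 1 <= 2 * (q * (2 * q - 1)).
Proof. by move: q_big; clear; nia. Qed.

(* For [m] vertices outside a huge clique: [dg] is the sum of their degrees, [i]
   the number of edges between them, [j] the number of edges outside the flat. *)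
Lemma num_exceptional m dg i j : 9 * q ^ 2 * m <= 2 * dg + q * m -> 20 * i <= q ^ 2 * m ->
  dg <= 2 * i + (2 * q - 1) * m + 2 * j -> T * ((2 * q - 1) * m) <= j.
Proof.
move=> h1 h2 h3; have qq : 100 * (q * m) <= q * q * m.
  by rewrite mulnA !leq_mul2r q_big !orbT.
have : T * ((2 * q - 1) * m) <= (q + 2) * (2 * q * m).
  by apply: leq_mul => //; rewrite leq_mul2r; apply/orP; right; lia.
move/leq_trans; apply.
have h4 : (2 * q - 1) * m <= 2 * (q * m) by rewrite mulnA leq_mul2r; apply/orP; right; lia.
have m0 : 100 * m <= q * m by rewrite leq_mul2r q_big orbT.
move: h1 h2 h3 h4 qq m0; rewrite -mulnn.
have -> : (q + 2) * (2 * q * m) = 2 * (q * q * m) + 4 * (q * m) by clear; ring.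
rewrite -!mulnA; move: (q * (q * m)) (q * m) ((2 * q - 1) * m) => x y z; clear; lia.
Qed.

End Numbers.

Section LocalCharge.
Import Order.TTheory GRing.Theory Num.Theory.
Local Open Scope ring_scope.
Variables (d T : nat).
Hypothesis d_gt0 : (0 < d)%N.
Local Notation D := ('C(d.+1, 2)).

(** The loss TD/(a+1) of T bases is paid by b half-edges. *)
Lemma charge_clique c a b : (d <= a)%N -> (2 * T * D <= b * a.+1)%N ->
  T%:R * d%:R <= T%:R * phi d c a + b%:R / 2 :> rat.
Proof.
move=> da; rewrite -(ler_nat rat) !natrM -(natr1 a) => h.
have := phi_ge_clique d_gt0 c da; move: (phi _ _ _) => ph hph.
have a0 : 0 < a%:R + 1 :> rat by rewrite natr1 ltr0n.
have : T%:R * (D%:R / (a%:R + 1)) <= b%:R / 2 :> rat.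
  rewrite mulrA ler_pdivrMr //; lra.
have := ler_wpM2l (ler0n rat T) hph; rewrite mulrBr; lra.
Qed.

Lemma charge_nonclique a b : (d <= a)%N -> (2 * D <= a)%N ->
  T%:R * d%:R <= T%:R * phi d false a + b%:R / 2 :> rat.
Proof.
move=> da; rewrite -(ler_nat rat) !natrM phi_nonclique // => h.
have a0 : 0 < a%:R :> rat by rewrite ltr0n; lia.
have : D%:R / a%:R <= 1 / 2 :> rat by rewrite ler_pdivrMr //; lra.
move=> h2; rewrite -[X in X <= _]addr0 lerD // ?divr_ge0 //.
by rewrite ler_wpM2l //; lra.
Qed.

Lemma charge_small c a b : (a <= d)%N -> (2 * T * d <= b)%N ->
  T%:R * d%:R <= T%:R * phi d c a + b%:R / 2 :> rat.
Proof.
move=> ad; rewrite -(ler_nat rat) !natrM phi_small // => h.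
have : 0 <= T%:R * (a%:R / 2) :> rat by rewrite mulr_ge0 // divr_ge0.
lra.
Qed.

Lemma gain_ge c a : (d <= a)%N -> (d <= gain d c a)%N.
Proof. by rewrite /gain; case: ifP => _; lia. Qed.

End LocalCharge.

(** * Packing condition in the sparse core *)

Section SparsePacking.
Variables (V : finType) (q T N : nat) (r : {set {set V}} -> nat) (E : {set {set V}}) (A0 : {set V}).
Let d := 2 * q - 1.
Local Notation D := ('C(d.+1, 2)).
Hypothesis rP : is_rigid d r.
Hypothesis EK : E \subset Kn setT.
Hypothesis q_big : 100 <= q.
Hypothesis T_le : T <= q + 2.
Hypothesis N_big : 18 * q ^ 4 < N.
Hypothesis sparse : forall W : {set V}, #|W| <= N -> 20 * ind E W <= q ^ 2 * #|W|.
Hypothesis mindeg : forall v, v \in A0 -> 9 * q ^ 2 <= 2 * deg E A0 v + q.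
Hypothesis sep : forall A1 A2 : {set V}, A1 \subset A0 -> A2 \subset A0 -> A1 != set0 ->
  A2 != set0 -> [disjoint A1 & A2] ->
  (forall x y, x \in A1 -> y \in A2 -> [set x; y] \notin E) ->
  #|A0 :\: (A1 :|: A2)| <= q ^ 4 -> #|A0 :\: A1| < N \/ #|A0 :\: A2| < N.
Implicit Types (e : {set V}) (X Y Z W S : {set V}) (u v w x y : V).

Variable F : {set {set V}}.
Hypothesis fl : flat r F.
Let J := E :\: F.
Let rR : is_rank r := rigid_rank rP.
Let C v : {set V} := v |: (nb F v :&: A0).
Let simp v := clq F (C v).
Let bb v := #|nb J v :&: A0|.
(* A simplicial vertex contributes less than [d] to the rank of the flat, but it
   can be deleted at the cost of exactly [d]; this is done when it is not
   compensated by edges outside the flat. *)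
Let removed v := simp v && (if #|C v| <= N then bb v < 2 * q else bb v == 0).
Let Del := [set v in A0 | removed v].
Let W := A0 :\: Del.

Local Lemma d_pos : 0 < d.
Proof. by move: q_big; rewrite /d; clear; lia. Qed.

Local Lemma DE : D = q * d.
Proof. by have := double_D d; rewrite /d; nia. Qed.

Local Lemma CA v : v \in A0 -> C v \subset A0.
Proof. by move=> vA; rewrite subUset sub1set vA subsetIr. Qed.

Local Lemma CP v x : x \in A0 -> x != v -> (x \in C v) = ([set v; x] \in F).
Proof. by move=> xA xv; rewrite in_setU1 in_setI nbP xA xv andbT (negPf xv). Qed.

Local Lemma C_self v : v \in C v.
Proof. by rewrite in_setU1 eqxx. Qed.

Local Lemma C_sym u v : u \in A0 -> v \in A0 -> u \in C v -> v \in C u.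
Proof.
move=> uA vA; have [->|uv] := eqVneq u v; first by rewrite C_self.
have vu : v != u by rewrite eq_sym.
by rewrite (CP uA uv) (CP vA vu) setUC.
Qed.

Local Lemma simp_sub u v : u \in A0 -> v \in A0 -> simp v -> u \in C v -> C v \subset C u.
Proof.
move=> uA vA sv uC; apply/subsetP => x xC.
have [->|xu] := eqVneq x u; first exact: C_self.
rewrite CP ?(subsetP (CA vA)) //; move/clqP: sv; apply=> //; by rewrite eq_sym.
Qed.

Local Lemma simp_eq u v : u \in A0 -> v \in A0 -> simp v -> simp u -> u \in C v -> C u = C v.
Proof.
move=> uA vA sv su uC; apply/eqP; rewrite eqEsubset !simp_sub //.
exact: C_sym.
Qed.

(** With d neighbours in the clique [C v], the vertex x would be joined to v by [flat_glue]. *)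
Local Lemma simp_out v x : v \in A0 -> simp v -> x \in A0 -> x \notin C v ->
  #|nb F x :&: C v| < d.
Proof.
move=> vA sv xA xC; rewrite ltnNge; apply/negP => dK.
have xv : x != v by apply: contraNneq xC => ->; apply: C_self.
have : [set v; x] \in F; last by rewrite -CP // (negPf xC).
apply: (flat_glue rP fl dK) => //.
- rewrite in_setI nbP C_self andbT; apply: contra xC => /andP[_ h].
  by rewrite CP // setUC.
- by rewrite in_setI (negPf xC) andbF.
- by rewrite eq_sym.
- exact: clqS (subsetIr _ _) sv.
move=> y /setIP[yx yC]; split; last by move: yx; rewrite nbP => /andP[].
move: yC; rewrite in_setU1 => /predU1P[yv|/setIP[]]; last by rewrite nbP => /andP[].
by move: xC; rewrite CP // setUC; move: yx; rewrite nbP yv => /andP[_ ->].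
Qed.

Local Lemma simp_inter u v : u \in A0 -> v \in A0 -> simp v -> simp u -> C u != C v ->
  #|C u :&: C v| < d.
Proof.
move=> uA vA sv su Cuv.
have [sub|/subsetPn[x xu xv]] := boolP (C u \subset C v).
  by case/eqP: Cuv; apply: simp_eq => //; apply: (subsetP sub); apply: C_self.
have xA : x \in A0 by apply: (subsetP (CA uA)).
apply: leq_ltn_trans (simp_out vA sv xA xv); apply: subset_leq_card.
apply/subsetP => y /setIP[yu yv]; rewrite in_setI yv andbT nbP.
have yx : y != x by apply: contraNneq xv => <-.
by rewrite yx /=; move/clqP: su; apply=> //; rewrite eq_sym.
Qed.

Local Lemma deg_split v Z : nb F v :&: A0 \subset Z -> deg E A0 v <= deg E Z v + bb v.
Proof.
move=> sZ; apply: leq_trans (leq_card_setU _ _); apply: subset_leq_card.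
apply/subsetP => x /setIP[xE xA]; rewrite in_setU !in_setI xE xA andbT /=.
case: (boolP (x \in Z)) => //= xZ; move: xE; rewrite !nbP in_setD => /andP[xv ->].
rewrite xv andbT /=; apply: contra xZ => xF; apply: (subsetP sZ).
by rewrite in_setI nbP xv xF.
Qed.

Local Lemma deg_FJ v : deg E A0 v <= #|nb F v :&: A0| + bb v.
Proof.
apply: leq_trans (deg_split (subxx _)) _; rewrite leq_add2r /deg.
exact/subset_leq_card/subsetIr.
Qed.

Local Lemma DelP v : v \in Del -> [/\ v \in A0, simp v &
  (#|C v| <= N /\ bb v < 2 * q) \/ (N < #|C v| /\ bb v = 0)].
Proof.
rewrite inE /removed => /and3P[vA sv].
have [h|h] := leqP #|C v| N => hb; split=> //; first by left.
by right; split=> //; apply/eqP.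
Qed.

Local Lemma WP v : (v \in W) = (v \in A0) && (v \notin Del).
Proof. by rewrite in_setD andbC. Qed.

(** Removed vertices of [C v] share this clique and have fewer than 2q edges outside the flat, so
    almost all of their degree 9q^2/2 lies inside [C v]. As [C v] spans few edges, they make up at
    most 1/40 of it, and the rest still has 17q^2/4 vertices. *)
Local Lemma small_clique v : v \in Del -> #|C v| <= N -> 17 * q ^ 2 <= 4 * #|C v :&: W|.
Proof.
move=> vD CN; have [vA sv h] := DelP vD.
have bv u : u \in C v :&: Del -> [/\ u \in A0, C u = C v & bb u < 2 * q].
  case/setIP=> uC uD; have [uA su hu] := DelP uD.
  have eC := simp_eq uA vA sv su uC; split=> //.
  case: hu => [[_ h2] //|[h1 _]].
  by rewrite eC ltnNge CN in h1.
have dC u : u \in C v :&: Del -> 9 * q ^ 2 <= 2 * deg E (C v) u + 5 * q.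
  move=> uP; have [uA eC bu] := bv u uP; have := mindeg uA.
  have := @deg_split u (C v); rewrite -{1}eC subsetUr => /(_ isT); lia.
have := sparse CN; have := handshake (C v) EK; rewrite -/(ind E (C v)) => hs.
have : #|C v :&: Del| * (9 * q ^ 2 - 5 * q) <= 4 * ind E (C v).
  rewrite -[4]/(2 * 2) -mulnA -hs -sum_nat_const [X in _ <= 2 * X](big_setID Del) mulnDr.
  apply: leq_trans (leq_addr _ _); rewrite big_distrr /=; apply: leq_sum => u uP.
  by have := dC u uP; rewrite /deg; lia.
have cC : #|C v| = #|C v :&: W| + #|C v :&: Del|.
  rewrite -(cardsID Del (C v)) addnC; congr (_ + _); apply: eq_card => x.
  rewrite [LHS]in_setD [RHS]in_setI WP; case: (boolP (x \in C v)) => [/(subsetP (CA vA))->|]; rewrite ?andbT ?andbF //.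
have : 9 * q ^ 2 <= 2 * #|C v| + 5 * q.
  have := dC v; rewrite in_setI C_self vD => /(_ isT).
  have : deg E (C v) v <= #|C v| by apply/subset_leq_card/subsetIr.
  lia.
rewrite cC; move: #|C v :&: W| #|C v :&: Del| (ind E (C v)) => x y i h1 h2 h3.
have q2 : 100 * q <= q ^ 2 by rewrite expnS expn1; nia.
have h4 : y * (8 * q ^ 2) <= y * (9 * q ^ 2 - 5 * q) by rewrite leq_mul2l; lia.
have h5 : 40 * y <= x + y.
  rewrite -(leq_pmul2l (isT : 0 < 1)) mul1n mul1n -(@leq_pmul2l (q ^ 2)); last lia.
  lia.
lia.
Qed.

Local Lemma CW_nb v : v \in Del -> C v :&: W \subset nb F v.
Proof.
move=> vD; apply/subsetP => x /setIP[xC]; rewrite WP => /andP[_ xD].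
have : x != v by apply: contraNneq xD => ->.
by move: xC; rewrite in_setU1 => /predU1P[->|/setIP[]]; rewrite ?eqxx.
Qed.

(** Each removed vertex keeps d neighbours in W itself. So the removed vertices can be put back in
    any order, each raising the rank by at least d. *)
Local Lemma del_rank : (forall v, v \in Del -> d <= #|C v :&: W|) ->
  r (F :&: Kn W) + d * #|Del| <= r (F :&: Kn A0).
Proof.
move=> hD; have DA : Del \subset A0 by apply/subsetP => v; rewrite inE => /andP[].
suff main n (Z : {set V}) : #|Z| = n -> Z \subset Del ->
    r (F :&: Kn W) + d * #|Z| <= r (F :&: Kn (W :|: Z)).
  have := main _ Del erefl (subxx _); suff -> : W :|: Del = A0 by [].
  by rewrite /W setUC -{1}(setIidPr DA) setID.
elim: n Z => [|n IHn] Z cZ ZD.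
  by move/eqP: (cZ); rewrite cards_eq0 => /eqP->; rewrite cards0 muln0 addn0 setU0.
have /card_gt0P[v vZ] : 0 < #|Z| by rewrite cZ.
have cZv : #|Z| = #|Z :\ v|.+1 by rewrite (cardsD1 v Z) vZ.
have := IHn (Z :\ v); rewrite cZ in cZv; case: cZv => <- /(_ erefl (subset_trans (subD1set _ _) ZD)).
have vD := subsetP ZD _ vZ.
have vW : v \notin W by rewrite WP vD andbF.
have -> : W :|: Z :\ v = (W :|: Z) :\ v.
  by apply/setP => x; rewrite !in_setU !in_setD1 in_setU; case: eqP => [->|]; rewrite ?(negPf vW).
have vWZ : v \in W :|: Z by rewrite in_setU vZ orbT.
have := rigid_gain rP fl vWZ.
have dN : d <= #|nb F v :&: (W :|: Z)|.
  apply: leq_trans (hD v vD) _; apply: subset_leq_card; apply/subsetP => x xCW.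
  by rewrite in_setI (subsetP (CW_nb vD)) //= in_setU; case/setIP: xCW => _ ->.
have := gain_ge d_pos (clq F (nb F v :&: (W :|: Z))) dN; rewrite cZ mulnS.
by move: (gain _ _ _) (r _) (r _) (r _) => g x y z; clear; lia.
Qed.

Section Nonexceptional.
Hypothesis nonex : forall v, v \in Del -> N < #|C v| -> q ^ 4 <= #|C v :&: W|.

Let q2_big : 100 * q <= q ^ 2.
Proof. by rewrite expnS expn1 leq_mul2r q_big orbT. Qed.

Let q4_big : 1000 * q ^ 2 <= q ^ 4.
Proof. by rewrite (expnD q 2 2) leq_mul2r; have := q2_big; move: q_big (q ^ 2) => h x; move: h; clear; lia. Qed.

Local Lemma delW v : v \in Del -> 17 * q ^ 2 <= 4 * #|C v :&: W|.
Proof.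
move=> vD; have [CN|CN] := leqP #|C v| N; first exact: small_clique.
have := nonex vD CN; have := q4_big; move: #|_ :&: _| (q ^ 2) (q ^ 4) => x y z; clear; lia.
Qed.

Let d_le v : v \in Del -> d.+1 < #|C v :&: W|.
Proof.
move=> vD; have := delW vD; have := q2_big; rewrite /d; move: q_big.
by move: #|_ :&: _| (q ^ 2) => x y; clear; lia.
Qed.

(** Deleting [Del] creates no new simplicial vertex next to a deleted one. A neighbour of u outside
    [C v] would be adjacent to too many vertices of [C v] if it is kept; if it is removed, its own
    clique meets W outside [C v], which gives a kept neighbour of that kind. *)
Local Lemma clique_del u v : v \in Del -> u \in W -> u \in C v -> clq F (nb F u :&: W) ->
  C u = C v.
Proof.
move=> vD uW uC cu; have [vA sv hv] := DelP vD.
have [uA uD] : u \in A0 /\ u \notin Del by move: uW; rewrite WP => /andP.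
have inW x : x \in nb F u :&: W -> x \in C v.
  move=> xn; apply: contraT => xC.
  have xA : x \in A0 by case/setIP: xn => _; rewrite WP => /andP[].
  have := simp_out vA sv xA xC; have dv := d_le vD.
  suff : #|C v :&: W| <= #|nb F x :&: C v|.+1 by move: dv; move: #|nb F x :&: C v| #|C v :&: W| => m n; clear; lia.
  rewrite (cardsD1 u (C v :&: W)) -add1n leq_add ?leq_b1 //.
  apply: subset_leq_card; apply/subsetP => y /setD1P[yu /setIP[yC yW]].
  rewrite in_setI yC andbT nbP.
  have yx : y != x by apply: contraNneq xC => <-.
  rewrite yx /=; move/clqP: cu; apply=> //; last by rewrite eq_sym.
  by rewrite in_setI yW andbT nbP yu /=; move/clqP: sv; apply=> //; rewrite eq_sym.
apply/eqP; rewrite eqEsubset (simp_sub uA vA sv uC) andbT.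
apply/subsetP => x /setU1P[->//|/setIP[xn xA]].
have [xD|xD] := boolP (x \in Del); last by apply: inW; rewrite in_setI xn WP xA.
have [_ sx _] := DelP xD.
have ux : u \in C x.
  by apply: (C_sym xA uA); rewrite in_setU1 in_setI xn xA orbT.
have [<-|Cxv] := eqVneq (C x) (C v); first exact: C_self.
have := simp_inter xA vA sv sx Cxv; have dx := d_le xD => lt.
have : ~~ (C x :&: W \subset C x :&: C v).
  apply/negP => /subset_leq_card h.
  by have := leq_trans (leq_trans dx h) (ltnW lt); rewrite ltnNge leqnSn.
case/subsetPn=> y /setIP[yx yW]; rewrite in_setI yx /= => yv.
have : y \in C v; last by rewrite (negPf yv).
apply: inW; rewrite in_setI yW andbT nbP.
have yu : y != u by apply: contraNneq yv => ->.
by rewrite yu /=; move/clqP: sx; apply=> //; rewrite eq_sym.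
Qed.

Local Lemma simpW u : u \in A0 -> clq F (nb F u :&: A0) -> simp u.
Proof.
move=> uA /clqP cu; apply/clqP => x y; rewrite !in_setU1.
have nF z : z \in nb F u :&: A0 -> [set u; z] \in F by case/setIP; rewrite nbP => /andP[].
case/predU1P=> [->|xn] /predU1P[->|yn] xy; rewrite ?eqxx // in xy *.
- exact: nF.
- by rewrite setUC; apply: nF.
exact: cu.
Qed.

(** Next to a deleted vertex, u has degree at least 2D in the flat on W, so only a clique
    neighbourhood loses; then u was simplicial in A0 and was kept because edges outside the flat pay
    for it. *)
Local Lemma charge_W u : u \in W ->
  (T%:R * d%:R <= T%:R * phiF d F W u + (bb u)%:R / 2 :> rat)%R.
Proof.
move=> uW; have [uA uD] : u \in A0 /\ u \notin Del by move: uW; rewrite WP => /andP.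
have DEd := DE; rewrite /phiF.
have big_b : simp u -> N < #|C u| -> 0 < bb u.
  move=> su CN; rewrite lt0n; apply: contra uD => b0.
  by rewrite inE uA /removed su leqNgt CN.
have small_b : simp u -> #|C u| <= N -> 2 * q <= bb u.
  move=> su CN; rewrite leqNgt; apply: contra uD => b0.
  by rewrite inE uA /removed su CN.
have [[v vD uv]|nodel] := classic (exists2 v, v \in Del & u \in nb F v).
  have [vA sv hv] := DelP vD.
  have uC : u \in C v by rewrite in_setU1 in_setI uv uA orbT.
  have xa : #|C v :&: W| <= #|nb F u :&: W|.+1.
    rewrite (cardsD1 u (C v :&: W)) -add1n leq_add ?leq_b1 //.
    apply: subset_leq_card; apply/subsetP => y /setD1P[yu /setIP[yC yW]].
    rewrite in_setI yW andbT nbP yu /=; move/clqP: sv; apply=> //; by rewrite eq_sym.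
  have h17 := delW vD.
  have hD : 2 * D <= #|nb F u :&: W| by rewrite DEd; apply: num_D h17 xa.
  have hd : d <= #|nb F u :&: W|.
    by apply: leq_trans hD; rewrite DEd; apply: num_d.
  have [cu|cu] := boolP (clq F (nb F u :&: W)); last first.
    by apply: charge_nonclique => //; exact: d_pos.
  have eC := clique_del vD uW uC cu.
  have su : simp u by rewrite /simp eC.
  apply: (charge_clique d_pos) => //; rewrite DEd.
  have [CN|CN] := leqP #|C u| N; first exact: num_small_clique h17 xa (small_b su CN).
  by apply: num_large_clique xa (big_b su CN) => //; apply: nonex; rewrite // -eC.
(* No neighbour of u in the flat was deleted, so the lower bound on the degree in A0 applies to a +
   b. *)
have eN : nb F u :&: W = nb F u :&: A0.
  apply/setP => x; rewrite !in_setI WP; case: (boolP (x \in nb F u)) => //= xn.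
  case: (x \in A0) => //=; apply/negP => xD; apply: nodel; exists x => //.
  by rewrite nb_sym.
rewrite eN; have hab := leq_trans (mindeg uA) (leq_add (leq_mul (leqnn 2) (deg_FJ u)) (leqnn q)).
have mid c : 2 * q <= bb u -> (T%:R * d%:R <= T%:R * phi d c #|nb F u :&: A0|
    + (bb u)%:R / 2 :> rat)%R.
  move=> hb; have [lo|hi] := ltnP #|nb F u :&: A0| d.
    by apply: charge_small (ltnW lo) _ => //; [exact: d_pos|apply: num_low lo hab].
  by apply: (charge_clique d_pos) => //; rewrite DEd; apply: num_mid hi hb hab.
have [cu|cu] := boolP (clq F (nb F u :&: A0)); last first.
  have [hD|hD] := leqP (2 * D) #|nb F u :&: A0|.
    apply: charge_nonclique => //; first exact: d_pos.
    apply: leq_trans hD; rewrite DEd.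
    exact: num_d.
  by apply: mid; rewrite DEd in hD; apply: num_b hD hab.
have su := simpW uA cu.
have [CN|CN] := leqP #|C u| N; first exact: mid (small_b su CN).
have cC : #|C u| = #|nb F u :&: A0|.+1.
  by rewrite /C cardsU1 in_setI (negPf (nbxx F u)).
have q4N : q ^ 4 <= #|nb F u :&: A0|.+1.
  rewrite -cC; apply: leq_trans (ltnW CN); apply: leq_trans (ltnW N_big).
  by rewrite leq_pmull.
apply: (charge_clique d_pos).
  have : 2 * q - 1 < #|nb F u :&: A0|.+1; last by [].
  apply: leq_trans q4N; have := q4_big; have := q2_big; move: q_big.
  by move: (q ^ 2) (q ^ 4) => x y; clear; lia.
by rewrite DEd; apply: num_large_clique q4N (leqnn _) (big_b su CN).
Qed.

Local Lemma packing_nonexceptional :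
  T * (d * #|A0|) <= T * r (F :&: Kn A0) + #|J :&: Kn A0|.
Proof.
have JK : J \subset Kn setT by apply: subset_trans EK; apply: subsetDl.
have hW := charge_rank rP d_pos fl JK (subsetDl A0 Del) charge_W.
have hD v : v \in Del -> d <= #|C v :&: W| by move/d_le => h; exact: ltnW (ltnW h).
have h1 := del_rank hD.
have -> : #|A0| = #|W| + #|Del|.
  have DA : Del \subset A0 by apply/subsetP => v; rewrite inE => /andP[].
  by rewrite addnC -(cardsID Del A0) (setIidPr DA).
rewrite !mulnDr; apply: leq_trans (leq_add (leq_mul (leqnn T) h1) (leqnn _)).
by rewrite mulnDr addnAC leq_add2r.
Qed.

End Nonexceptional.

(** The removed vertices of the huge clique have no edges outside the flat, so fewer than q^4
    vertices separate them from [A0 :\: C v], which therefore has fewer than N vertices and is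
    sparse. Its vertices send fewer than d flat edges each into the clique, so most of their degree
    is outside the flat and pays for them. The clique causes the term T * D. *)
Local Lemma packing_exceptional v : v \in Del -> N < #|C v| -> #|C v :&: W| < q ^ 4 ->
  T * (d * #|A0|) <= T * r (F :&: Kn A0) + #|J :&: Kn A0| + T * D.
Proof.
move=> vD CN Cq; have [vA sv hv] := DelP vD.
have JK : J \subset Kn setT by apply: subset_trans EK; apply: subsetDl.
have dC : d <= #|C v|.
  apply: leq_trans (ltnW CN); apply: leq_trans (ltnW N_big).
  have h4 : q ^ 1 <= q ^ 4 by rewrite leq_pexp2l //; move: q_big; clear; lia.
  rewrite expn1 in h4; apply: (@leq_trans (18 * q)); first by rewrite /d; clear; lia.
  by rewrite leq_mul2l h4 orbT.
have rC : d * #|C v| <= r (F :&: Kn A0) + D.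
  rewrite -(rigid_Kn_eq rP dC) leq_add2r rank_mono //.
  by rewrite subsetI KnS ?CA // andbT; exact: sv.
set Rem := A0 :\: C v.
have cA : #|A0| = #|C v| + #|Rem| by rewrite -(cardsID (C v) A0) (setIidPr (CA vA)).
suff hR : T * (d * #|Rem|) <= #|J :&: Kn A0|.
  have -> : T * (d * #|A0|) = T * (d * #|C v|) + T * (d * #|Rem|) by rewrite cA !mulnDr.
  rewrite addnAC leq_add //.
  by apply: leq_trans (leq_mul (leqnn T) rC) _; rewrite (mulnDr T (r _)).
have [->|Rem0] := eqVneq Rem set0; first by rewrite cards0 !muln0.
set P := C v :&: Del.
have PP u : u \in P -> [/\ u \in A0, C u = C v & bb u = 0].
  case/setIP=> uC uD; have [uA su hu] := DelP uD.
  have eC := simp_eq uA vA sv su uC; split=> //.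
  by case: hu => [[h1 _]|[_ ->]] //; rewrite eC leqNgt CN in h1.
have RemN : #|Rem| < N.
  have CWP : A0 :\: (P :|: Rem) = C v :&: W.
    apply/setP => x; rewrite in_setD in_setU !in_setI in_setD WP.
    case: (boolP (x \in C v)) => [/(subsetP (CA vA))->|]; last by rewrite andbC; case: (x \in A0).
    by rewrite /= !andbT !orbF.
  have PA : P \subset A0 by apply: subset_trans (subsetIl _ _) (CA vA).
  have P0 : P != set0 by apply/set0Pn; exists v; rewrite in_setI C_self vD.
  have dPR : [disjoint P & Rem].
    rewrite -setI_eq0; apply/eqP/setP => x; rewrite in_setI in_setI in_setD in_set0.
    by case: (x \in C v); rewrite ?andbF.
  have noE x y : x \in P -> y \in Rem -> [set x; y] \notin E.
    move=> xP /setDP[yA yC]; have [xA eC bx] := PP x xP; apply/negP => xyE.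
    have yx : y != x.
      by apply: contraNneq yC => ->; case/setIP: xP.
    have : y \notin nb J x :&: A0.
      by move/eqP: bx; rewrite cards_eq0 => /eqP->; rewrite in_set0.
    rewrite in_setI nbP yx yA andbT in_setD xyE andbT /= negbK => xyF.
    by rewrite -eC CP ?xyF in yC.
  have h := sep PA (subsetDl A0 (C v)) P0 Rem0 dPR noE; rewrite CWP in h.
  case: (h (ltnW Cq)) => {}h.
    apply: leq_ltn_trans h; apply: subset_leq_card; apply/subsetP => x /setDP[xA xC].
    by rewrite in_setD xA andbT in_setI (negPf xC).
  by exfalso; move: h; rewrite /Rem setDDr setDv set0U (setIidPr (CA vA)) ltnNge (ltnW CN).
apply: (@num_exceptional q T q_big T_le #|Rem| (\sum_(x in Rem) deg E A0 x) (ind E Rem)).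
- have hs : \sum_(x in Rem) 9 * q ^ 2 <= \sum_(x in Rem) (2 * deg E A0 x + q).
    by apply: leq_sum => x /setDP[xA _]; exact: mindeg.
  rewrite sum_nat_const big_split /= -big_distrr /= sum_nat_const in hs.
  by rewrite [X in X <= _]mulnC [q * _]mulnC.
- exact: sparse (ltnW RemN).
have <- := handshake Rem EK; have hJ := handshake A0 JK.
apply: (@leq_trans (\sum_(x in Rem) (#|nb E x :&: Rem| + d + bb x))).
  apply: leq_sum => x /setDP[xA xC]; have lt := simp_out vA sv xA xC.
  apply: (@leq_trans (#|nb E x :&: Rem| + #|nb F x :&: C v| + bb x)); last first.
    by rewrite leq_add2r leq_add2l ltnW.
  apply: leq_trans (leq_add (leq_card_setU _ _) (leqnn _)).
  apply: leq_trans (leq_card_setU _ _); apply: subset_leq_card.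
  apply/subsetP => y /setIP[yE yA]; rewrite !in_setU !in_setI in_setD yE yA /= !andbT.
  case: (boolP (y \in C v)) => //= yC; rewrite andbT orbC.
  move: yE; rewrite !nbP in_setD => /andP[-> ->]; rewrite /= andbT.
  by case: (_ \in F).
rewrite !big_split /= sum_nat_const [#|Rem| * d]mulnC leq_add2l -hJ.
by rewrite [X in _ <= X](big_setID (C v)) /= leq_addl.
Qed.

Lemma sparse_flat_bound :
  T * (d * #|A0|) <= T * r (F :&: Kn A0) + #|(E :\: F) :&: Kn A0| + T * D.
Proof.
have [[v [vD CN Cq]]|h] := classic (exists v, [/\ v \in Del, N < #|C v| & #|C v :&: W| < q ^ 4]).
  exact: packing_exceptional vD CN Cq.
apply: leq_trans (packing_nonexceptional _) (leq_addr _ _) => v vD CN.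
by rewrite leqNgt; apply/negP => Cq; apply: h; exists v.
Qed.

End SparsePacking.

Section Glue.
Variable V : finType.
Implicit Types (e : {set V}) (E : {set {set V}}) (v : V).

Lemma glue_tails (I : finType) E (B : I -> {set {set V}}) (ti : I -> {set V} -> V) (v0 : V) :
  E \subset Kn setT -> (forall i j, i != j -> [disjoint B i & B j]) ->
  (forall i e, e \in B i -> ti i e \in e) ->
  exists t, (forall e, e \in E -> t e \in e) /\ forall i e, e \in B i -> t e = ti i e.
Proof.
move=> EK dB tiB.
exists (fun e => if [pick i | e \in B i] is Some i then ti i e else odflt v0 [pick w in e]).
split=> [e eE|i e eB].
  case: pickP => [i /tiB //|_]; case: pickP => [//|h].
  have := subsetP EK _ eE; rewrite inE => /andP[/eqP c2 _].
  by move: c2; rewrite (eq_card0 h).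
case: pickP => [j ejB|/(_ i)]; last by rewrite eB.
by have [->//|ji] := eqVneq j i; rewrite (disjointFl (dB _ _ ji) eB) in ejB.
Qed.

End Glue.

(** * Orienting a base with its deficit on d chosen vertices *)

Section Weighted.
Variables (V : finType) (q : nat) (r : {set {set V}} -> nat).
Local Notation d := (2 * q - 1).
Hypothesis rP : is_rigid d r.
Hypothesis q_gt1 : 1 < q.
Implicit Types (e : {set V}) (B E F J : {set {set V}}) (X Y Z W S L : {set V}) (u v w : V).
Implicit Types (t : {set V} -> V).
Let rR : is_rank r := rigid_rank rP.

Lemma binom_dq : 'C(d.+1, 2) = q * d.
Proof.
have := double_D d; have -> : d * d.+1 = 2 * (q * d) by rewrite mulnC mulnA; congr (_ * _); lia.
by move/eqP; rewrite eqn_pmul2l // => /eqP.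
Qed.

Lemma dead_size B t X S v : B \subset Kn setT -> (forall e, e \in B -> t e \in e) ->
  v \in X -> d <= outdeg t B v -> (forall e, e \in B -> t e \in X -> e \subset X :|: S) ->
  d <= #|X :|: S|.
Proof.
move=> BK tB vX ov dead; apply: leq_trans ov _.
have sK : B :&: Kn (X :|: S) \subset Kn setT by apply: subset_trans (subsetIl _ _) BK.
apply: (@leq_trans #|nb (B :&: Kn (X :|: S)) v|); last first.
  by rewrite nbI_Kn ?inE ?vX // subset_leq_card ?subsetIr.
rewrite -card_inc //; apply: subset_leq_card; apply/subsetP => e; rewrite inE => /andP[eB /eqP te].
rewrite inE -te tB // andbT in_setI eB inE dead ?te // andbT.
by have := subsetP BK _ eB; rewrite inE => /andP[].
Qed.

(** The counting behind [dead_count], for a base whose out-degree may drop by q at each vertex of L: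
    then d|X| - q|X & L| <= d|X u S| - qd. *)
Lemma dead_weight B t X S L : indep r B -> B \subset Kn setT ->
  (forall e, e \in B -> t e \in e) ->
  (forall v, v \in X -> d <= outdeg t B v + q * (v \in L)) ->
  (forall e, e \in B -> t e \in X -> e \subset X :|: S) -> d <= #|X :|: S| ->
  q * d <= q * #|X :&: L| + d * #|S|.
Proof.
move=> iB BK tB oX dead dX.
have sub : [set e in B | t e \in X] \subset B :&: Kn (X :|: S).
  apply/subsetP => e; rewrite !inE => /andP[eB tX]; rewrite eB dead // andbT /=.
  by have := subsetP BK _ eB; rewrite inE => /andP[].
have h1 : d * #|X| <= #|B :&: Kn (X :|: S)| + q * #|X :&: L|.
  have : \sum_(v in X) d <= \sum_(v in X) (outdeg t B v + q * (v \in L)) by apply: leq_sum.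
  rewrite sum_nat_const mulnC big_split /= -big_distrr /= => h; apply: leq_trans h _.
  apply: leq_add; first by rewrite sum_outdeg subset_leq_card.
  rewrite leq_mul2l; apply/orP; right; rewrite -sum1_card big_mkcond [X in _ <= X]big_mkcond /=.
  by apply: leq_sum => v _; rewrite in_setI; case: (v \in X); case: (v \in L).
have h2 := rank_mono rR (subsetIr B (Kn (X :|: S))).
rewrite (eqP (indepS rR (subsetIl B (Kn (X :|: S))) iB)) in h2.
have h3 := rigid_Kn_eq rP dX; rewrite binom_dq in h3.
have h4 : d * #|X :|: S| <= d * #|X| + d * #|S|.
  by rewrite -mulnDr leq_mul2l leq_card_setU orbT.
move: h1 h2 h3 h4; move: (d * #|X|) (d * #|S|) (d * #|_|) (q * #|_|) (q * d) #|_| (r _); clear; lia.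
Qed.

(** The qd missing arcs are spread as q on each of the d vertices of L. Hakimi's condition on Z
    follows from the rank formula if Z has at least d vertices. *)
Lemma weighted_orient (A0 : {set V}) L B (v0 : V) : B \subset Kn A0 -> indep r B ->
  r B + q * d = d * #|A0| -> L \subset A0 -> #|L| = d ->
  exists t, (forall e, e \in B -> t e \in e) /\
    forall v, v \in A0 -> d <= outdeg t B v + q * (v \in L).
Proof.
move=> BA iB rB LA cL; have BK : B \subset Kn setT by apply: subset_trans BA (KnS (subsetT _)).
pose x v := if v \in A0 then d - q * (v \in L) else 0.
have xA v : v \in A0 -> x v + q * (v \in L) = d.
  by move=> vA; rewrite /x vA; case: (v \in L); move: q_gt1; clear; lia.
have sumx Z : \sum_(v in Z) x v + q * #|Z :&: L| = d * #|Z :&: A0|.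
  rewrite (big_setID A0) /= [X in _ + X + _]big1 => [|v /setDP[_ /negPf vA]]; last by rewrite /x vA.
  have -> : Z :&: L = (Z :&: A0) :&: L by rewrite -setIA (setIidPr LA).
  have -> : #|Z :&: A0 :&: L| = \sum_(v in Z :&: A0) (v \in L).
    rewrite -sum1_card big_mkcond [RHS]big_mkcond /=; apply: eq_bigr => v _.
    by rewrite [v \in _ :&: L]in_setI; case: (v \in Z :&: A0); case: (v \in L).
  rewrite addn0 big_distrr -big_split /= mulnC -sum_nat_const; apply: eq_bigr => v /setIP[_ vA].
  exact: xA.
have hB Z : #|B :&: Kn Z| <= \sum_(v in Z) x v.
  have -> : B :&: Kn Z = B :&: Kn (Z :&: A0).
    by rewrite -KnI setIA setIAC (setIidPl BA).
  have := sumx Z; have LZ : #|Z :&: L| <= #|Z :&: A0| by apply/subset_leq_card/setIS.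
  have Ld : #|Z :&: L| <= d by rewrite -cL subset_leq_card ?subsetIr.
  have := rank_mono rR (subsetIr B (Kn (Z :&: A0))).
  rewrite (eqP (indepS rR (subsetIl B (Kn (Z :&: A0))) iB)).
  have [dZ|Zd] := leqP d #|Z :&: A0|.
    have := rigid_Kn_eq rP dZ; rewrite binom_dq.
    have : q * #|Z :&: L| <= q * d by rewrite leq_mul2l Ld orbT.
    by clear; lia.
  (* A set of fewer than d = 2q - 1 vertices spans at most q - 1 = d - q edges per vertex, so the
     condition holds even if all its vertices are in L. *)
  have hC : 2 * 'C(#|Z :&: A0|, 2) <= 2 * ((q - 1) * #|Z :&: A0|).
    rewrite mulnC; have := bin_ffact #|Z :&: A0| 2; rewrite !ffactnS ffactn0 !factS fact0 !muln1 => ->.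
    by rewrite mulnA [X in _ <= X]mulnC leq_mul2l; apply/orP; right; move: Zd; clear; lia.
  rewrite leq_pmul2l // in hC.
  have := rank_card rR (Kn (Z :&: A0)); rewrite card_Kn.
  have h4 : q * #|Z :&: L| <= q * #|Z :&: A0| by rewrite leq_mul2l LZ orbT.
  have h5 : (q - 1) * #|Z :&: A0| + q * #|Z :&: A0| = d * #|Z :&: A0|.
    by rewrite -mulnDl; congr (_ * _); move: q_gt1; clear; lia.
  by move: hC h4 h5; clear; lia.
have [t [tB ot]] := hakimi v0 BK hB; exists t; split=> // v vA.
rewrite (hakimi_eq ot) ?xA //.
have := sumx setT; rewrite !setTI cL -rB (eqP iB) (eq_bigl xpredT) => [|u]; last by rewrite in_setT.
by move=> h; rewrite -(leq_add2r (q * d)) h.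
Qed.

End Weighted.

(** * Orienting the sparse core with hubs *)

Section SparseOrientation.
Variables (V : finType) (q N : nat) (r : {set {set V}} -> nat) (E : {set {set V}}).
Variable A : {set V}.
Local Notation d := (2 * q - 1).
Hypothesis rP : is_rigid d r.
Hypothesis EK : E \subset Kn setT.
Hypothesis q_big : 100 <= q.
Hypothesis N_big : 18 * q ^ 4 < N.
Hypothesis sparse : forall W : {set V}, #|W| <= N -> 20 * ind E W <= q ^ 2 * #|W|.
Hypothesis A_neq0 : A != set0.
Hypothesis mindeg : forall v, v \in A -> 9 * q ^ 2 <= 2 * deg E A v.
Hypothesis sep : forall A1 A2 : {set V}, A1 \subset A -> A2 \subset A -> A1 != set0 ->
  A2 != set0 -> [disjoint A1 & A2] ->
  (forall x y, x \in A1 -> y \in A2 -> [set x; y] \notin E) ->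
  #|A :\: (A1 :|: A2)| <= 2 * q ^ 4 -> #|A :\: A1| < N \/ #|A :\: A2| < N.
Implicit Types (e : {set V}) (X Y Z W S : {set V}) (u v w x y : V).
Let rR : is_rank r := rigid_rank rP.

Let q2_big : 100 * q <= q ^ 2.
Proof. by rewrite expnS expn1 leq_mul2r q_big orbT. Qed.

Let q_gt1 : 1 < q.
Proof. by apply: leq_trans q_big. Qed.

Let d_gt0 : 0 < d.
Proof. by move: q_gt1; clear; lia. Qed.

Section Hub.
Variable Hub : {set V}.
Hypothesis HubA : Hub \subset A.
Hypothesis cHub : #|Hub| = q./2.
Let A0 := A :\: Hub.
Let Hb : finType := {x : V | x \in Hub}.
(* Index of a base: [true] for prescribed out-degrees and [false] for prescribed
   in-degrees, together with its hub ([None] for the last pair). *)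
Let K : finType := (bool * option Hb)%type.

Local Lemma HbA (j : Hb) : val j \in A /\ val j \notin A0.
Proof. by have jH := valP j; rewrite in_setD jH (subsetP HubA). Qed.

Local Lemma card_K : #|K| = 2 * (q./2).+1.
Proof. by rewrite card_prod card_bool card_option card_sig -cHub; congr (2 * _.+1); apply: eq_card. Qed.

Local Lemma degA0 v : deg E A v <= deg E A0 v + #|Hub|.
Proof.
rewrite /deg; apply: leq_trans (leq_card_setU _ _); apply: subset_leq_card; apply/subsetP => x.
by rewrite in_setU !in_setI in_setD => /andP[-> ->]; case: (x \in Hub).
Qed.

Local Lemma mindeg0 v : v \in A -> 9 * q ^ 2 <= 2 * deg E A0 v + q.
Proof.
move=> vA; apply: leq_trans (mindeg vA) _; apply: leq_trans (leq_mul (leqnn 2) (degA0 v)) _.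
rewrite cHub mulnDr leq_add2l -{2}(odd_double_half q) mul2n; exact: leq_addl.
Qed.

Local Lemma big_deg v : v \in A -> 3 * d <= deg E A0 v.
Proof.
move=> vA; have := mindeg0 vA; have := q2_big; move: q_big.
by move: (deg _ _ _) (q ^ 2) => x y; clear; lia.
Qed.

Local Lemma big_A0 : 3 * d <= #|A0|.
Proof.
have [v vA] := set0Pn _ A_neq0; apply: leq_trans (big_deg vA) _.
exact/subset_leq_card/subsetIr.
Qed.

(** The hubs join the separator; this is why the core tolerates separators of order 2q^4. *)
Local Lemma A0_sep (A1 A2 : {set V}) : A1 \subset A0 -> A2 \subset A0 -> A1 != set0 ->
  A2 != set0 -> [disjoint A1 & A2] ->
  (forall x y, x \in A1 -> y \in A2 -> [set x; y] \notin E) ->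
  #|A0 :\: (A1 :|: A2)| <= q ^ 4 -> #|A0 :\: A1| < N \/ #|A0 :\: A2| < N.
Proof.
move=> s1 s2 n1 n2 dA noE cS; have AA : A0 \subset A by apply: subsetDl.
have [|h|h] := sep (subset_trans s1 AA) (subset_trans s2 AA) n1 n2 dA noE.
- apply: (@leq_trans (#|A0 :\: (A1 :|: A2)| + #|Hub|)).
    apply: leq_trans (leq_card_setU _ _); apply: subset_leq_card; apply/subsetP => x.
    by rewrite in_setU !in_setD => /andP[-> ->]; case: (x \in Hub).
  rewrite cHub mul2n -addnn leq_add //; apply: leq_trans (half_leq (leqnn q)) _.
  apply: (@leq_trans q); first by rewrite -{2}(odd_double_half q) -addnn addnA leq_addl.
  by rewrite -{1}(expn1 q) leq_pexp2l //; apply: leq_trans q_big.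
- by left; apply: leq_ltn_trans h; apply/subset_leq_card/setSD.
by right; apply: leq_ltn_trans h; apply/subset_leq_card/setSD.
Qed.

Local Lemma base_packing : exists B : K -> {set {set V}}, [/\ forall k, indep r (B k),
  forall k, r (B k) + q * d = d * #|A0|, forall k, B k \subset E :&: Kn A0 &
  forall k l, k != l -> [disjoint B k & B l]].
Proof.
set EA := E :&: Kn A0; pose T := #|K|.
have dA : d <= #|A0| by apply: leq_trans big_A0; rewrite leq_pmull.
have rKA := rigid_Kn_eq rP dA.
have T_le : T <= q + 2.
  by rewrite /T card_K mulnS mul2n -{2}(odd_double_half q); case: (odd q); rewrite ?add0n ?add1n; clear; lia.
have pack (F : {set {set V}}) : F \subset EA -> T * (d * #|A0|) <= T * r F + #|EA :\: F| + T * 'C(d.+1, 2).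
  move=> FE; have FK : F \subset Kn setT.
    by apply: subset_trans FE (subset_trans (subsetIl _ _) EK).
  have [F' [sF fl rF]] := flat_closure rP FK.
  have md v : v \in A0 -> 9 * q ^ 2 <= 2 * deg E A0 v + q.
    by case/setDP=> vA _; apply: mindeg0.
  have := sparse_flat_bound rP EK q_big T_le N_big sparse md A0_sep fl.
  move/leq_trans; apply; rewrite leq_add2r leq_add //.
    by rewrite leq_mul2l -rF rank_mono ?orbT // subsetIl.
  apply: subset_leq_card; apply/subsetP => e /setIP[/setDP[eE eF] eA].
  by rewrite in_setD in_setI eE eA !andbT; apply: contra eF; apply: (subsetP sF).
have T0 : 0 < T by rewrite /T card_K.
have rEA : r EA + 'C(d.+1, 2) = d * #|A0|.
  apply/eqP; rewrite eqn_leq; apply/andP; split.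
    by rewrite -rKA leq_add2r rank_mono // subsetIr.
  have hp := pack EA (subxx _); rewrite setDv cards0 addn0 in hp.
  by rewrite -(leq_pmul2l T0) (mulnDr T (r EA) 'C(d.+1, 2)).
have [|B [iB rB sB dB]] := matroid_packing (T := T) rR (A := EA).
  move=> F FE; have := pack F FE; rewrite -rEA (mulnDr T (r EA) 'C(d.+1, 2)).
  by rewrite leq_add2r.
exists (fun k => B (enum_rank k)); split=> //.
- by move=> k; rewrite rB -(binom_dq q_gt1).
- by move=> k l kl; apply: dB; rewrite (inj_eq enum_rank_inj).
Qed.

(** The leaves of a hub are where its two bases have their deficits. Leaves of index true get an arc
    to the hub and leaves of index false an arc from it. *)
Local Lemma leaves : exists L : Hb -> bool -> {set V},
  (forall j b, L j b \subset nb E (val j) :&: A0) /\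
  (forall j b, #|L j b| = d) /\ forall j, [disjoint L j true & L j false].
Proof.
have h (j : Hb) : exists L : {set V} * {set V}, [/\ L.1 \subset nb E (val j) :&: A0,
    L.2 \subset nb E (val j) :&: A0, #|L.1| = d, #|L.2| = d & [disjoint L.1 & L.2]].
  have [jA _] := HbA j; have h3 := big_deg jA.
  have [|L1 [s1 c1]] := @ex_subset_card _ (nb E (val j) :&: A0) d.
    by apply: leq_trans h3; rewrite leq_pmull.
  have [|L2 [s2 c2]] := @ex_subset_card _ ((nb E (val j) :&: A0) :\: L1) d.
    by rewrite cardsD (setIidPr s1) c1; move: h3; rewrite /deg; move: #|_| d => x y; clear; lia.
  exists (L1, L2); split=> //=; first exact: subset_trans s2 (subsetDl _ _).
  rewrite disjoint_sym -setI_eq0; apply/eqP/setP => x; rewrite in_set0 in_setI.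
  by apply/negP => /andP[/(subsetP s2)]; rewrite in_setD => /andP[/negP].
have [L hL] := fin_all_exists h.
exists (fun j b => if b then (L j).1 else (L j).2).
by split=> [j b|]; [|split=> [j b|j]]; case: (hL j) => // *; case: b.
Qed.

Local Lemma hub_orientation : exists t, (forall e, e \in E :&: Kn A -> t e \in e) /\
  qcut q (arc (E :&: Kn A) t) A.
Proof.
have [B [iB rB sB dB]] := base_packing; have [L [sL [cL dL]]] := leaves.
have [v0 v0A] := set0Pn _ A_neq0.
have [x0 x0H] : exists x, x \in Hub.
  by apply/card_gt0P; rewrite cHub half_gt0.
pose j0 : Hb := exist _ x0 x0H.
(* R carries the deficits of the last pair. It avoids the leaves of one hub, so every vertex of A0
   has full degree d in some base of each direction. *)
have [R [sR cR]] : exists R : {set V}, R \subset A0 :\: (L j0 true :|: L j0 false) /\ #|R| = d.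
  apply: ex_subset_card; rewrite cardsD.
  have h1 : #|A0 :&: (L j0 true :|: L j0 false)| <= 2 * d.
    by apply: leq_trans (subset_leq_card (subsetIr _ _)) _; rewrite cards_disjU ?dL // !cL; clear; lia.
  by have := big_A0; move: h1; clear; lia.
have RA : R \subset A0 by apply: subset_trans sR (subsetDl _ _).
have Rj0 b v : v \in R -> v \notin L j0 b.
  move/(subsetP sR); rewrite in_setD in_setU negb_or => /andP[/andP[h1 h2] _].
  by case: b.
pose LS (k : K) := if k.2 is Some j then L j k.1 else R.
have LSA k : LS k \subset A0.
  by rewrite /LS; case: k.2 => [j|] //; apply: subset_trans (sL j k.1) (subsetIr _ _).
have cLS k : #|LS k| = d by rewrite /LS; case: k.2.
have h k := weighted_orient rP q_gt1 v0 (subset_trans (sB k) (subsetIr _ _)) (iB k) (rB k) (LSA k) (cLS k).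
have {h} [tau htau] := fin_all_exists h.
have tauB k e : e \in B k -> tau k e \in e by case: (htau k) => + _; apply.
have tauD k v : v \in A0 -> d <= outdeg (tau k) (B k) v + q * (v \in LS k).
  by case: (htau k) => _; apply.
have BA k e : e \in B k -> e \in E /\ e \in Kn A0.
  by move/(subsetP (sB k)); rewrite in_setI => /andP.
have BK k : B k \subset Kn setT by apply/subsetP => e /BA[/(subsetP EK)].
have KA0 u v : [set u; v] \in Kn A0 -> u \in A0 /\ v \in A0.
  by rewrite in_Kn2 => /and3P[].
have LP j b u : u \in L j b -> [/\ u \in A0, u != val j & [set val j; u] \in E].
  by move/(subsetP (sL j b)); rewrite in_setI nbP => /andP[/andP[h1 h2] h3].
pose I : finType := (K + (Hb * bool))%type.
pose BI (i : I) : {set {set V}} :=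
  match i with inl k => B k | inr p => star (val p.1) (L p.1 p.2) end.
pose ti (i : I) : {set V} -> V := match i with
  | inl k => if k.1 then tau k else other (tau k)
  | inr p => if p.2 then other (fun=> val p.1) else fun=> val p.1 end.
have starP j b e : e \in star (val j) (L j b) -> exists2 u, u \in L j b & e = [set val j; u].
  by case/imsetP=> u uL ->; exists u.
have dBl k j b : [disjoint B k & star (val j) (L j b)].
  rewrite -setI_eq0; apply/eqP/setP => e; rewrite in_setI in_set0; apply/negP => /andP[/BA[_ eA]].
  case/starP=> u _ ee; move: eA; rewrite ee => /KA0[]; by have [_ /negP] := HbA j.
have dBI i i' : i != i' -> [disjoint BI i & BI i'].
  case: i i' => [k|[j b]] [k'|[j' b']] //= ne.
  - exact: dB.
  - exact: dBl.
  - by rewrite disjoint_sym; exact: dBl.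
  rewrite -setI_eq0; apply/eqP/setP => e; rewrite in_setI in_set0; apply/negP.
  case/andP=> /starP[u uL ee] /starP[u' uL' ee'].
  have [uA uj _] := LP _ _ _ uL; have [uA' uj' _] := LP _ _ _ uL'.
  have [_ jA] := HbA j; have [_ jA'] := HbA j'.
  have : val j \in [set val j'; u'] by rewrite -ee' ee !inE eqxx.
  rewrite in_set2 => /orP[/eqP/val_inj jj|/eqP jj]; last by rewrite jj uA' in jA.
  have : u \in [set val j'; u'] by rewrite -ee' ee !inE eqxx orbT.
  rewrite in_set2 -jj (negPf uj) /= => /eqP uu.
  have bb : b != b' by apply: contraNneq ne => ->; rewrite jj.
  move: uL uL' bb; rewrite -jj -uu; case: (b); case: (b') => // uL uL' _.
    by rewrite (disjointFr (dL j) uL) in uL'.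
  by rewrite (disjointFl (dL j) uL) in uL'.
have tiB i e : e \in BI i -> ti i e \in e.
  case: i => [[b o]|[j b]] /= eB.
    by case: b eB => eB; [exact: tauB|case: (otherP (subsetP (BK _) _ eB) (tauB _ _ eB))].
  have [u uL ee] := starP _ _ _ eB; have [_ uj uE] := LP _ _ _ uL.
  have je : val j \in e by rewrite ee !inE eqxx.
  case: b {eB uL} => //; have eK : e \in Kn setT by rewrite ee (subsetP EK).
  by case: (@otherP _ (fun=> val j) e eK je).
set EA := E :&: Kn A; have EAK : EA \subset Kn setT by apply: subset_trans (subsetIl _ _) EK.
have [t [tE tI]] := glue_tails v0 EAK dBI tiB.
exists t; split=> //.
have A0A : A0 \subset A by apply: subsetDl.
have BEA k e : e \in B k -> e \in EA.
  by case/BA=> eE eA; rewrite in_setI eE (subsetP (KnS A0A)).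
have LEA j b u : u \in L j b -> [set val j; u] \in EA.
  move=> uL; have [uA uj uE] := LP _ _ _ uL; have [jA _] := HbA j.
  by rewrite in_setI uE in_Kn2 eq_sym uj jA (subsetP A0A).
(* Reversing all arcs exchanges the two values of [b]. *)
pose ar b x y := if b then arc EA t x y else arc EA t y x.
have arB b o e : e \in B (b, o) -> ar b (tau (b, o) e) (other (tau (b, o)) e).
  move=> eB; have [_ ot ee] := otherP (subsetP (BK _) _ eB) (tauB _ _ eB).
  have eEA := BEA _ _ eB; have te := tI (inl (b, o)) e eB.
  rewrite /ar /arc; case: b eB ot ee eEA te => eB ot ee eEA /= te.
    by rewrite eq_sym ot -ee eEA te eqxx.
  by rewrite ot setUC -ee eEA te eqxx.
have arL b j u : u \in L j b -> ar b u (val j).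
  move=> uL; have [uA uj uE] := LP _ _ _ uL; have eEA := LEA _ _ _ uL.
  have te := tI (inr (j, b)) [set val j; u] (star_f _ uL).
  rewrite /ar /arc; case: b uL te => uL /= te; last by rewrite eq_sym uj eEA te eqxx.
  rewrite uj setUC eEA te /=.
  have je : val j \in [set val j; u] by rewrite !inE eqxx.
  have [o1 o2 _] := @otherP _ (fun=> val j) _ (subsetP EAK _ eEA) je.
  by move: o1; rewrite in_set2 (negPf o2).
have arN b x y : ar (~~ b) x y = ar b y x by case: b.
have HbP x : x \in A -> x \notin A0 -> exists j : Hb, val j = x.
  move=> xA; rewrite in_setD xA andbT negbK => xH; by exists (exist _ x xH).
have qd : q <= d by move: q_gt1; clear; lia.
split.
  have : 3 * d <= #|A| by apply: leq_trans big_A0 (subset_leq_card A0A).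
  by apply: leq_trans; move: q_gt1; clear; lia.
move=> X Y XA YA X0 Y0 dXY Sq; apply: NNPP => noarc.
set S := A :\: (X :|: Y) in Sq.
have SA0 : #|S :&: A0| < q by apply: leq_ltn_trans Sq; apply/subset_leq_card/subsetIl.
(* Applied to X with out-arcs and to Y with in-arcs: no hub lies on the opposite side, and the last
   base gives the weighted count. *)
have side b (P Q : {set V}) : P \subset A -> P != set0 -> A :\: (P :|: Q) = S ->
    (forall x y, x \in P -> y \in Q -> ~~ ar b x y) ->
    (forall j : Hb, val j \in P :|: S) /\
    q * d <= q * #|(P :&: A0) :&: R| + d * #|S :&: A0|.
  move=> PA P0 eS dead.
  have inPS x : x \in A -> x \notin Q -> x \in P :|: S.
    by move=> xA xQ; rewrite in_setU -eS in_setD in_setU (negPf xQ) xA orbF andbT orbN.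
  have deadB o e : e \in B (b, o) -> tau (b, o) e \in P :&: A0 ->
      e \subset (P :&: A0) :|: (S :&: A0).
    move=> eB /setIP[tP tA]; have [oe ot ee] := otherP (subsetP (BK _) _ eB) (tauB _ _ eB).
    have [_ eA] := BA _ _ eB; rewrite ee in eA; have [_ oA] := KA0 _ _ eA.
    rewrite ee -setIUl subUset !sub1set !(in_setI _ (_ :|: _)) tA oA in_setU tP /= andbT.
    apply: inPS; first exact: (subsetP A0A).
    by apply: contraL (arB _ _ _ eB) => oQ; apply: dead.
  have [v vP] : exists v, v \in P :&: A0.
    have [x xP] := set0Pn _ P0; have xA := subsetP PA _ xP.
    have [xA0|xA0] := boolP (x \in A0); first by exists x; rewrite in_setI xP.
    have [j jx] := HbP x xA xA0.
    (* If P consisted of hubs only, the d leaves that such a hub reaches would all be in S, but d >=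
       q. *)
    apply: NNPP => noP; have : L j (~~ b) \subset S :&: A0.
      apply/subsetP => u uL; have [uA _ _] := LP _ _ _ uL; rewrite in_setI uA andbT.
      have : u \in P :|: S.
        apply: inPS; first exact: (subsetP A0A).
        by apply: contraL (arL _ _ _ uL) => uQ; rewrite arN; apply: dead; rewrite ?jx.
      case/setUP=> // uP; case: noP; by exists u; rewrite in_setI uP.
    move/subset_leq_card; rewrite cL => h; have := leq_ltn_trans h SA0.
    by rewrite ltnNge qd.
  have vA : v \in A0 by case/setIP: vP.
  have szP o : v \notin LS (b, o) -> d <= #|(P :&: A0) :|: (S :&: A0)|.
    move=> vL; apply: (dead_size (BK (b, o)) (tauB _) vP _ (deadB o)).
    by have := tauD (b, o) v vA; rewrite (negPf vL) muln0 addn0.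
  have szP' : d <= #|(P :&: A0) :|: (S :&: A0)|.
    have [vR|vR] := boolP (v \in R); last exact: (szP None).
    by apply: (szP (Some j0)); apply: Rj0.
  have wt o := dead_weight rP q_gt1 (iB (b, o)) (BK (b, o)) (tauB _)
    (fun u (uP : u \in P :&: A0) => tauD (b, o) u (subsetP (subsetIr _ _) _ uP)) (deadB o) szP'.
  split=> [j|]; last exact: (wt None).
  (* With its hub in Q, the base of j has none of its deficit vertices in P, since each of them has
     an arc to the hub. The count then gives q vertices in [S :&: A0]. *)
  have [jA _] := HbA j; apply: inPS => //; apply/negP => jQ.
  have e0 : (P :&: A0) :&: LS (b, Some j) = set0.
    apply/setP => u; rewrite in_setI in_set0; apply/negP => /andP[/setIP[uP _] uL].
    by have := arL _ _ _ uL; apply/negP; apply: dead.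
  have := wt (Some j); rewrite e0 cards0 muln0 add0n mulnC leq_pmul2l //.
  by rewrite leqNgt SA0.
have noarc' x y : x \in X -> y \in Y -> ~~ arc EA t x y.
  by move=> xX yY; apply/negP => a; apply: noarc; exists x, y.
have [hX wX] := side true X Y XA X0 erefl noarc'.
have eS : A :\: (Y :|: X) = S by rewrite setUC.
have [hY wY] := side false Y X YA Y0 eS (fun x y xY yX => noarc' y x yX xY).
have HS : Hub \subset S.
  apply/subsetP => x xH; have := hX (exist _ x xH); have := hY (exist _ x xH) => /=.
  by move=> /setUP[xY|//] /setUP[xX|//]; rewrite (disjointFr dXY xX) in xY.
have cS : #|S :&: A0| + q./2 <= #|S|.
  rewrite -cHub -cards_disjU; last first.
    rewrite -setI_eq0; apply/eqP/setP => x; rewrite in_set0 !in_setI [x \in A0]in_setD.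
    by case: (x \in Hub); rewrite ?andbF.
  by apply: subset_leq_card; rewrite subUset subsetIl HS.
have cRR : #|(X :&: A0) :&: R| + #|(Y :&: A0) :&: R| <= d.
  rewrite -cR -cards_disjU; last first.
    rewrite -setI_eq0; apply/eqP/setP => x; rewrite in_set0 !in_setI.
    by case: (boolP (x \in X)) => //= xX; rewrite (disjointFr dXY xX) /= andbF.
  by apply: subset_leq_card; rewrite subUset !subsetIr.
(* Adding the two counts for the last pair and using that X and Y share the d vertices of R gives
   2|S & A0| >= q. Together with the q/2 hubs, rounded down, S has at least q vertices. *)
have : q * d <= d * (2 * #|S :&: A0|).
  have h1 : q * (#|(X :&: A0) :&: R| + #|(Y :&: A0) :&: R|) <= q * d by rewrite leq_mul2l cRR orbT.
  rewrite mulnDr in h1; rewrite mulnCA.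
  by move: wX wY h1; clear; lia.
rewrite mulnC leq_pmul2l //; have := odd_double_half q; rewrite -mul2n.
by move: Sq cS; case: (odd q); clear; lia.
Qed.

End Hub.

Lemma sparse_orientation : 2 * q - 1 <= #|A| /\
  exists t, (forall e, e \in E :&: Kn A -> t e \in e) /\ qcut q (arc (E :&: Kn A) t) A.
Proof.
have [v vA] := set0Pn _ A_neq0.
have dA : d <= #|A|.
  have : deg E A v <= #|A| by apply/subset_leq_card/subsetIr.
  have := mindeg vA; have := q2_big; move: q_big.
  by move: (deg _ _ _) (q ^ 2) => x y; clear; lia.
split=> //; have [|Hub [HubA cHub]] := @ex_subset_card _ A q./2.
  apply: leq_trans dA; apply: leq_trans (half_leq (leqnn q)) _.
  by have := odd_double_half q; rewrite -mul2n; move: q_big; clear; lia.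
exact: hub_orientation HubA cHub.
Qed.

End SparseOrientation.

(** * The bound *)

(** At k = 0 the bound 65 <= 2^7 suffices. In the step, 5(x+1)^2 <= 6x^2 for x >= 65, so the fourth
    power grows by a factor of at most 36/25. *)
Lemma quartic_lt_pow2 k : (k + 65) ^ 4 < 2 ^ (k + 35).
Proof.
elim: k => [|k IHk].
  apply: (@leq_ltn_trans ((2 ^ 7) ^ 4)); first by rewrite leq_exp2r.
  by rewrite -expnM ltn_exp2l.
rewrite !addSn (expnS 2); apply: (@leq_ltn_trans (2 * (k + 65) ^ 4)); last by rewrite ltn_pmul2l.
have : 65 <= k + 65 by rewrite leq_addl.
move: (k + 65) => x hx; rewrite (expnM _ 2 2) (expnM x 2 2).
have h : 5 * x.+1 ^ 2 <= 6 * x ^ 2.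
  by rewrite -!mulnn; have := leq_mul hx (leqnn x); move: hx; clear; nia.
move: (x.+1 ^ 2) (x ^ 2) h => a b h; rewrite -!mulnn.
have := leq_mul h h; rewrite (mulnACA 5 a) (mulnACA 6 b); move: (a * a) (b * b); clear; lia.
Qed.

Lemma pow2_big q : 64 <= q %/ 60 -> 18 * q ^ 4 < 2 ^ (q %/ 60).
Proof.
move=> hq; have [k ek] : exists k, q %/ 60 = k + 64.
  by exists (q %/ 60 - 64); rewrite subnK.
have lt : q < 60 * (k + 65).
  by rewrite mulnC; have := ltn_ceil q (isT : 0 < 60); rewrite ek -addnS.
apply: (@leq_ltn_trans (2 ^ 5 * (2 ^ 6 * (k + 65)) ^ 4)).
  apply: leq_mul => //; rewrite leq_exp2r //; apply: leq_trans (ltnW lt) _.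
  by rewrite leq_mul2r orbC.
have -> : q %/ 60 = 29 + (k + 35) by rewrite ek; clear; lia.
rewrite expnMn mulnA -expnM -expnD (expnD 2 29) ltn_pmul2l ?expn_gt0 //; exact: quartic_lt_pow2.
Qed.

(** The divisor 60 is 20 times 3: for |W| <= 2^(q/60) the bound 3q|W|log|W| is at most q^2|W|/20. *)
Lemma sparse_of_no_expander (V : finType) (E : {set {set V}}) q : E \subset Kn setT ->
  (forall W : {set V}, 1 < #|W| -> ~ expander (3 * q) E W) ->
  forall W : {set V}, #|W| <= 2 ^ (q %/ 60) -> 20 * ind E W <= q ^ 2 * #|W|.
Proof.
move=> EK noex W cW.
have := no_expander_sparse (c := 3 * q) (W := W) EK (fun W' _ => noex W').
have lg : trunc_log 2 #|W| <= q %/ 60.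
  by rewrite -(@trunc_expnK 2 (q %/ 60)) // leq_trunc_log.
have := leq_trunc_div q 60; move: lg; rewrite -mulnn.
move: (trunc_log 2 _) (q %/ 60) => l m lm mq h.
have : q * #|W| * (l * 60) <= q * #|W| * q.
  by rewrite leq_mul2l; apply/orP; right; apply: leq_trans mq; rewrite leq_mul2r lm orbT.
by move: h; clear; nia.
Qed.

Theorem forces_orientation_quadratic q : 64 <= q %/ 60 -> forces_orientation q (8 * q ^ 2).
Proof.
move=> hq G conn; have q_big : 100 <= q.
  by have := leq_trunc_div q 60; apply: leq_trans; apply: (@leq_trans (64 * 60)); rewrite // leq_mul2r hq orbT.
have q_gt1 : 1 < q by apply: leq_trans q_big.
pose d := 2 * q - 1; have [r rP] := generic_rigid G d.
have EK := edges_Kn G; have sc := k_connected_sconn conn.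
have [v0 _] : exists v0 : G, v0 \in [set: G].
  by apply/card_gt0P; case: sc => h _; apply: leq_trans h.
have kD : 4 * 'C(d.+1, 2) <= 8 * q ^ 2.
  rewrite (binom_dq q_gt1) -mulnn; apply: (@leq_trans (4 * (q * (2 * q)))); last by clear; lia.
  by rewrite leq_mul2l leq_mul2l leq_subr !orbT.
have [W0 [dW0 [t [tE cut]]]] : exists W0 : {set G}, d <= #|W0| /\ exists t : {set G} -> G,
    (forall e, e \in edges G :&: Kn W0 -> t e \in e) /\ qcut q (arc (edges G :&: Kn W0) t) W0.
  have [[W [W1 ex]]|noex] := classic (exists W : {set G}, 1 < #|W| /\ expander (3 * q) (edges G) W).
    have [cW ht] := expander_qcut ex (ltnW q_gt1) EK W1.
    by exists W; split=> //; apply: leq_trans cW; apply: leq_subr.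
  have sp := sparse_of_no_expander (q := q) EK (fun W W1 ex => noex (ex_intro _ W (conj W1 ex))).
  have Nb := pow2_big hq.
  have md v : 8 * q ^ 2 <= #|nb (edges G) v|.
    by have := sconn_mindeg sc (in_setT v); rewrite setIT.
  have [A [A0 mA sA]] := sparse_core EK (ltnW q_gt1) Nb md sp v0.
  by exists A; apply: (sparse_orientation rP EK q_big Nb sp A0 mA sA).
have [t' [t'E cut']] := orient_extend rP erefl q_gt1 kD EK sc dW0 tE cut.
exact: qcut_orientation t'E cut'.
Qed.

Lemma has_k_connected_orientationS q q' (G : sgraph) : q <= q' ->
  has_k_connected_orientation q' G -> has_k_connected_orientation q G.
Proof.
move=> le [D [oD [cD hD]]]; exists D; split=> //; split; first exact: leq_ltn_trans cD.
by move=> S cS; apply: hD; apply: leq_trans cS le.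
Qed.

(** For q below the threshold, a forcing value is taken from a larger q', because a q'-connected
    orientation is also q-connected. *)
Lemma least_forcing_exists q : exists m, 0 < q -> is_least_forcing q m.
Proof.
pose q' := maxn q (64 * 60); have hq' : 64 <= q' %/ 60 by rewrite leq_divRL // leq_maxr.
have : exists k, 0 < k /\ forces_orientation q k.
  exists (8 * q' ^ 2); split; last first.
    move=> G /(forces_orientation_quadratic hq'); apply: has_k_connected_orientationS.
    exact: leq_maxl.
  by rewrite muln_gt0 expn_gt0 /q' leq_max orbT.
case=> k; elim/ltn_ind: k => k IHk [k0 fk].
have [[l [lk [l0 fl]]]|h] := classic (exists l, l < k /\ 0 < l /\ forces_orientation q l).
  by apply: (IHk l lk).
exists k => _; split=> // l l0 fl; rewrite leqNgt; apply/negP => lk; apply: h.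
by exists l.
Qed.

From mathcomp Require Import all_classical all_reals all_analysis.
Import Order.TTheory GRing.Theory Num.Theory.
Import numFieldNormedType.Exports.
Local Open Scope classical_set_scope.
Local Open Scope ring_scope.

Theorem theorem1p9 (R : realType) :
  exists f : nat -> nat,
    (forall q : nat, (0 < q)%N -> is_least_forcing q (f q)) /\
    (exists q0 : nat, forall q : nat, (q0 <= q)%N ->
       (f q <= 8 * q ^ 2 + 212 * q + 1404)%N) /\
    (exists e : nat -> R, e =o_\oo (fun _ : nat => 1 : R) /\
       \forall q \near \oo, (f q)%:R <= (8 + e q) * q%:R ^+ 2).
Proof.
have [f hf] := choice least_forcing_exists.
have bound q : (64 * 60 <= q)%N -> (f q <= 8 * q ^ 2)%N.
  move=> hq; have q0 : (0 < q)%N by apply: leq_trans hq.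
  have [_ _ least] := hf q q0; apply: least; first by rewrite muln_gt0 expn_gt0 q0.
  by apply: forces_orientation_quadratic; rewrite leq_divRL.
exists f; split; first exact: hf.
split.
  (* The threshold 3840 is the range q/60 >= 64 of [pow2_big]. *)
  exists (64 * 60)%N => q /bound /leq_trans; apply.
  by rewrite -addnA leq_addr.
(* The bound 8q^2 has no lower-order term, so the error sequence can be zero. *)
exists (fun=> 0); split.
  by apply/eqoP => eps eps0; near=> n; rewrite normr0 mulr_ge0 // ltW.
exists (64 * 60)%N => // q /= /bound; rewrite -(ler_nat R) => h.
by rewrite addr0; apply: le_trans h _; rewrite natrM natrX.
Unshelve. all: by end_near.
Qed.
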